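(* For every $n\ge 1$, the natural homomorphisms $\pi_1\,\mathcal{UR}_n\to\pi_1\mathcal R_n$, $\pi_1\,\mathcal{UR}_n\to\pi_1\mathcal{VR}_n$, and $\pi_1\,\mathcal{UW}_n\to\pi_1\mathcal W_n$ induced by the inclusions $\mathcal{UR}_n\hookrightarrow\mathcal R_n$, $\mathcal{UR}_n\hookrightarrow\mathcal{VR}_n$, and $\mathcal{UW}_n\hookrightarrow\mathcal W_n$ are injective.
   Context: A ring is a Euclidean (round) circle in $\mathbb R^3$. $\mathcal R_n$ is the space of unordered configurations of $n$ disjoint, pairwise unlinked (unoriented) rings in $\mathbb R^3$, topologized by the centers, radii and planes of the rings. Subspaces: $\mathcal{UR}_n$ consists of configurations of rings lying in planes parallel to the $yz$-plane; $\mathcal{VR}_n$ of configurations of rings lying in vertical planes (planes parallel to the $z$-axis); $\mathcal W_n$ of configurations of rings each of which lies in a vertical plane and is cut into two equal halves by the $xy$-plane; $\mathcal{UW}_n=\mathcal W_n\cap\mathcal{UR}_n$. All these spaces are path-connected. *)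

(* Defs.v *)
From HB Require Import structures.
From mathcomp Require Import all_boot all_order all_algebra.
From mathcomp Require Import all_classical all_reals all_analysis.
From mathcomp Require Import lra.

Set Implicit Arguments.
Unset Strict Implicit.
Unset Printing Implicit Defensive.

Import Order.TTheory GRing.Theory Num.Theory.
Import numFieldNormedType.Exports.

Local Open Scope classical_set_scope.
Local Open Scope ring_scope.


Section continuity_combinators.
Context {R : realType}.

Lemma cts_comp (T U V : topologicalType) (g : U -> V) (f : T -> U) :
  continuous g -> continuous f -> continuous (fun t => g (f t)).
Proof. by move=> cg cf t; apply: (@continuous_comp _ _ _ f g); [exact: cf|exact: cg]. Qed.

Lemma cts_pair (T U V : topologicalType) (f : T -> U) (g : T -> V) :
  continuous f -> continuous g -> continuous (fun t => (f t, g t)).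
Proof. by move=> cf cg t; apply: cvg_pair; [exact: cf|exact: cg]. Qed.

Lemma cts_fst (T U : topologicalType) : continuous (fun p : T * U => p.1).
Proof. by move=> p; exact: cvg_fst. Qed.

Lemma cts_snd (T U : topologicalType) : continuous (fun p : T * U => p.2).
Proof. by move=> p; exact: cvg_snd. Qed.

Lemma cts_cst (T U : topologicalType) (u : U) : continuous (fun _ : T => u).
Proof. by move=> t; exact: cvg_cst. Qed.

Lemma cts_id (T : topologicalType) : continuous (fun t : T => t).
Proof. by move=> t; exact: cvg_id. Qed.

Lemma cts_aff (T : topologicalType) (a b : R) (f : T -> R) :
  continuous f -> continuous (fun t => a * f t + b).
Proof.
move=> cf t; apply: (@cvgD _ R); last exact: cvg_cst.
by apply: cvgM; [exact: cvg_cst|exact: cf].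
Qed.

Lemma cts_min (T : topologicalType) (u v : T -> R) :
  continuous u -> continuous v -> continuous (fun s => Num.min (u s) (v s)).
Proof.
by move=> cu cv s; apply: (@continuous_min R T u v); [exact: cu|exact: cv].
Qed.

Lemma cts_max (T : topologicalType) (u v : T -> R) :
  continuous u -> continuous v -> continuous (fun s => Num.max (u s) (v s)).
Proof.
by move=> cu cv s; apply: (@continuous_max R T u v); [exact: cu|exact: cv].
Qed.

End continuity_combinators.

Section clamp.
Context {R : realType}.
Implicit Types s t : R.

Definition clamp t : R := Num.max 0 (Num.min 1 t).

Lemma clamp_ge0 t : 0 <= clamp t.
Proof. by rewrite /clamp le_max lexx. Qed.

Lemma clamp_le1 t : clamp t <= 1.
Proof. by rewrite /clamp ge_max ler01 ge_min lexx. Qed.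

Lemma clamp_itv t : `[0, 1]%classic (clamp t).
Proof. by rewrite /= in_itv /= clamp_ge0 clamp_le1. Qed.

Lemma clampE t : 0 <= t <= 1 -> clamp t = t.
Proof. by move=> /andP[t0 t1]; rewrite /clamp (min_r t1) (max_r t0). Qed.

Lemma clamp_continuous : continuous clamp.
Proof.
apply: cts_max; first exact: cts_cst.
by apply: cts_min; [exact: cts_cst|exact: cts_id].
Qed.

Definition clamp2 (p : R * R) : R * R := (clamp p.1, clamp p.2).

Lemma clamp2_itv p : (`[0, 1]%classic `*` `[0, 1]%classic) (clamp2 p).
Proof. by split; exact: clamp_itv. Qed.

Lemma clamp2_continuous : continuous clamp2.
Proof.
by apply: cts_pair; apply: (cts_comp clamp_continuous);
  [exact: cts_fst|exact: cts_snd].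
Qed.

End clamp.

Section continuity.
Context {R : realType}.

Lemma within_comp (T U V : topologicalType) (A : set U) (f : U -> V)
    (g : T -> U) : {within A, continuous f} -> continuous g ->
  (forall x, A (g x)) -> continuous (f \o g).
Proof.
move=> /subspace_continuousP cf cg Ag x W fW.
have /= := cf _ (Ag x) _ fW; rewrite /within /= => H.
have K : nbhs x (fun y => A (g y) -> W (f (g y))) := cg x _ H.
by apply: (@filterS _ (nbhs x) _ _ _ _ K) => y /=; apply; exact: Ag.
Qed.

Lemma within_ext (U V : topologicalType) (A : set U) (f g : U -> V) :
  (forall x, A x -> f x = g x) -> continuous f -> {within A, continuous g}.
Proof.
move=> fg cf; apply: (@subspace_eq_continuous _ A V f).
  by move=> x /set_mem/fg.
exact: continuous_subspaceT.
Qed.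

Lemma continuous_paste (T X : topologicalType) (h : T -> R) (c : R)
    (f g : T -> X) : continuous h -> continuous f -> continuous g ->
  (forall p, h p = c -> f p = g p) ->
  continuous (fun p => if h p <= c then f p else g p).
Proof.
move=> ch cf cg fg; apply/continuous_subspace_setT.
have -> : [set: T] = h @^-1` [set y | y <= c] `|` h @^-1` [set y | c <= y].
  by apply/seteqP; split => // p _ /=; apply/orP; exact: le_total.
apply: withinU_continuous.
- by apply: preimage_closed => //; exact: closed_le.
- by apply: preimage_closed => //; exact: closed_ge.
- by apply: (within_ext _ cf) => p /= ->.
- apply: (within_ext _ cg) => p /= hp; case: ifPn => // hp'.
  by rewrite fg//; apply/eqP; rewrite eq_le hp hp'.
Qed.

End continuity.

Section loops.
Context {R : realType} (X : topologicalType) (x : X).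

(* Only the restriction of a loop to [0, 1] matters: two loops that agree on
   [0, 1] are homotopic. *)
Record loop := Loop {
  loop_fun :> R -> X;
  loop_cts : {within `[0, 1]%classic, continuous loop_fun};
  loop0 : loop_fun 0 = x;
  loop1 : loop_fun 1 = x }.

HB.instance Definition _ := gen_eqMixin loop.
HB.instance Definition _ := gen_choiceMixin loop.

Definition loop_homotopic (f g : loop) : Prop := exists H : R * R -> X,
  [/\ {within `[0, 1]%classic `*` `[0, 1]%classic, continuous H},
      forall s, 0 <= s <= 1 -> H (s, 0) = f s,
      forall s, 0 <= s <= 1 -> H (s, 1) = g s &
      forall t, 0 <= t <= 1 -> H (0, t) = x /\ H (1, t) = x].

Lemma clamp_loop_continuous (f : loop) : continuous (f \o clamp).
Proof.
exact: (within_comp (@loop_cts f) clamp_continuous clamp_itv).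
Qed.

Lemma clamp_loop_comp (T : topologicalType) (f : loop) (h : T -> R) :
  continuous h -> continuous (fun t => f (clamp (h t))).
Proof. exact: (cts_comp (@clamp_loop_continuous f)). Qed.

Lemma loop_homotopicP (f g : loop) : loop_homotopic f g <->
  exists H : R * R -> X, [/\ continuous H,
      forall s, H (s, 0) = f (clamp s),
      forall s, H (s, 1) = g (clamp s) &
      forall t, H (0, t) = x /\ H (1, t) = x].
Proof.
have c0 : clamp (0 : R) = 0 by rewrite clampE// lexx ler01.
have c1 : clamp (1 : R) = 1 by rewrite clampE// lexx ler01.
have cl (t : R) : 0 <= clamp t <= 1 by rewrite clamp_ge0 clamp_le1.
split=> -[H [cH H0 H1 Hb]].
  exists (H \o clamp2); split => [|s|s|t] /=; rewrite /clamp2 /= ?c0 ?c1 ?H0 ?H1 //.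
    exact: (within_comp cH clamp2_continuous clamp2_itv).
  exact: Hb.
exists H; split=> [|s s01|s s01|t _]; rewrite ?H0 ?H1 ?clampE //.
exact: continuous_subspaceT.
Qed.

Lemma loop_homotopic_refl f : loop_homotopic f f.
Proof.
apply/loop_homotopicP; exists (fun p => f (clamp p.1)); split=> //=.
  by apply: (@clamp_loop_comp _ f); exact: cts_fst.
by move=> t; rewrite !clampE ?lexx ?ler01 // loop0 loop1.
Qed.

Lemma loop_homotopic_sym f g : loop_homotopic f g -> loop_homotopic g f.
Proof.
move=> /loop_homotopicP[H [cH H0 H1 Hb]]; apply/loop_homotopicP.
exists (fun p => H (p.1, -1 * p.2 + 1)); split=> [|s|s|t] /=.
- apply: (cts_comp cH); apply: cts_pair; first exact: cts_fst.
  by apply: cts_aff; exact: cts_snd.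
- by rewrite mulr0 add0r.
- by rewrite mulr1 addNr.
- exact: Hb.
Qed.

Lemma loop_homotopic_trans f g h :
  loop_homotopic f g -> loop_homotopic g h -> loop_homotopic f h.
Proof.
move=> /loop_homotopicP[H [cH H0 H1 Hb]] /loop_homotopicP[K [cK K0 K1 Kb]].
apply/loop_homotopicP.
exists (fun p => if p.2 <= 2^-1 then H (p.1, 2 * p.2 + 0) else K (p.1, 2 * p.2 + -1)).
split=> [|s|s|t] /=.
- apply: continuous_paste => [|||[s t] /= ->].
  + exact: cts_snd.
  + apply: (cts_comp cH); apply: cts_pair; first exact: cts_fst.
    by apply: cts_aff; exact: cts_snd.
  + apply: (cts_comp cK); apply: cts_pair; first exact: cts_fst.
    by apply: cts_aff; exact: cts_snd.
  + by rewrite divff// addr0 subrr H1 K0.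
- by rewrite invr_ge0 ler0n mulr0 addr0.
- by rewrite ifF; [rewrite mulr1 (_ : 2 - 1 = 1)//; lra|apply/negbTE; lra].
- by case: ifP => _; [exact: Hb|exact: Kb].
Qed.

Lemma loop_reparam (f g h : loop) (phi psi : R -> R) :
  continuous phi -> continuous psi ->
  phi 0 = psi 0 -> phi 1 = psi 1 ->
  (forall s, 0 <= s <= 1 -> f s = h (clamp (phi s))) ->
  (forall s, 0 <= s <= 1 -> g s = h (clamp (psi s))) ->
  loop_homotopic f g.
Proof.
move=> cphi cpsi e0 e1 fE gE.
exists (fun p => h (clamp ((1 - p.2) * phi p.1 + p.2 * psi p.1))).
split=> [|s s01|s s01|t t01] /=.
- apply: continuous_subspaceT; apply: (@clamp_loop_comp _ h).
  move=> p; apply: (@cvgD _ R); apply: (@cvgM R).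
  + by apply: (@cvgB _ R); [exact: cvg_cst|exact: cvg_snd].
  + exact: (cts_comp cphi (@cts_fst _ _)).
  + exact: cvg_snd.
  + exact: (cts_comp cpsi (@cts_fst _ _)).
- by rewrite fE// subr0 mul1r mul0r addr0.
- by rewrite gE// subrr mul1r mul0r add0r.
- have a (u : R) : (1 - t) * u + t * u = u by rewrite -mulrDl subrK mul1r.
  rewrite e0 e1 !a -e0 -e1 -!fE ?lexx ?ler01//.
  by rewrite loop0 loop1.
Qed.

Definition concat_fun (f g : R -> X) (s : R) : X :=
  if s <= 2^-1 then f (2 * s) else g (2 * s - 1).

Lemma concat_cts (f g : loop) : {within `[0, 1]%classic, continuous (concat_fun f g)}.
Proof.
apply: (@within_ext R X _
  (fun s => if s <= 2^-1 then f (clamp (2 * s + 0)) else g (clamp (2 * s + -1)))).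
  move=> s /=; rewrite in_itv /= => /andP[s0 s1]; rewrite /concat_fun.
  by case: ifPn => hs; rewrite clampE ?addr0//; lra.
apply: continuous_paste => [|||s ->].
- exact: cts_id.
- by apply: (@clamp_loop_comp _ f); apply: cts_aff; exact: cts_id.
- by apply: (@clamp_loop_comp _ g); apply: cts_aff; exact: cts_id.
- by rewrite divff// addr0 subrr !clampE ?lexx ?ler01// loop0 loop1.
Qed.

Lemma concat0 (f g : loop) : concat_fun f g 0 = x.
Proof. by rewrite /concat_fun invr_ge0 ler0n mulr0 loop0. Qed.

Lemma concat1 (f g : loop) : concat_fun f g 1 = x.
Proof.
rewrite /concat_fun ifF; last by apply/negbTE; lra.
by rewrite mulr1 (_ : 2 - 1 = 1); [rewrite loop1|lra].
Qed.

Definition loop_concat (f g : loop) : loop :=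
  Loop (@concat_cts f g) (concat0 f g) (concat1 f g).

Lemma reverse_cts (f : loop) :
  {within `[0, 1]%classic, continuous (fun s => f (1 - s))}.
Proof.
apply: (@within_ext R X _ (fun s => f (clamp (-1 * s + 1)))).
  move=> s /=; rewrite in_itv /= => /andP[s0 s1]; rewrite clampE; last lra.
  by congr (_ _); lra.
by apply: (@clamp_loop_comp _ f); apply: cts_aff; exact: cts_id.
Qed.

Lemma reverse0 (f : loop) : f (1 - 0) = x.
Proof. by rewrite subr0 loop1. Qed.

Lemma reverse1 (f : loop) : f (1 - 1) = x.
Proof. by rewrite subrr loop0. Qed.

Definition loop_reverse (f : loop) : loop :=
  Loop (@reverse_cts f) (reverse0 f) (reverse1 f).

Lemma const_cts : {within `[0, 1 : R], continuous (fun _ : R => x)}.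
Proof. by apply: continuous_subspaceT => s; exact: cvg_cst. Qed.

Definition loop_const : loop := Loop const_cts erefl erefl.

Lemma loop_concat_homotopic (f f' g g' : loop) :
  loop_homotopic f f' -> loop_homotopic g g' ->
  loop_homotopic (loop_concat f g) (loop_concat f' g').
Proof.
move=> /loop_homotopicP[H [cH H0 H1 Hb]] /loop_homotopicP[K [cK K0 K1 Kb]].
exists (fun p => if p.1 <= 2^-1 then H (2 * p.1 + 0, p.2)
                 else K (2 * p.1 + -1, p.2)).
split=> [|s s01|s s01|t _] /=.
- apply: continuous_subspaceT; apply: continuous_paste => [|||[s t] /= ->].
  + exact: cts_fst.
  + apply: (cts_comp cH); apply: cts_pair; last exact: cts_snd.
    by apply: cts_aff; exact: cts_fst.
  + apply: (cts_comp cK); apply: cts_pair; last exact: cts_snd.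
    by apply: cts_aff; exact: cts_fst.
  + by rewrite divff// addr0 subrr (Hb t).2 (Kb t).1.
- by rewrite /concat_fun H0 K0; case: ifPn => hs; rewrite clampE ?addr0//; lra.
- by rewrite /concat_fun H1 K1; case: ifPn => hs; rewrite clampE ?addr0//; lra.
- rewrite invr_ge0 ler0n mulr0 addr0 (Hb t).1; split=> //.
  rewrite ifF; last by apply/negbTE; lra.
  by rewrite mulr1 (_ : 2 - 1 = 1); [exact: (Kb t).2|lra].
Qed.

Lemma loop_reverse_homotopic (f g : loop) :
  loop_homotopic f g -> loop_homotopic (loop_reverse f) (loop_reverse g).
Proof.
move=> /loop_homotopicP[H [cH H0 H1 Hb]].
exists (fun p => H (-1 * p.1 + 1, p.2)); split=> [|s s01|s s01|t _] /=.
- apply: continuous_subspaceT; apply: (cts_comp cH).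
  apply: cts_pair; last exact: cts_snd.
  by apply: cts_aff; exact: cts_fst.
- by rewrite H0 clampE; [congr (_ _)|]; lra.
- by rewrite H1 clampE; [congr (_ _)|]; lra.
- by rewrite mulr0 add0r mulr1 addNr (Hb t).1 (Hb t).2.
Qed.

Lemma loop_concatA (f g h : loop) :
  loop_homotopic (loop_concat f (loop_concat g h))
                 (loop_concat (loop_concat f g) h).
Proof.
apply: loop_homotopic_sym.
pose phi (s : R) :=
  Num.min (2 * s + 0) (Num.min (1 * s + 4^-1) (2^-1 * s + 2^-1)).
have phiE s : phi s = if s <= 4^-1 then 2 * s else
                      if s <= 2^-1 then s + 4^-1 else 2^-1 * s + 2^-1.
  rewrite /phi; case: (leP (1 * s + 4^-1) (2^-1 * s + 2^-1)) => ?.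
    by rewrite minEle; do ?case: ifPn => ?; lra.
  by rewrite minEle; do ?case: ifPn => ?; lra.
apply: (@loop_reparam _ _ (loop_concat f (loop_concat g h)) phi (fun s => s)).
- by do 2?[apply: cts_min]; apply: cts_aff; exact: cts_id.
- exact: cts_id.
- by rewrite phiE; do ?case: ifPn => ?; lra.
- by rewrite phiE; do ?case: ifPn => ?; lra.
- move=> s s01; rewrite clampE; last by rewrite phiE; do ?case: ifPn => ?; lra.
  rewrite /= /concat_fun phiE.
  case: (leP s 4^-1) => ?; case: (leP s 2^-1) => ?; do ?[by exfalso; lra];
    do ?case: ifPn => ?; do ?[by exfalso; lra]; congr (_ _); lra.
- by move=> s s01; rewrite clampE.
Qed.

Lemma loop_concat1l (f : loop) : loop_homotopic (loop_concat loop_const f) f.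
Proof.
apply: (@loop_reparam _ _ f (fun s => Num.max (0 * s + 0) (2 * s + -1)) (fun s => s)).
- by apply: cts_max; apply: cts_aff; exact: cts_id.
- exact: cts_id.
- by rewrite maxEle; case: ifPn => ?; lra.
- by rewrite maxEle; case: ifPn => ?; lra.
- move=> s s01; rewrite clampE; last by rewrite maxEle; case: ifPn => ?; lra.
  rewrite /= /concat_fun maxEle; do ?case: ifPn => ?; do ?[by exfalso; lra] => //.
  + rewrite (_ : 2 * s + -1 = 0) ?loop0 //; lra.
  + by rewrite mul0r addr0 loop0.
- by move=> s s01; rewrite clampE.
Qed.

Lemma loop_concat1r (f : loop) : loop_homotopic (loop_concat f loop_const) f.
Proof.
apply: (@loop_reparam _ _ f (fun s => Num.min (0 * s + 1) (2 * s + 0)) (fun s => s)).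
- by apply: cts_min; apply: cts_aff; exact: cts_id.
- exact: cts_id.
- by rewrite minEle; case: ifPn => ?; lra.
- by rewrite minEle; case: ifPn => ?; lra.
- move=> s s01; rewrite clampE; last by rewrite minEle; case: ifPn => ?; lra.
  rewrite /= /concat_fun minEle; do ?case: ifPn => ?; do ?[by exfalso; lra].
  + by congr (_ _); lra.
  + by congr (_ _); lra.
  + by rewrite mul0r add0r loop1.
- by move=> s s01; rewrite clampE.
Qed.

Lemma loop_concatVl (f : loop) :
  loop_homotopic (loop_concat (loop_reverse f) f) loop_const.
Proof.
apply: (@loop_reparam _ _ f
  (fun s => Num.max (-2 * s + 1) (2 * s + -1)) (fun _ => 1)).
- by apply: cts_max; apply: cts_aff; exact: cts_id.
- by move=> s; exact: cvg_cst.
- by rewrite /= maxEle; case: ifPn => ?; lra.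
- by rewrite /= maxEle; case: ifPn => ?; lra.
- move=> s s01; rewrite clampE; last by rewrite maxEle; case: ifPn => ?; lra.
  rewrite /= /concat_fun maxEle; do ?case: ifPn => ?;
    do ?[by exfalso; lra]; by congr (_ _); lra.
- by move=> s s01; rewrite clampE /= ?lexx ?ler01// loop1.
Qed.

Lemma loop_concatVr (f : loop) :
  loop_homotopic (loop_concat f (loop_reverse f)) loop_const.
Proof.
apply: (@loop_reparam _ _ f
  (fun s => Num.min (2 * s + 0) (-2 * s + 2)) (fun _ => 0)).
- by apply: cts_min; apply: cts_aff; exact: cts_id.
- by move=> s; exact: cvg_cst.
- by rewrite /= minEle; case: ifPn => ?; lra.
- by rewrite /= minEle; case: ifPn => ?; lra.
- move=> s s01; rewrite clampE; last by rewrite minEle; case: ifPn => ?; lra.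
  rewrite /= /concat_fun minEle; do ?case: ifPn => ?;
    do ?[by exfalso; lra]; by congr (_ _); lra.
- by move=> s s01; rewrite clampE /= ?lexx ?ler01// loop0.
Qed.

Definition loop_equiv : rel loop := fun f g => `[< loop_homotopic f g >].

Lemma loop_equiv_refl : reflexive loop_equiv.
Proof. by move=> f; apply/asboolP; exact: loop_homotopic_refl. Qed.

Lemma loop_equiv_sym : symmetric loop_equiv.
Proof.
by move=> f g; apply/asboolP/asboolP; exact: loop_homotopic_sym.
Qed.

Lemma loop_equiv_trans : transitive loop_equiv.
Proof.
move=> g f h /asboolP fg /asboolP gh; apply/asboolP.
exact: loop_homotopic_trans fg gh.
Qed.

Canonical loop_equiv_rel :=
  EquivRel loop_equiv loop_equiv_refl loop_equiv_sym loop_equiv_trans.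

Local Open Scope quotient_scope.

Definition pi1 := {eq_quot loop_equiv}.

HB.instance Definition _ := Choice.on pi1.
HB.instance Definition _ := EqQuotient.on pi1.

Definition loop_class (f : loop) : pi1 := \pi_pi1 f.

Lemma loop_classP (f g : loop) :
  loop_class f = loop_class g <-> loop_homotopic f g.
Proof.
by split=> [/eqmodP/asboolP//|fg]; apply/eqmodP/asboolP.
Qed.

Lemma repr_loop_class (f : loop) : loop_homotopic (repr (loop_class f)) f.
Proof. by apply/loop_classP; rewrite /loop_class reprK. Qed.

Lemma loop_class_repr (a : pi1) : loop_class (repr a) = a.
Proof. exact: reprK. Qed.

Definition pi1_one : pi1 := loop_class loop_const.
Definition pi1_mul (a b : pi1) : pi1 :=
  loop_class (loop_concat (repr a) (repr b)).
Definition pi1_inv (a : pi1) : pi1 := loop_class (loop_reverse (repr a)).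

Lemma pi1_mulE f g :
  pi1_mul (loop_class f) (loop_class g) = loop_class (loop_concat f g).
Proof.
by apply/loop_classP; apply: loop_concat_homotopic; exact: repr_loop_class.
Qed.

Lemma pi1_invE f : pi1_inv (loop_class f) = loop_class (loop_reverse f).
Proof.
by apply/loop_classP; apply: loop_reverse_homotopic; exact: repr_loop_class.
Qed.

Lemma pi1_mulA : associative pi1_mul.
Proof.
move=> a b c; rewrite -(loop_class_repr a) -(loop_class_repr b).
rewrite -(loop_class_repr c) !pi1_mulE; apply/loop_classP; exact: loop_concatA.
Qed.

Lemma pi1_mul1g : left_id pi1_one pi1_mul.
Proof.
move=> a; rewrite -(loop_class_repr a) pi1_mulE.
by apply/loop_classP; exact: loop_concat1l.
Qed.

Lemma pi1_mulg1 : right_id pi1_one pi1_mul.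
Proof.
move=> a; rewrite -(loop_class_repr a) pi1_mulE.
by apply/loop_classP; exact: loop_concat1r.
Qed.

Lemma pi1_mulVg : left_inverse pi1_one pi1_inv pi1_mul.
Proof.
move=> a; rewrite -(loop_class_repr a) pi1_invE pi1_mulE.
by apply/loop_classP; exact: loop_concatVl.
Qed.

Lemma pi1_mulgV : right_inverse pi1_one pi1_inv pi1_mul.
Proof.
move=> a; rewrite -(loop_class_repr a) pi1_invE pi1_mulE.
by apply/loop_classP; exact: loop_concatVr.
Qed.

HB.instance Definition _ := isGroup.Build pi1
  pi1_mulA pi1_mul1g pi1_mulg1 pi1_mulVg pi1_mulgV.

End loops.

Arguments loop R {X} x.
Arguments pi1 R {X} x.

Section pi1_map.
Context {R : realType} {X Y : topologicalType} (f : X -> Y).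
Hypothesis cf : continuous f.
Variable x : X.

Lemma loop_map_cts (u : loop R x) : {within `[0, 1]%classic, continuous (f \o u)}.
Proof. exact: (@cts_comp (subspace _) _ _ f u cf (@loop_cts _ _ _ u)). Qed.

Lemma loop_map0 (u : loop R x) : (f \o u) 0 = f x.
Proof. by rewrite /= loop0. Qed.

Lemma loop_map1 (u : loop R x) : (f \o u) 1 = f x.
Proof. by rewrite /= loop1. Qed.

Definition loop_map (u : loop R x) : loop R (f x) :=
  Loop (@loop_map_cts u) (loop_map0 u) (loop_map1 u).

Lemma loop_map_homotopic (u v : loop R x) :
  loop_homotopic u v -> loop_homotopic (loop_map u) (loop_map v).
Proof.
move=> [H [cH H0 H1 Hb]]; exists (f \o H); split=> [|s s01|s s01|t t01] /=.
- exact: (@cts_comp (subspace _) _ _ f H cf cH).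
- by rewrite H0.
- by rewrite H1.
- by rewrite (Hb t t01).1 (Hb t t01).2.
Qed.

Definition pi1_map (a : pi1 R x) : pi1 R (f x) :=
  loop_class (loop_map (repr a)).

Lemma pi1_mapE (u : loop R x) :
  pi1_map (loop_class u) = loop_class (loop_map u).
Proof.
by apply/loop_classP; apply: loop_map_homotopic; exact: repr_loop_class.
Qed.

Lemma pi1_map_mul : {morph pi1_map : a b / (a * b)%g}.
Proof.
move=> a b; rewrite -(loop_class_repr a) -(loop_class_repr b).
rewrite /= [LHS](congr1 _ (pi1_mulE _ _)) !pi1_mapE.
rewrite [RHS]pi1_mulE; apply/loop_classP.
exists (fun p => f (loop_concat (repr a) (repr b) (clamp p.1))).
split=> [|s s01|s s01|t t01].
- apply: continuous_subspaceT; apply: (cts_comp cf).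
  by apply: (@clamp_loop_comp _ _ _ _ (loop_concat _ _)); exact: cts_fst.
- by rewrite /= clampE.
- by rewrite /= clampE// /concat_fun; case: ifP.
- by rewrite /= !clampE ?lexx ?ler01// concat0 concat1.
Qed.

HB.instance Definition _ :=
  isMultiplicative.Build (pi1 R x) (pi1 R (f x)) pi1_map pi1_map_mul.

End pi1_map.

Arguments pi1_map R {X Y f} cf x.

Section subspace_inclusion.
Context {X : topologicalType}.

Definition set_incl (A B : set X) (AB : A `<=` B) (a : A) : B :=
  SigSub (mem_set (AB _ (set_valP a))).

Lemma set_val_continuous (A : set X) : continuous (set_val : A -> X).
Proof. exact: initial_continuous. Qed.

Lemma set_incl_continuous (A B : set X) (AB : A `<=` B) :
  continuous (set_incl AB).
Proof.
apply/continuousP => _ [W oW <-].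
have := @set_val_continuous A; move/continuousP => /(_ _ oW).
by congr open.
Qed.

End subspace_inclusion.

Arguments set_val_continuous {X} A.
Arguments set_incl_continuous {X A B} AB.


Section rings.
Context {R : realType}.

Definition dotp m (u v : 'rV[R]_m) : R := \sum_i u 0 i * v 0 i.

(* The norm of ['rV[R]_m] in the library is the sup norm, whence [dotp]. *)
Definition sqdist m (u v : 'rV[R]_m) : R := dotp (u - v) (u - v).

Definition plane (v : 'rV[R]_3) (d : R) : set 'rV[R]_3 :=
  [set p | dotp v p = d].

Definition circle (c : 'rV[R]_3) (r : R) (v : 'rV[R]_3) : set 'rV[R]_3 :=
  [set p | sqdist p c = r ^+ 2 /\ dotp v (p - c) = 0].

Definition unit_disk : set 'rV[R]_2 := [set z | dotp z z <= 1].
Definition unit_circle : set 'rV[R]_2 := [set z | dotp z z = 1].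

Definition spanning_disk (f : 'rV[R]_2 -> 'rV[R]_3) (C : set 'rV[R]_3) :=
  [/\ {within unit_disk, continuous f}, set_inj unit_disk f &
      f @` unit_circle = C].

(* [C] and [D] form the trivial two-component link: they bound disjoint
   embedded disks (a continuous injection of the compact disk is an
   embedding). *)
Definition unlinked (C D : set 'rV[R]_3) :=
  exists f g : 'rV[R]_2 -> 'rV[R]_3,
    [/\ spanning_disk f C, spanning_disk g D &
        (f @` unit_disk) `&` (g @` unit_disk) = set0].

Definition parallel_to_yz (C : set 'rV[R]_3) :=
  exists a : R, C `<=` [set p | p 0 0 = a].

Definition vertical (C : set 'rV[R]_3) :=
  exists (v : 'rV[R]_3) (d : R), [/\ v != 0, v 0 2 = 0 & C `<=` plane v d].

(* The parts of [C] above and below the xy-plane are congruent. *)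
Definition halved_by_xy (C : set 'rV[R]_3) :=
  exists h : 'rV[R]_3 -> 'rV[R]_3,
    (forall p q, sqdist (h p) (h q) = sqdist p q) /\
    h @` (C `&` [set p | 0 <= p 0 2]) = C `&` [set p | p 0 2 <= 0].


(* Center, radius and unit normal of the plane of a ring; a ring determines its
   unit normal up to sign only. *)
Definition ring_data : Type := ('rV[R]_3 * R * 'rV[R]_3)%type.

HB.instance Definition _ := Topological.on ring_data.

Definition ring_of (a : ring_data) : set 'rV[R]_3 := circle a.1.1 a.1.2 a.2.

Section fixed_number.
Variable n : nat.

Definition is_config (a : 'rV[ring_data]_n) : Prop :=
  [/\ forall i, 0 < (a 0 i).1.2,
      forall i, dotp (a 0 i).2 (a 0 i).2 = 1 &
      forall i j, i != j ->
        ring_of (a 0 i) `&` ring_of (a 0 j) = set0 /\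
        unlinked (ring_of (a 0 i)) (ring_of (a 0 j))].

Definition ordered_config : Type := [set a | is_config a].

HB.instance Definition _ := Topological.on ordered_config.

Definition rings (a : ordered_config) : set (set 'rV[R]_3) :=
  range (fun i : 'I_n => ring_of (val a 0 i)).

(* Rings are disjoint and nonempty, so two configurations are identified
   exactly when they differ by a renumbering of the rings and by changing the
   signs of the normals. *)
Definition same_rings : rel ordered_config :=
  fun a b => `[< rings a = rings b >].

Lemma same_rings_refl : reflexive same_rings.
Proof. by move=> a; apply/asboolP. Qed.

Lemma same_rings_sym : symmetric same_rings.
Proof. by move=> a b; apply/asboolP/asboolP. Qed.

Lemma same_rings_trans : transitive same_rings.
Proof. by move=> b a c /asboolP ab /asboolP bc; apply/asboolP; rewrite ab. Qed.

Canonical same_rings_equiv :=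
  EquivRel same_rings same_rings_refl same_rings_sym same_rings_trans.

Local Open Scope quotient_scope.

Definition ring_config : Type := quotient_topology {eq_quot same_rings}.


Definition rings_of (c : ring_config) : set (set 'rV[R]_3) := rings (repr c).

Lemma rings_of_pi (a : ordered_config) : rings_of (\pi_ring_config a) = rings a.
Proof.
have : \pi_({eq_quot same_rings}) (repr (\pi_ring_config a)) =
       \pi_({eq_quot same_rings}) a by exact: reprK.
by move/eqmodP/asboolP.
Qed.

Definition UR : set ring_config := [set c | rings_of c `<=` parallel_to_yz].

Definition VR : set ring_config := [set c | rings_of c `<=` vertical].

Definition W : set ring_config :=
  [set c | rings_of c `<=` [set C | vertical C /\ halved_by_xy C]].

Definition UW : set ring_config := W `&` UR.

Lemma UR_sub_VR : UR `<=` VR.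
Proof.
move=> c URc C /URc [a Ca]; exists (delta_mx 0 0), a; split.
- by apply/eqP => /matrixP/(_ 0 0)/eqP; rewrite !mxE !eqxx oner_eq0.
- by rewrite !mxE.
- move=> p /Ca /= <-; rewrite /plane /= /dotp (bigD1 0)//= mxE !eqxx mul1r.
  by rewrite big1 ?addr0// => i i0; rewrite mxE (negbTE i0) andbF mul0r.
Qed.

Lemma UW_sub_W : UW `<=` W.
Proof. by move=> c []. Qed.

End fixed_number.

End rings.

Arguments ring_config R n : clear implicits.
Arguments UR R n : clear implicits.
Arguments VR R n : clear implicits.
Arguments W R n : clear implicits.
Arguments UW R n : clear implicits.
Arguments UR_sub_VR {R} n.
Arguments UW_sub_W {R} n.

(* Main.v *)
From HB Require Import structures.
From mathcomp Require Import all_boot all_order all_algebra.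
From mathcomp Require Import all_classical all_reals all_analysis.
From mathcomp Require Import perm ring lra.
Require Import Defs.

Set Implicit Arguments.
Unset Strict Implicit.
Unset Printing Implicit Defensive.

Import Order.TTheory GRing.Theory Num.Theory.
Import numFieldNormedType.Exports.

Local Open Scope classical_set_scope.
Local Open Scope ring_scope.

(* A homotopy through rings between two loops of rings parallel to the yz-plane
   lifts to centers, radii and normals over the square, and the normals are [ex]
   on its boundary.  Following the loop by an excursion, where the rings are parked
   apart from each other while their normals run backwards through their paths,
   makes the normals null-homotopic relative to the boundary.

   It remains to make all rings parallel, continuously in the parameters and
   keeping the parallel ones parallel.  Let all squared radii decrease at the same
   speed.  The rings stay disjoint, since two disjoint rings which met at a later
   time would be linked.  When a ring is about to vanish, it is kept as a tiny ring,
   whose normal follows the null-homotopy to [ex], and which is dragged from then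
   on by a vector field interpolating the motions of the surviving rings.  The tiny
   rings could collide, so that this field is replaced by its largest minorant that
   is Lipschitz with respect to the gaps between them. *)

(** * Vectors *)

(** Over the square, a normal is a map to the sphere that is constant on the boundary. Its degree
    may be nonzero, which obstructs any direct contraction; the excursion contributes the opposite
    degree and is trivial on the two loops being compared. Squared radii decrease equally because
    two slices then meet exactly at a point of both planes, inside or on both circles, with the same
    power with respect to both; while the rings stay disjoint, such points neither appear nor
    disappear. Tiny rings cannot stay where they collapsed, since surviving rings may sweep through
    these places. The motion is a composition of a fixed number of explicit steps, and the homotopy
    parameter is the length of a step: no flow has to be integrated, and length 0 gives back the
    given rings. Three scales are nested: [mu] separates the slices, [dl] is the radius of a
    collapsing ring, and [rho] is its final radius, exponentially small in the motion still to come;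
    it is larger for rings that collapse later, so that their final shrinking costs little to those
    collapsed before. *)

Section euclidean_norm.
Context {R : realType} {m : nat}.
Implicit Types (u v w : 'rV[R]_m) (a b : R).

Lemma dotpC u v : dotp u v = dotp v u.
Proof. by apply: eq_bigr => i _; rewrite mulrC. Qed.

Lemma dotpDl u v w : dotp (u + v) w = dotp u w + dotp v w.
Proof. by rewrite -big_split; apply: eq_bigr => i _; rewrite mxE mulrDl. Qed.

Lemma dotpZl a u v : dotp (a *: u) v = a * dotp u v.
Proof. by rewrite mulr_sumr; apply: eq_bigr => i _; rewrite mxE mulrA. Qed.

Lemma dotpNl u v : dotp (- u) v = - dotp u v.
Proof. by rewrite -scaleN1r dotpZl mulN1r. Qed.

Lemma dotpBl u v w : dotp (u - v) w = dotp u w - dotp v w.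
Proof. by rewrite dotpDl dotpNl. Qed.

Lemma dotpDr u v w : dotp w (u + v) = dotp w u + dotp w v.
Proof. by rewrite dotpC dotpDl !(dotpC w). Qed.

Lemma dotpZr a u v : dotp v (a *: u) = a * dotp v u.
Proof. by rewrite dotpC dotpZl !(dotpC v). Qed.

Lemma dotpNr u v : dotp v (- u) = - dotp v u.
Proof. by rewrite dotpC dotpNl !(dotpC v). Qed.

Lemma dotpBr u v w : dotp w (u - v) = dotp w u - dotp w v.
Proof. by rewrite dotpDr dotpNr. Qed.

Lemma dotp0l u : dotp 0 u = 0.
Proof. by rewrite -(scale0r (0 : 'rV[R]_m)) dotpZl mul0r. Qed.

Lemma dotp0r u : dotp u 0 = 0.
Proof. by rewrite dotpC dotp0l. Qed.

Definition dotpE := (dotpDl, dotpDr, dotpBl, dotpBr, dotpNl, dotpNr, dotpZl, dotpZr).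

Lemma dotp_ge0 u : 0 <= dotp u u.
Proof. by apply: sumr_ge0 => i _; rewrite -expr2 sqr_ge0. Qed.

Definition nrm u : R := Num.sqrt (dotp u u).

Lemma nrm_ge0 u : 0 <= nrm u. Proof. exact: sqrtr_ge0. Qed.

Lemma nrm_sqr u : nrm u ^+ 2 = dotp u u.
Proof. by rewrite sqr_sqrtr// dotp_ge0. Qed.

Lemma nrm0 : nrm 0 = 0. Proof. by rewrite /nrm dotp0l sqrtr0. Qed.

Lemma coord_le_nrm u i : `|u 0 i| <= nrm u.
Proof.
rewrite -(ler_pXn2r (_ : (0 < 2)%N)) ?nnegrE ?nrm_ge0// nrm_sqr real_normK ?num_real//.
by rewrite /dotp (bigD1 i)//= -expr2 lerDl sumr_ge0// => j _; rewrite -expr2 sqr_ge0.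
Qed.

Lemma nrm_eq0 u : nrm u = 0 -> u = 0.
Proof.
move=> u0; apply/rowP => i; rewrite mxE; apply/eqP; rewrite -normr_le0.
by rewrite (le_trans (coord_le_nrm u i))// u0.
Qed.

Lemma cauchy_schwarz u v : `|dotp u v| <= nrm u * nrm v.
Proof.
rewrite -(ler_pXn2r (_ : (0 < 2)%N)) ?nnegrE ?mulr_ge0 ?nrm_ge0//.
rewrite exprMn !nrm_sqr real_normK ?num_real//.
have [v0|v0] := eqVneq (dotp v v) 0.
  have -> : v = 0 by apply: nrm_eq0; rewrite /nrm v0 sqrtr0.
  by rewrite !dotp0r expr0n mulr0.
have vv : 0 < dotp v v by rewrite lt_def v0 dotp_ge0.
have := dotp_ge0 (dotp v v *: u - dotp u v *: v).
rewrite !dotpE (dotpC v u).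
set x := dotp u v; set a := dotp u u; set b := dotp v v.
rewrite [X in 0 <= X -> _](_ : _ = b * (a * b - x ^+ 2)); last by ring.
by rewrite pmulr_rge0// subr_ge0.
Qed.

Lemma nrmD u v : nrm (u + v) <= nrm u + nrm v.
Proof.
rewrite -(ler_pXn2r (_ : (0 < 2)%N)) ?nnegrE ?addr_ge0 ?nrm_ge0//.
rewrite sqrrD !nrm_sqr !dotpE (dotpC v u).
have := le_trans (ler_norm _) (cauchy_schwarz u v).
by rewrite mulr2n; lra.
Qed.

Lemma nrmZ a u : nrm (a *: u) = `|a| * nrm u.
Proof.
apply/eqP; rewrite -(eqrXn2 (_ : (0 < 2)%N)) ?mulr_ge0 ?nrm_ge0//.
by rewrite exprMn !nrm_sqr !dotpE real_normK ?num_real// mulrA expr2.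
Qed.

Lemma nrmN u : nrm (- u) = nrm u.
Proof. by rewrite -scaleN1r nrmZ normrN1 mul1r. Qed.

Lemma nrmB u v : nrm (u - v) <= nrm u + nrm v.
Proof. by rewrite -(nrmN v) nrmD. Qed.

Lemma nrm_distC u v : nrm (u - v) = nrm (v - u).
Proof. by rewrite -nrmN opprB. Qed.

Lemma nrm_triangle v u w : nrm (u - w) <= nrm (u - v) + nrm (v - w).
Proof. by rewrite (le_trans _ (nrmD _ _))// addrA subrK. Qed.

Lemma nrm_lip u v : `|nrm u - nrm v| <= nrm (u - v).
Proof.
rewrite ler_norml; apply/andP; split.
  have := nrmD (v - u) u; rewrite subrK -(nrm_distC u v); lra.
have := nrmD (u - v) v; rewrite subrK; lra.
Qed.

Lemma nrm_eq a u : 0 <= a -> dotp u u = a ^+ 2 -> nrm u = a.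
Proof. by move=> a0 ua; rewrite /nrm ua sqrtr_sqr ger0_norm. Qed.

End euclidean_norm.

Section three_dimensions.
Context {R : realType}.
Implicit Types (u v w : 'rV[R]_3).

Lemma sum3 (F : 'I_3 -> R) : \sum_i F i = F 0 + F 1 + F 2.
Proof.
rewrite !big_ord_recl big_ord0 addr0 addrA.
by congr (_ + F _ + F _); apply: val_inj.
Qed.

Lemma dotp3 u v : dotp u v = u 0 0 * v 0 0 + u 0 1 * v 0 1 + u 0 2 * v 0 2.
Proof. exact: sum3. Qed.

Lemma row3P u v :
  u 0 0 = v 0 0 -> u 0 1 = v 0 1 -> u 0 2 = v 0 2 -> u = v.
Proof.
move=> e0 e1 e2; apply/rowP => -[[|[|[|i]]] hi] //.
- by rewrite (_ : Ordinal hi = 0)//; apply: val_inj.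
- by rewrite (_ : Ordinal hi = 1)//; apply: val_inj.
- by rewrite (_ : Ordinal hi = 2)//; apply: val_inj.
Qed.

Lemma nrm_le_sum u : nrm u <= `|u 0 0| + `|u 0 1| + `|u 0 2|.
Proof.
rewrite -(ler_pXn2r (_ : (0 < 2)%N)) ?nnegrE ?addr_ge0 ?nrm_ge0//.
rewrite nrm_sqr dotp3 -!expr2 -(real_normK (num_real (u 0 0))).
rewrite -(real_normK (num_real (u 0 1))) -(real_normK (num_real (u 0 2))).
by have := normr_ge0 (u 0 0); have := normr_ge0 (u 0 1);
  have := normr_ge0 (u 0 2); nra.
Qed.

Definition vec3 (a b c : R) : 'rV[R]_3 := \row_i (if i == 0 then a else if i == 1 then b else c).

Lemma vec3E a b c : (vec3 a b c 0 0 = a) * (vec3 a b c 0 1 = b) * (vec3 a b c 0 2 = c).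
Proof. by rewrite !mxE. Qed.

Definition ex : 'rV[R]_3 := vec3 1 0 0.

Lemma ex_unit : dotp ex ex = 1.
Proof. by rewrite dotp3 !vec3E; lra. Qed.

Lemma dotp_ex u : dotp ex u = u 0 0.
Proof. by rewrite dotp3 !vec3E; lra. Qed.

Lemma exists_orthogonal v : exists2 u, dotp u u = 1 & dotp v u = 0.
Proof.
pose q := v 0 0 ^+ 2 + v 0 1 ^+ 2.
have q0 : 0 <= q by rewrite addr_ge0 ?sqr_ge0.
have [qz|qz] := eqVneq q 0.
  have /andP[/eqP v0 /eqP v1] : (v 0 0 == 0) && (v 0 1 == 0).
    by move/eqP: qz; rewrite paddr_eq0 ?sqr_ge0// !sqrf_eq0.
  by exists ex; [exact: ex_unit|rewrite dotpC dotp_ex].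
have qp : 0 < q by rewrite lt_def qz.
have sq : Num.sqrt q ^+ 2 = q by rewrite sqr_sqrtr.
have sq0 : Num.sqrt q != 0 by rewrite gt_eqF// sqrtr_gt0.
exists ((Num.sqrt q)^-1 *: vec3 (- v 0 1) (v 0 0) 0); last first.
  by rewrite dotpZr dotp3 !vec3E; ring.
rewrite dotpZl dotpZr mulrA -expr2 exprVn sq dotp3 !vec3E.
by rewrite /q in qz *; field.
Qed.

End three_dimensions.
Arguments ex {R}.

(** * Lipschitz regularisation *)

Section lipschitz_regularisation.
Context {R : realType} {n : nat}.
Variables (s : 'I_n -> 'I_n -> R).
Hypothesis s_ge0 : forall i j, 0 <= s i j.
Implicit Types (i j : 'I_n) (p q : seq 'I_n).

Fixpoint walk_cost i p : R :=
  if p is j :: q then s i j + walk_cost j q else 0.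

Lemma walk_cost_ge0 i p : 0 <= walk_cost i p.
Proof. by elim: p i => //= j p IH i; rewrite addr_ge0. Qed.

Lemma walk_cost_cat i p q :
  walk_cost i (p ++ q) = walk_cost i p + walk_cost (last i p) q.
Proof. by elim: p i => [|j p IH] i /=; rewrite ?add0r// IH addrA. Qed.

(** If the start recurs, the part of the walk before its recurrence is dropped; costs are
    nonnegative. *)
Lemma walk_shorten p i : exists q, [/\ uniq (i :: q), {subset q <= p},
  last i q = last i p & walk_cost i q <= walk_cost i p].
Proof.
have [N] := ubnP (size p); elim: N p i => // N IH p i.
have [ip|ip] := boolP (i \in p).
  case/splitPr: ip => p1 p2; rewrite size_cat /= addnS ltnS => sz.
  have [q [uq sq lq cq]] := IH p2 i (leq_ltn_trans (leq_addl _ _) sz).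
  exists q; split => //; first by move=> x /sq; rewrite mem_cat inE => ->; rewrite !orbT.
    by rewrite last_cat.
  rewrite walk_cost_cat /= (le_trans cq)// addrA lerDr addr_ge0//.
  exact: walk_cost_ge0.
case: p ip => [|j p] ip; first by exists [::].
rewrite /= ltnS => sz; have [q [uq sq lq cq]] := IH p j sz.
exists (j :: q); split => //=; last by rewrite lerD2l.
  rewrite -/(uniq (j :: q)) uq andbT; apply: contra ip.
  by rewrite !inE => /orP[->//|/sq ->]; rewrite orbT.
by move=> x; rewrite !inE => /orP[->//|/sq ->]; rewrite orbT.
Qed.

Variables (L : R) (f : 'I_n -> R).
Hypothesis L_ge0 : 0 <= L.
Hypothesis s_refl : forall i, s i i = 0.

(* The largest minorant of [f] that is [L]-Lipschitz for [s]. *)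
Definition regularise i : R :=
  \big[Num.min/f i]_(p : n.-tuple 'I_n) (f (last i p) + L * walk_cost i p).

Lemma regularise_le i : regularise i <= f i.
Proof. exact: bigmin_le_id. Qed.

(** A walk of any length can be shortened to at most [n] steps, then padded to an [n]-tuple by
    repeating its last vertex at no cost. The fixed length makes [regularise] a finite minimum,
    hence continuous in the data. *)
Lemma regularise_walk i p : regularise i <= f (last i p) + L * walk_cost i p.
Proof.
have [q [uq _ lq cq]] := walk_shorten p i.
have sz : (size q <= n)%N.
  move: uq => /= /andP[_ /card_uniqP <-].
  by rewrite (leq_trans (max_card _)) ?card_ord.
pose r := q ++ nseq (n - size q) (last i q).
have lr k : last (last i q) (nseq k (last i q)) = last i q by elim: k.
have cr k : walk_cost (last i q) (nseq k (last i q)) = 0.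
  by elim: k => //= k ->; rewrite s_refl addr0.
have szr : size r == n by rewrite size_cat size_nseq subnKC.
apply: le_trans (bigmin_le (f i) (Tuple szr) _) _ => /=.
rewrite last_cat lr lq lerD2l ler_wpM2l// walk_cost_cat cr addr0.
exact: cq.
Qed.

Lemma regularise_ge i b :
  (forall p, (size p <= n)%N -> b <= f (last i p) + L * walk_cost i p) ->
  b <= regularise i.
Proof.
move=> hb; apply: le_bigmin => [|p _].
  by have := hb [::] isT; rewrite /= mulr0 addr0.
by apply: hb; rewrite size_tuple.
Qed.

(** A walk from [j] preceded by the step from [i] to [j] is a walk from [i]. Walks replace single
    steps because [s], later a gap between circles, need not satisfy the triangle inequality. *)
Lemma regularise_lip i j : regularise i <= regularise j + L * s i j.
Proof.
rewrite -lerBlDr; apply: regularise_ge => p _; rewrite lerBlDr -addrA -mulrDr.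
by rewrite [walk_cost j p + _]addrC; exact: (regularise_walk i (j :: p)).
Qed.

End lipschitz_regularisation.

(** * Walks through small discs *)

Section walks_in_space.
Context {R : realType} {n m : nat}.
Variables (s : 'I_n -> 'I_n -> R) (x : 'I_n -> 'rV[R]_m) (rho : 'I_n -> R).
Hypothesis s_ge0 : forall i j, 0 <= s i j.
Hypothesis s_dist : forall i j, nrm (x i - x j) <= s i j + rho i + rho j.

Lemma walk_dist (b : R) p i : 0 <= b -> (forall l, l \in i :: p -> rho l <= b) ->
  forall l, l \in i :: p ->
  nrm (x i - x l) <= walk_cost s i p + 2 * b * (size p)%:R.
Proof.
move=> b0; elim: p i => [|j p IH] i hb l.
  by rewrite inE => /eqP ->; rewrite subrr nrm0 /= mulr0 addr0.
have sp : 0 <= (size p)%:R :> R by [].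
rewrite inE => /orP[/eqP ->|lp].
  rewrite subrr nrm0 addr_ge0 ?mulr_ge0//.
  exact: (walk_cost_ge0 s_ge0 i (j :: p)).
have hb' k : k \in j :: p -> rho k <= b by move=> kp; apply: hb; rewrite inE kp orbT.
apply: le_trans (nrm_triangle (x j) _ _) _.
have := IH j hb' l lp; have := s_dist i j.
have := hb' j (mem_head _ _); have := hb i (mem_head _ _).
by rewrite /= -natr1; lra.
Qed.

Lemma walk_max p i : exists2 l, l \in i :: p & forall k, k \in i :: p -> rho k <= rho l.
Proof.
elim: p i => [|j p IH] i.
  by exists i; rewrite ?inE// => k; rewrite inE => /eqP ->.
have [l lp hl] := IH j; have [il|li] := leP (rho i) (rho l).
  exists l; first by rewrite inE lp orbT.
  by move=> k; rewrite inE => /orP[/eqP -> //|/hl].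
exists i; first exact: mem_head.
by move=> k; rewrite inE => /orP[/eqP -> //|/hl /le_trans]; apply; exact: ltW.
Qed.

Variables (L : R) (f : 'I_n -> R).
Hypothesis L_ge0 : 0 <= L.
Hypothesis s_refl : forall i, s i i = 0.
Hypothesis rho_ge0 : forall i, 0 <= rho i.
Hypothesis n_gt0 : (0 < n)%N.

(* Collapsed discs are so small compared to their distance to [y] that walking
   through them cannot spoil the value near [y]. *)
Lemma regularise_near (y : 'rV[R]_m) i :
  (forall j, f i - f j <= L / 2 * nrm (x i - x j)) ->
  (forall l, 6 * n%:R * rho l <= nrm (x l - y)) ->
  f i - L / 4 * nrm (x i - y) <= regularise s L f i.
Proof.
move=> fL tame; apply: regularise_ge => // p szp.
set d := nrm _; set C := walk_cost _ _ _.
have C0 : 0 <= C by exact: walk_cost_ge0.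
(* The largest disc [l] of the walk controls all the others: smallness at [l] gives
   [4 * n * rho l <= d + C], so that the walk ends within [3/2 * C + d/2] of its start. *)
have [l lp hl] := walk_max p i.
have n1 : 1 <= n%:R :> R by rewrite ler1n.
have spn : (size p)%:R <= n%:R :> R by rewrite ler_nat.
have rl := rho_ge0 l.
have bnd : 2 * rho l * (size p)%:R <= 2 * n%:R * rho l by nra.
have D k : k \in i :: p -> nrm (x i - x k) <= C + 2 * n%:R * rho l.
  by move=> kp; apply: le_trans (walk_dist rl hl kp) _; rewrite lerD2l.
have hl' : 6 * n%:R * rho l <= d + C + 2 * n%:R * rho l.
  apply: (le_trans (tame l)); have := nrm_triangle (x i) (x l) y.
  by rewrite (nrm_distC (x l) (x i)); have := D l lp; rewrite /d; lra.
have Dl : nrm (x i - x (last i p)) <= 3 / 2 * C + d / 2.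
  have := D _ (mem_last i p); move: hl'; rewrite -!(mulrA _ n%:R).
  by move: (n%:R * rho l) => K; lra.
have L2 : 0 <= L / 2 by rewrite divr_ge0.
have := ler_wpM2l L2 Dl; have := fL (last i p); have := mulr_ge0 L_ge0 C0.
by lra.
Qed.

(* [f] vanishes on a ball, which is much larger than the collapsed discs. *)
Lemma regularise_flat (c : 'rV[R]_m) (rad eps : R) i :
  (forall j, - (L / 2 * Num.max 0 (nrm (x j - c) - rad)) <= f j) ->
  (forall l, 2 * n%:R * rho l <= eps) ->
  - (L / 2 * Num.max 0 (nrm (x i - c) + eps - rad)) <= regularise s L f i.
Proof.
move=> fL small; apply: regularise_ge => // p szp.
set C := walk_cost _ _ _.
have C0 : 0 <= C by exact: walk_cost_ge0.
have [l lp hl] := walk_max p i; have rl := rho_ge0 l.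
have spn : (size p)%:R <= n%:R :> R by rewrite ler_nat.
have bnd : 2 * rho l * (size p)%:R <= eps by apply: le_trans (small l); nra.
have := walk_dist rl hl (mem_last i p); rewrite -/C => D.
have := nrm_triangle (x i) (x (last i p)) c; rewrite (nrm_distC (x (last i p)) (x i)) => T.
have := fL (last i p); move: T D; set xl := x (last i p).
set A := nrm (xl - c); set B := nrm (x i - c) => T D F.
suff h : Num.max 0 (A - rad) <= Num.max 0 (B + eps - rad) + 2 * C.
  have L2 : 0 <= L / 2 by rewrite divr_ge0.
  by have := ler_wpM2l L2 h; lra.
rewrite ge_max addr_ge0 ?mulr_ge0 ?le_max ?lexx//=.
have : B + eps - rad <= Num.max 0 (B + eps - rad) by rewrite le_max lexx orbT.
by lra.
Qed.

End walks_in_space.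

(** * Circles *)

Section circles.
Context {R : realType}.
Implicit Types (c x y z v N : 'rV[R]_3) (r : R).

Lemma circleP c r N x : 0 <= r ->
  circle c r N x <-> nrm (x - c) = r /\ dotp N (x - c) = 0.
Proof.
move=> r0; split=> -[xr xN]; split=> //; first exact: nrm_eq.
by rewrite /sqdist -nrm_sqr xr.
Qed.

Lemma circle_point c r N : exists x, circle c r N x.
Proof.
have [u u1 Nu] := exists_orthogonal N.
exists (c + r *: u); rewrite /circle /= /sqdist addrC addKr !dotpE u1 Nu.
by split; ring.
Qed.

Definition par N y := y - dotp N y *: N.

Lemma parB N y z : par N (y - z) = par N y - par N z.
Proof. by apply/rowP => i; rewrite /par dotpBr !mxE; ring. Qed.

Lemma par_sqr N y : dotp N N = 1 -> dotp (par N y) (par N y) = dotp y y - dotp N y ^+ 2.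
Proof. by move=> N1; rewrite /par !dotpE N1 (dotpC y N); ring. Qed.

Lemma par_le N y : dotp N N = 1 -> nrm (par N y) <= nrm y.
Proof.
move=> N1; rewrite -(ler_pXn2r (_ : (0 < 2)%N)) ?nnegrE ?nrm_ge0//.
by rewrite !nrm_sqr par_sqr// lerBlDr lerDl sqr_ge0.
Qed.

Lemma dotp_unit_le N y : dotp N N = 1 -> `|dotp N y| <= nrm y.
Proof.
by move=> N1; have := cauchy_schwarz N y; rewrite {1}/nrm N1 sqrtr1 mul1r.
Qed.

(* Comparable to the distance from [x] to the circle. *)
Definition tube c r N x : R :=
  `|dotp N (x - c)| + `|nrm (par N (x - c)) - r|.

Lemma tube_ge0 c r N x : 0 <= tube c r N x.
Proof. by rewrite addr_ge0. Qed.

Lemma tube_circle c r N x : 0 <= r -> dotp N N = 1 -> circle c r N x -> tube c r N x = 0.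
Proof.
move=> r0 N1 /(circleP _ _ _ r0)[xr xN].
by rewrite /tube xN normr0 add0r /par xN scale0r subr0 xr subrr normr0.
Qed.

Lemma dotp_par N y : dotp N N = 1 -> dotp N (par N y) = 0.
Proof. by move=> N1; rewrite /par !dotpE N1 mulr1 subrr. Qed.

Lemma tube_near c r N x : 0 <= r -> dotp N N = 1 ->
  exists2 z, circle c r N z & nrm (x - z) <= tube c r N x.
Proof.
move=> r0 N1; set y := x - c; set q := par N y.
have [g g1 [Ng qg]] : exists2 g, dotp g g = 1 & dotp N g = 0 /\ q = nrm q *: g.
  have [q0|q0] := eqVneq (nrm q) 0.
    have [g g1 Ng] := exists_orthogonal N; exists g => //; split=> //.
    by rewrite q0 scale0r (nrm_eq0 q0).
  exists ((nrm q)^-1 *: q).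
    by rewrite dotpZl dotpZr -(nrm_sqr q); field.
  by rewrite dotpZr dotp_par// mulr0; split=> //; rewrite scalerA divff// scale1r.
exists (c + r *: g).
  rewrite /circle /= /sqdist (addrC c) addrK !dotpE g1 Ng; split; ring.
have -> : x - (c + r *: g) = dotp N y *: N + (nrm q - r) *: g.
  rewrite scalerBl -qg /q /par; apply/rowP => i; rewrite !mxE; ring.
apply: le_trans (nrmD _ _) _.
by rewrite !nrmZ {1}/nrm N1 /(nrm g) g1 sqrtr1 !mulr1.
Qed.

Lemma tube_lip c r N x y : dotp N N = 1 ->
  `|tube c r N x - tube c r N y| <= 2 * nrm (x - y).
Proof.
move=> N1; rewrite /tube.
have e : x - y = (x - c) - (y - c) by rewrite opprB addrA subrK.
have h1 : `| `|dotp N (x - c)| - `|dotp N (y - c)| | <= nrm (x - y).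
  by rewrite (le_trans (ler_dist_dist _ _))// -dotpBr e dotp_unit_le.
have h2 : `| `|nrm (par N (x - c)) - r| - `|nrm (par N (y - c)) - r| | <= nrm (x - y).
  rewrite (le_trans (ler_dist_dist _ _))// opprB addrA subrK.
  by rewrite (le_trans (nrm_lip _ _))// -parB e par_le.
move: h1 h2; set a := `|dotp _ _|; set b := `|dotp _ _|; set a' := `|_ - r|.
set b' := `|_ - r| => h1 h2.
have -> : a + a' - (b + b') = (a - b) + (a' - b') by ring.
by rewrite (le_trans (ler_normD _ _))//; lra.
Qed.

(* On the vectors orthogonal to [N], adding this displacement amounts to the
   rotation taking [N] to [N'] followed by the homothety of ratio [k]. *)
Definition tilt (k : R) N N' y : 'rV[R]_3 :=
  (k - 1) *: y - (k * dotp (N' - N) y / (1 + dotp N N')) *: (N + N').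

Lemma tiltB k N N' y z : tilt k N N' (y - z) = tilt k N N' y - tilt k N N' z.
Proof.
by apply/rowP => i; rewrite /tilt (dotpBr y z) !mxE; ring.
Qed.

(** On vectors orthogonal to [N], the products with [N' - N] and with [N'] agree; the choice of
    [N' - N] makes the displacement small on all of space when [N'] is close to [N] and [k] to 1. *)
Lemma tilt_bound k N N' y : dotp N N = 1 -> dotp N' N' = 1 -> 0 <= dotp N N' ->
  0 <= k <= 1 ->
  nrm (tilt k N N' y) <= ((1 - k) + 2 * nrm (N' - N)) * nrm y.
Proof.
move=> N1 N1' NN /andP[k0 k1]; apply: le_trans (nrmB _ _) _.
rewrite !nrmZ mulrDl; apply: lerD.
  by rewrite ler_wpM2r ?nrm_ge0// ler0_norm; lra.
have n1 : nrm N = 1 by rewrite /nrm N1 sqrtr1.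
have n1' : nrm N' = 1 by rewrite /nrm N1' sqrtr1.
have w2 : nrm (N + N') <= 2 by apply: le_trans (nrmD _ _) _; lra.
rewrite !normrM normfV (ger0_norm k0) (@ger0_norm _ (1 + _)); last lra.
have cs := cauchy_schwarz (N' - N) y.
set A := `|dotp _ _| in cs *; set B := nrm (N' - N) in cs *.
have A0 : 0 <= A := normr_ge0 _; have B0 : 0 <= B := nrm_ge0 _.
have Y0 := nrm_ge0 y; have W0 := nrm_ge0 (N + N').
have i1 : (1 + dotp N N')^-1 <= 1 by rewrite invf_le1; lra.
have i0 : 0 <= (1 + dotp N N')^-1 by rewrite invr_ge0; lra.
have h1 : k * A * (1 + dotp N N')^-1 <= A.
  rewrite -[leRHS]mulr1; apply: ler_pM => //; first exact: mulr_ge0.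
  by rewrite -[leRHS]mul1r ler_wpM2r.
apply: (@le_trans _ _ (A * 2)); last nra.
by apply: ler_pM => //; rewrite !mulr_ge0.
Qed.

Lemma tilt_onto k c r N N' z : 0 <= r -> 0 < k ->
  dotp N N = 1 -> dotp N' N' = 1 -> 0 <= dotp N N' ->
  circle c (k * r) N' z ->
  exists2 y, circle c r N y & z = y + tilt k N N' (y - c).
Proof.
move=> r0 k0 N1 N1' NN [zr zN]; rewrite /sqdist in zr.
pose q := k^-1 *: (z - c); pose t := dotp N q.
have kn : k != 0 by rewrite gt_eqF.
have kNN : 1 + dotp N N' != 0 by rewrite gt_eqF; lra.
have qN' : dotp N' q = 0 by rewrite /q dotpZr zN mulr0.
have qq : dotp q q = r ^+ 2 by rewrite /q dotpZl dotpZr zr; field.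
have zc : z = c + k *: q by rewrite /q scalerA divff// scale1r addrC subrK.
have tE : t = dotp N q by [].
clearbody t q; clear zr zN.
(* The rotation taking [N'] back to [N], applied to [q]. *)
pose w := q - (t / (1 + dotp N N')) *: (N + N').
have ew : dotp (N' - N) w = - t.
  by rewrite /w !dotpE qN' N1 N1' (dotpC N' N) -tE; field.
exists (c + w).
  rewrite /circle /= /sqdist (addrC c) addrK; split.
    rewrite /w !dotpE (dotpC q N) (dotpC q N') qN' qq N1 N1' (dotpC N' N) -tE.
    by field.
  by rewrite /w !dotpE N1 -tE; field.
rewrite /tilt (addrC c w) addrK ew.
by rewrite zc; apply/rowP => i; rewrite /w !mxE; ring.
Qed.

End circles.

(** * Gaps between circles parallel to the yz-plane *)

Section separation.
Context {R : realType}.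
Implicit Types (c x y : 'rV[R]_3) (D : 'rV[R]_3) (r : R).

Definition flat D : 'rV[R]_3 := vec3 0 (D 0 1) (D 0 2).

Lemma flatE D : D = D 0 0 *: ex + flat D.
Proof. by apply: row3P; rewrite !mxE /=; lra. Qed.

Lemma flatB D D' : flat (D - D') = flat D - flat D'.
Proof. by apply: row3P; rewrite !mxE /=; lra. Qed.

Lemma flat_le D : nrm (flat D) <= nrm D.
Proof.
rewrite -(ler_pXn2r (_ : (0 < 2)%N)) ?nnegrE ?nrm_ge0// !nrm_sqr !dotp3 !vec3E.
by have := sqr_ge0 (D 0 0); rewrite expr2; lra.
Qed.

Lemma flat_id D : D 0 0 = 0 -> flat D = D.
Proof. by move=> D0; rewrite [RHS]flatE D0 scale0r add0r. Qed.

(* Comparable to the distance between two circles parallel to the yz-plane. *)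
Definition gap r r' D : R :=
  `|D 0 0| + Num.max 0 (Num.max (nrm (flat D) - (r + r')) (`|r - r'| - nrm (flat D))).

Lemma gap_ge0 r r' D : 0 <= gap r r' D.
Proof. by rewrite addr_ge0// le_max lexx. Qed.

Lemma gap_refl r : 0 <= r -> gap r r 0 = 0.
Proof.
move=> r0; rewrite /gap (_ : flat 0 = 0); last by apply: flat_id; rewrite mxE.
rewrite mxE normr0 nrm0 subrr normr0 add0r.
by apply: max_l; rewrite ge_max; apply/andP; split; lra.
Qed.

Lemma gapN r r' D : gap r r' (- D) = gap r' r D.
Proof.
rewrite /gap mxE normrN (_ : flat (- D) = - flat D) ?nrmN ?(addrC r r') 1?distrC//.
by have := flatB 0 D; rewrite !sub0r => ->; rewrite flat_id ?mxE// sub0r.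
Qed.

Lemma gap_dist r r' D : nrm D <= gap r r' D + r + r'.
Proof.
rewrite [in leLHS](flatE D) (le_trans (nrmD _ _))// nrmZ {1}/nrm ex_unit sqrtr1 mulr1.
have : nrm (flat D) - (r + r') <=
  Num.max 0 (Num.max (nrm (flat D) - (r + r')) (`|r - r'| - nrm (flat D))).
  by rewrite !le_max lexx orbT.
by rewrite /gap; lra.
Qed.

Lemma gap_lip r r' D D' : gap r r' D <= gap r r' D' + 2 * nrm (D - D').
Proof.
rewrite /gap; set a := nrm (flat D); set b := nrm (flat D').
have ab : `|a - b| <= nrm (D - D').
  by rewrite (le_trans (nrm_lip _ _))// -flatB flat_le.
have h0 : `|D 0 0| <= `|D' 0 0| + nrm (D - D').
  have := coord_le_nrm (D - D') 0; rewrite !mxE => h.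
  by have := lerB_dist (D 0 0) (D' 0 0); lra.
suff : Num.max 0 (Num.max (a - (r + r')) (`|r - r'| - a)) <=
  Num.max 0 (Num.max (b - (r + r')) (`|r - r'| - b)) + nrm (D - D') by lra.
have m0 : 0 <= Num.max 0 (Num.max (b - (r + r')) (`|r - r'| - b)).
  by rewrite le_max lexx.
have m1 : b - (r + r') <= Num.max 0 (Num.max (b - (r + r')) (`|r - r'| - b)).
  by rewrite !le_max lexx orbT.
have m2 : `|r - r'| - b <= Num.max 0 (Num.max (b - (r + r')) (`|r - r'| - b)).
  by rewrite !le_max lexx !orbT.
move: ab; rewrite ler_norml => /andP[ab1 ab2].
have := nrm_ge0 (D - D').
by rewrite !ge_max; move: m0 m1 m2; set M := Num.max _ _ => *; apply/and3P; split; lra.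
Qed.

Lemma gap_disjoint c c' r r' : 0 <= r -> 0 <= r' -> 0 < gap r r' (c - c') ->
  circle c r ex `&` circle c' r' ex = set0.
Proof.
move=> r0 r0' g; rewrite -subset0 => p [/(circleP _ _ _ r0)[pr]].
rewrite dotp_ex => p0 /(circleP _ _ _ r0')[pr']; rewrite dotp_ex => p0'.
have D : c - c' = (p - c') - (p - c) by apply/rowP => i; rewrite !mxE; ring.
have D0 : (c - c') 0 0 = 0 by move: p0 p0'; rewrite !mxE; lra.
suff : gap r r' (c - c') = 0 by move=> g0; rewrite g0 ltxx in g.
rewrite /gap D0 normr0 add0r flat_id//; apply: max_l; rewrite ge_max !subr_le0.
apply/andP; split; first by rewrite D -pr -pr' [leRHS]addrC nrmB.
by rewrite D -pr -pr' (le_trans (nrm_lip _ _))// nrm_distC.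
Qed.

Lemma gap_gt0 c c' r r' : 0 <= r -> 0 <= r' ->
  (forall y, circle c' r' ex y -> r < nrm (c - y)) -> 0 < gap r r' (c - c').
Proof.
move=> r0 r0' h; rewrite lt_def gap_ge0 andbT; apply/eqP => g0.
set D := c - c' in g0 *; set q := flat D in g0 *.
move/eqP: g0; rewrite paddr_eq0 ?le_max ?lexx// normr_eq0 => /andP[/eqP D0].
rewrite eq_maxl ge_max !subr_le0 -/q => /andP[q1 q2].
have [g g1 [Ng qg]] : exists2 g, dotp g g = 1 & g 0 0 = 0 /\ q = nrm q *: g.
  have [q0|q0] := eqVneq (nrm q) 0.
    have [g g1 Ng] := exists_orthogonal (ex : 'rV[R]_3); rewrite dotp_ex in Ng.
    by exists g => //; split=> //; rewrite q0 scale0r (nrm_eq0 q0).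
  exists ((nrm q)^-1 *: q); first by rewrite dotpZl dotpZr -(nrm_sqr q); field.
  by rewrite !mxE mulr0; split=> //; rewrite scalerA divff// scale1r.
have Dq : D = q by rewrite /q flat_id.
(* In the direction of [D], the point of the second circle is at distance [|nrm D - r'|] from [c]; a
   vanishing gap makes this at most [r]. *)
have yc : circle c' r' ex (c' + r' *: g).
  rewrite /circle /= /sqdist (addrC c') addrK !dotpE g1 dotp_ex Ng; split; ring.
have := h _ yc; rewrite opprD addrA -/D Dq qg -scalerBl nrmZ {2}/nrm g1 sqrtr1 mulr1.
rewrite ltNge => /negP; apply; rewrite ler_norml.
by move: q2; rewrite ler_norml => /andP[]; lra.
Qed.

End separation.

Section clamp_facts.
Context {R : realType}.
Implicit Types s t : R.

Lemma clamp_eq0 t : t <= 0 -> clamp t = 0.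
Proof. by move=> t0; apply: max_l; rewrite ge_min t0 orbT. Qed.

Lemma clamp_eq1 t : 1 <= t -> clamp t = 1.
Proof. by move=> t1; rewrite /clamp (min_l t1) max_r. Qed.

Lemma clamp_homo s t : s <= t -> clamp s <= clamp t.
Proof.
move=> st; have h : Num.min 1 s <= Num.min 1 t.
  by rewrite le_min !ge_min lexx st orbT.
by rewrite /clamp ge_max !le_max lexx h orbT.
Qed.

Lemma clamp_lip s t : s <= t -> clamp t - clamp s <= t - s.
Proof.
move=> st; rewrite /clamp.
case: (leP 1 t) => h1; case: (leP 1 s) => h2;
  [case: (leP 0 1) => h3|case: (leP 0 1) => h3; case: (leP 0 s) => h4
  |case: (leP 0 t) => h3; case: (leP 0 1) => h4
  |case: (leP 0 t) => h3; case: (leP 0 s) => h4]; lra.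
Qed.

Lemma expR_small t : 0 <= t <= 2^-1 -> expR (- (2 * t)) <= 1 - t.
Proof.
move=> t01; have h := expR_ge1Dx (2 * t).
have p : 0 < 1 + 2 * t by lra.
apply: (@le_trans _ _ (1 + 2 * t)^-1).
  by rewrite expRN lef_pV2 ?posrE ?expR_gt0.
rewrite -[leLHS]mul1r ler_pdivrMr//; nra.
Qed.

Lemma nrm_sum (m : nat) (I : finType) (F : I -> 'rV[R]_m) :
  nrm (\sum_i F i) <= \sum_i nrm (F i).
Proof.
elim/big_ind2 : _ => [|u a v b ua vb|//]; first by rewrite nrm0.
by rewrite (le_trans (nrmD _ _))// lerD.
Qed.

End clamp_facts.

(** * Dragging the collapsed rings *)

Section dragging.
Context {R : realType} {n : nat}.
Variables (c : 'I_n -> 'rV[R]_3) (r : 'I_n -> R) (N : 'I_n -> R -> 'rV[R]_3).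
Variables (mu w dl Rm LN eta : R) (lam : 'I_n -> R).
Implicit Types (t : R) (i j k l : 'I_n) (x : 'I_n -> 'rV[R]_3) (p y z : 'rV[R]_3).

(* The time elapsed since the ring [i], shrinking as r^2 - t, would have
   disappeared, in units of [w]. *)
Definition age i t : R := (t - r i ^+ 2) / w.
(** The life of a ring in terms of its age: up to -1 its radius decreases to [dl]; from 0 to 1 its
    normal turns to [ex]; from 1 to 2 its radius shrinks from [dl] to [rho i]; from 2 to 3 it rests;
    from 3 to 4 it is gradually released; after 4 it is dragged. *)
Definition base i t : R := Num.sqrt (Num.max (r i ^+ 2 - t) w).
Definition late i t : R := clamp (age i t - 1).
Definition Rad i t : R := base i t * expR (- (lam i * late i t)).
Definition rho i : R := dl * expR (- lam i).
Definition Nt i t : 'rV[R]_3 := N i (clamp (age i t)).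
Definition free i t : R := clamp (age i t - 3).
(** A nondecreasing clock: its increment over a step bounds the relative shrinking of the ring plus
    twice the turn of its normal, hence the operator norm of [A]. *)
Definition Phi i t : R :=
  - (base i t / dl) + lam i * late i t + 2 * LN * clamp (age i t).
Definition circ i t := circle (c i) (Rad i t) (Nt i t).

(** By [tilt_onto], every point of the ring [k] at time [t + eta] is [y + A k t (y - c k)] for some
    point [y] of the ring at time [t]. *)
Definition A k t y : 'rV[R]_3 :=
  tilt (Rad k (t + eta) / Rad k t) (Nt k t) (Nt k (t + eta)) y.
Definition cut k t p : R :=
  Num.max 0 (1 - tube (c k) (Rad k t) (Nt k t) p / (mu / 8)).
Definition V t p : 'rV[R]_3 := \sum_k cut k t p *: A k t (p - c k).
(** A Lipschitz constant of a term of [V] per unit of [Phi]: 1 for the linear map [A], and [16 / mu]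
    for the cut-off times [Rm + mu], which bounds the vectors from the centre to the support. *)
Definition C1 : R := 1 + 16 * (Rm + mu) / mu.
Definition var t : R := \sum_k (Phi k (t + eta) - Phi k t).
(** Twice a Lipschitz constant of [V]; the spare half absorbs the discs that walks cross for
    free. *)
Definition LL t : R := 2 * C1 * var t.
(** The factor [free] lets a ring enter the gaps as a point and grow continuously to its radius. *)
Definition sp t x i j : R :=
  gap (rho i * free i t) (rho j * free j t) (x i - x j).
Definition disp t x i : 'rV[R]_3 :=
  \row_a regularise (sp t x) (LL t) (fun j => V t (x j) 0 a) i.
Definition next t x i : 'rV[R]_3 := x i + free i t *: disp t x i.
Fixpoint pos (m : nat) : 'I_n -> 'rV[R]_3 :=
  if m is m'.+1 then next (m'%:R * eta) (pos m') else c.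

(** A lower bound for the distance from the released ring [i] to the surviving ones. It is [mu / 4]
    when the release ends, at [r i ^+ 2 + 4 * w], and decays with the total motion from then on. *)
Definition Q i t : R := mu / 4 * expR (- (12 * C1 *
  \sum_k (Phi k t - Phi k (r i ^+ 2 + 4 * w)))).

Hypothesis n_gt0 : (0 < n)%N.
Hypothesis mu_gt0 : 0 < mu.
Hypothesis dl_gt0 : 0 < dl.
Hypothesis dl_w : dl ^+ 2 = w.
Hypothesis dl_mu : 100 * n%:R * dl <= mu.
Hypothesis dl_Rm : dl <= Rm.
Hypothesis r_gt0 : forall i, 0 < r i.
Hypothesis r_Rm : forall i, r i <= Rm.
Hypothesis LN_ge0 : 0 <= LN.
Hypothesis lam_ge0 : forall i, 0 <= lam i.
Hypothesis eta_w : 0 <= eta <= w.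
Hypothesis N_unit : forall i s, dotp (N i s) (N i s) = 1.
Hypothesis N_lip : forall i s s', s <= s' -> nrm (N i s' - N i s) <= LN * (s' - s).
Hypothesis N_end : forall i, N i 1 = ex.
Hypothesis slices : forall i j h y z, i != j ->
  0 <= h -> h <= r i ^+ 2 -> h <= r j ^+ 2 ->
  circle (c i) (Num.sqrt (r i ^+ 2 - h)) (N i 0) y ->
  circle (c j) (Num.sqrt (r j ^+ 2 - h)) (N j 0) z -> mu <= nrm (y - z).
Hypothesis var_small : forall t, 0 <= t -> var t <= (24 * C1)^-1.
Hypothesis Q_rho : forall i t, r i ^+ 2 + 4 * w <= t -> 6 * n%:R * rho i <= Q i t.

Lemma w_gt0 : 0 < w. Proof. by rewrite -dl_w exprn_gt0. Qed.
Let eta_ge0 : 0 <= eta. Proof. by case/andP: eta_w. Qed.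
Let n_ge1 : 1 <= n%:R :> R. Proof. by rewrite ler1n. Qed.
Let dl_mu' : 100 * dl <= mu.
Proof. by apply: le_trans dl_mu; rewrite ler_wpM2r ?(ltW dl_gt0)// ler_peMr. Qed.

Lemma C1_ge1 : 1 <= C1.
Proof.
by rewrite /C1 lerDl divr_ge0 ?(ltW mu_gt0)// mulr_ge0//; have := mu_gt0; have := dl_gt0; have := dl_Rm; lra.
Qed.

Lemma age_homo i t t' : t <= t' -> age i t <= age i t'.
Proof. by move=> tt; rewrite ler_wpM2r ?invr_ge0 ?(ltW w_gt0)// lerD2r. Qed.

Lemma age_step i t : age i (t + eta) <= age i t + 1.
Proof.
have [_ ew] := andP eta_w; have w0 := w_gt0.
rewrite /age ler_pdivrMr// mulrDl divfK ?gt_eqF//; lra.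
Qed.

Lemma ageP i t a : (age i t <= a) = (t <= r i ^+ 2 + a * w).
Proof. by rewrite ler_pdivrMr ?w_gt0// lerBlDl. Qed.

Lemma sqrt_w : Num.sqrt w = dl.
Proof. by rewrite -dl_w sqrtr_sqr ger0_norm// ltW. Qed.

Lemma base_ge i t : dl <= base i t.
Proof. by rewrite -sqrt_w ler_wsqrtr// le_max lexx orbT. Qed.

Lemma base_dl i t : -1 <= age i t -> base i t = dl.
Proof.
rewrite lerNl => h; rewrite /base max_r ?sqrt_w//.
by move: h; rewrite /age -mulNr ler_pdivrMr ?w_gt0// mul1r opprB.
Qed.

Lemma base_alive i t : age i t <= -1 -> base i t = Num.sqrt (r i ^+ 2 - t).
Proof. by rewrite ageP => h; rewrite /base max_l//; lra. Qed.

Lemma base_anti i t t' : t <= t' -> base i t' <= base i t.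
Proof.
move=> tt; have w0 := w_gt0; apply: ler_wsqrtr.
by rewrite ge_max !le_max lexx orbT andbT; apply/orP; left; lra.
Qed.

Lemma Rad_gt0 i t : 0 < Rad i t.
Proof. by rewrite mulr_gt0 ?expR_gt0// (lt_le_trans dl_gt0)// base_ge. Qed.

Lemma Rad_base i t : Rad i t <= base i t.
Proof.
rewrite /Rad -[leRHS]mulr1 ler_wpM2l ?sqrtr_ge0// -[leRHS]expR0 ler_expR oppr_le0.
by rewrite mulr_ge0// clamp_ge0.
Qed.

Lemma Rad_dl i t : -1 <= age i t -> Rad i t <= dl.
Proof. by move=> h; rewrite -(base_dl h) Rad_base. Qed.

Lemma Rad_alive i t : age i t <= -1 -> Rad i t = Num.sqrt (r i ^+ 2 - t).
Proof.
move=> h; rewrite /Rad base_alive// /late clamp_eq0; last lra.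
by rewrite mulr0 oppr0 expR0 mulr1.
Qed.

Lemma Rad_Rm i t : 0 <= t -> Rad i t <= Rm.
Proof.
move=> t0; apply: le_trans (Rad_base _ _) _.
rewrite -[leRHS](@ger0_norm _ Rm) ?(le_trans (ltW dl_gt0))// -sqrtr_sqr.
rewrite ler_sqrt ?sqr_ge0// ge_max; apply/andP; split.
  by have := r_Rm i; have := r_gt0 i; nra.
by rewrite -dl_w; have := dl_gt0; have := dl_Rm; nra.
Qed.

Lemma Rad_rho i t : 2 <= age i t -> Rad i t = rho i.
Proof.
by move=> h; rewrite /Rad base_dl ?/late ?clamp_eq1 ?mulr1//; lra.
Qed.

Lemma rho_gt0 i : 0 < rho i.
Proof. by rewrite mulr_gt0 ?expR_gt0. Qed.

Lemma rho_dl i : rho i <= dl.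
Proof.
rewrite /rho -[leRHS]mulr1 ler_wpM2l ?(ltW dl_gt0)// -[leRHS]expR0 ler_expR.
by rewrite oppr_le0.
Qed.

Lemma rho_lt i : rho i < 6 * n%:R * rho i.
Proof. by rewrite ltr_pMl ?rho_gt0//; have := n_ge1; lra. Qed.

Lemma Nt_unit i t : dotp (Nt i t) (Nt i t) = 1.
Proof. exact: N_unit. Qed.

Lemma Nt_alive i t : age i t <= 0 -> Nt i t = N i 0.
Proof. by move=> h; rewrite /Nt clamp_eq0. Qed.

Lemma Nt_end i t : 1 <= age i t -> Nt i t = ex.
Proof. by move=> h; rewrite /Nt clamp_eq1. Qed.

Lemma free0 i t : age i t <= 3 -> free i t = 0.
Proof. by move=> h; apply: clamp_eq0; lra. Qed.

Lemma free1 i t : 4 <= age i t -> free i t = 1.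
Proof. by move=> h; apply: clamp_eq1; lra. Qed.

Lemma free_ge0 i t : 0 <= free i t. Proof. exact: clamp_ge0. Qed.
Lemma free_le1 i t : free i t <= 1. Proof. exact: clamp_le1. Qed.

Lemma circ_nrm i t y : circ i t y -> nrm (y - c i) = Rad i t.
Proof. by case/(circleP _ _ _ (ltW (Rad_gt0 i t))). Qed.

(** Either the ring is still decreasing regularly, and [t - h <= 5 * w] bounds the difference of the
    radii by [3 * dl]; or it has radius at most [dl] and the slice at most [3 * dl], about the same
    centre. *)
Lemma slice_approx i t h y : 0 <= h <= t -> h <= r i ^+ 2 -> age i t <= 5 ->
  t - h <= 5 * w -> circ i t y ->
  exists2 y0, circle (c i) (Num.sqrt (r i ^+ 2 - h)) (N i 0) y0 &
    nrm (y - y0) <= 4 * dl.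
Proof.
move=> /andP[h0 ht] hr ai th cy; have w0 := w_gt0; have d0 := dl_gt0.
set q := Num.sqrt (r i ^+ 2 - h).
have q0 : 0 <= q := sqrtr_ge0 _.
have q2 : q ^+ 2 = r i ^+ 2 - h by rewrite sqr_sqrtr// subr_ge0.
have yR := circ_nrm cy.
have [a1|a1] := leP (age i t) (-1).
  have Rs := Rad_alive a1; have R0 := Rad_gt0 i t.
  have Rn : Rad i t != 0 by rewrite gt_eqF.
  have R2 : Rad i t ^+ 2 = r i ^+ 2 - t.
    by rewrite Rs sqr_sqrtr//; move: a1; rewrite ageP; lra.
  case: cy => [ys yN]; rewrite Nt_alive in yN; last lra.
  exists (c i + (q / Rad i t) *: (y - c i)).
    rewrite /circle /= /sqdist (addrC (c i)) addrK; split.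
      by rewrite dotpZl dotpZr -/(sqdist y (c i)) ys; field.
    by rewrite dotpZr yN mulr0.
  have -> : y - (c i + (q / Rad i t) *: (y - c i)) = (1 - q / Rad i t) *: (y - c i).
    by apply/rowP => a; rewrite !mxE; ring.
  rewrite nrmZ yR -{2}(ger0_norm (ltW R0)) -normrM mulrBl mul1r divfK//.
  have qR : Rad i t <= q.
    by rewrite -(ler_pXn2r (_ : (0 < 2)%N)) ?nnegrE ?(ltW R0)// R2 q2; lra.
  have h3 : q - Rad i t <= 3 * dl.
    rewrite -(ler_pXn2r (_ : (0 < 2)%N)) ?nnegrE ?subr_ge0//; last by lra.
    have qR2 : Rad i t * Rad i t <= q * Rad i t by rewrite ler_wpM2r// ltW.
    rewrite sqrrB [in leRHS]exprMn dl_w q2 R2; move: qR2; rewrite -expr2 R2.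
    by rewrite mulr2n; lra.
  by rewrite ler0_norm; lra.
have yd := Rad_dl (ltW a1).
have [y0 cy0] := circle_point (c i) q (N i 0).
exists y0 => //; have [y0q _] := (circleP (c i) (N i 0) y0 q0).1 cy0.
have := nrm_triangle (c i) y y0; rewrite (nrm_distC (c i) y0) yR y0q.
suff : q <= 3 * dl by lra.
move: a1; rewrite ltNge ageP -ltNge => a1.
rewrite -(ler_pXn2r (_ : (0 < 2)%N)) ?nnegrE//; last by lra.
by rewrite q2 exprMn dl_w; lra.
Qed.

(** Both rings are compared with the slices at the last time [h <= t] when both slices exist, at a
    loss of [4 * dl] each. The bound 5 is one more than the age of release, since a step ages a ring
    by at most 1. *)
Lemma alive_sep i k t y z : i != k -> 0 <= t -> age i t <= 5 -> age k t <= 5 ->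
  circ i t y -> circ k t z -> mu / 2 <= nrm (y - z).
Proof.
move=> ik t0 ai ak cy cz; have w0 := w_gt0; have d0 := dl_gt0.
pose h := Num.min t (Num.min (r i ^+ 2) (r k ^+ 2)).
have ht : h <= t by rewrite ge_min lexx.
have hi : h <= r i ^+ 2 by rewrite !ge_min lexx orbT.
have hk : h <= r k ^+ 2 by rewrite !ge_min lexx !orbT.
have h0 : 0 <= h by rewrite !le_min t0 !sqr_ge0.
have th : t - h <= 5 * w.
  rewrite lerBlDr -lerBlDl !le_min; move: ai ak; rewrite !ageP => ai ak.
  by apply/and3P; split; lra.
have h0t : 0 <= h <= t by rewrite h0.
have [y0 cy0 yy] := slice_approx h0t hi ai th cy.
have [z0 cz0 zz] := slice_approx h0t hk ak th cz.
have := slices ik h0 hi hk cy0 cz0.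
have := nrm_triangle y y0 z0; have := nrm_triangle z y z0.
by rewrite (nrm_distC y0 y); have := dl_mu'; lra.
Qed.

Lemma alive_center i k t z : i != k -> 0 <= t -> -1 <= age i t <= 5 ->
  age k t <= 5 -> circ k t z -> mu / 2 - dl <= nrm (c i - z).
Proof.
move=> ik t0 /andP[a1 a5] ak cz.
have [y cy] := circle_point (c i) (Rad i t) (Nt i t).
have := alive_sep ik t0 a5 ak cy cz; have := nrm_triangle (c i) y z.
by rewrite (circ_nrm cy); have := Rad_dl a1; lra.
Qed.

Section one_step.
Variable t : R.
Hypothesis t_ge0 : 0 <= t.
Let t' := t + eta.
Let tt' : t <= t'. Proof. by rewrite /t' lerDl. Qed.

Lemma ratio_le1 k : 0 <= Rad k t' / Rad k t <= 1.
Proof.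
have R0 := Rad_gt0 k t; have R0' := Rad_gt0 k t'.
rewrite divr_ge0 ?(ltW R0) ?(ltW R0')//= ler_pdivrMr// mul1r.
apply: ler_pM; rewrite ?expR_ge0 ?sqrtr_ge0 ?base_anti// ler_expR lerN2.
by rewrite ler_wpM2l// clamp_homo// lerD2r age_homo.
Qed.

(** Each term of [Phi] pays for one motion: [base k t >= dl] turns relative shrinking into a
    difference of [base / dl], [1 - expR (- q) <= q] treats the final shrinking, and the normals are
    [LN]-Lipschitz. *)
Lemma step_var k : (1 - Rad k t' / Rad k t) + 2 * nrm (Nt k t' - Nt k t) <=
  Phi k t' - Phi k t.
Proof.
have aa : age k t <= age k t' := age_homo k tt'.
have hN := N_lip k (clamp_homo aa); rewrite -/(Nt k t') -/(Nt k t) in hN.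
have b0 : 0 < base k t by rewrite (lt_le_trans dl_gt0)// base_ge.
have bb := base_anti k tt'.
pose p := base k t' / base k t; pose q := lam k * (late k t' - late k t).
have -> : Rad k t' / Rad k t = p * expR (- q).
  rewrite /Rad invfM mulrACA -/p; congr (_ * _).
  by rewrite -expRN opprK -expRD /q; congr expR; ring.
have q0 : 0 <= q.
  by rewrite mulr_ge0// subr_ge0 clamp_homo// lerD2r.
have e1 := expR_ge1Dx (- q).
have e2 : expR (- q) <= 1 by rewrite -[leRHS]expR0 ler_expR oppr_le0.
have p1 : p <= 1 by rewrite ler_pdivrMr// mul1r.
have p2 : 1 - p <= base k t / dl - base k t' / dl.
  have bn : base k t != 0 by rewrite gt_eqF.
  have -> : 1 - p = (base k t - base k t') / base k t by rewrite /p; field.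
  by rewrite -mulrBl ler_wpM2l ?subr_ge0// lef_pV2 ?posrE// base_ge.
have pq : 0 <= (1 - p) * (1 - expR (- q)) by rewrite mulr_ge0 ?subr_ge0.
have -> : Phi k t' - Phi k t = (base k t / dl - base k t' / dl) + q +
  2 * (LN * (clamp (age k t') - clamp (age k t))) by rewrite /Phi /q; ring.
by rewrite mulrBr mulr1 mulrBl mul1r in pq; lra.
Qed.

Let lk k := Phi k t' - Phi k t.

Lemma lk_ge0 k : 0 <= lk k.
Proof.
apply: le_trans (step_var k); have [_ h] := andP (ratio_le1 k).
by rewrite addr_ge0 ?subr_ge0// mulr_ge0 ?nrm_ge0.
Qed.

Lemma var_ge0 : 0 <= var t.
Proof. by apply: sumr_ge0 => k _; exact: lk_ge0. Qed.

Lemma lk_var k : lk k <= var t.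
Proof.
rewrite /var (bigD1 k)//= lerDl sumr_ge0// => j _; exact: lk_ge0.
Qed.

Lemma LL_ge0 : 0 <= LL t.
Proof.
by rewrite /LL mulr_ge0 ?var_ge0// mulr_ge0//; have := C1_ge1; lra.
Qed.

Lemma LL_small : LL t <= 12^-1.
Proof.
have C0 : 0 < C1 by have := C1_ge1; lra.
apply: le_trans (ler_wpM2l _ (var_small t_ge0)) _; first by rewrite mulr_ge0// ltW.
by rewrite (_ : _ / _ = 12^-1)//; field; rewrite gt_eqF.
Qed.

Lemma Nt_dot k : 0 <= dotp (Nt k t) (Nt k t').
Proof.
have C0 : 1 <= C1 := C1_ge1.
have h1 : var t <= 1.
  apply: le_trans (var_small t_ge0) _; rewrite invf_le1; lra.
have := step_var k; have := lk_var k; have [_ r1] := andP (ratio_le1 k).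
have := nrm_ge0 (Nt k t' - Nt k t).
have := nrm_sqr (Nt k t' - Nt k t).
rewrite dotpBl !dotpBr !Nt_unit (dotpC (Nt k t')) /lk.
set a := nrm _; set d := dotp _ _ => a2 a0 l1 l2.
have : a <= 1 by lra.
by nra.
Qed.

Lemma A_bound k y : nrm (A k t y) <= lk k * nrm y.
Proof.
apply: le_trans (tilt_bound y (Nt_unit k t) (Nt_unit k t') (Nt_dot k) (ratio_le1 k)) _.
by rewrite ler_wpM2r ?nrm_ge0// step_var.
Qed.

Lemma A_static k y : 2 <= age k t -> A k t y = 0.
Proof.
move=> a2; have a2' := le_trans a2 (age_homo k tt').
rewrite /A -/t' !Rad_rho// !Nt_end; [|lra|lra].
rewrite divff ?gt_eqF ?rho_gt0// /tilt subrr scale0r subrr dotp0l mulr0 mul0r.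
by rewrite scale0r subrr.
Qed.

Lemma cut_le1 k p : 0 <= cut k t p <= 1.
Proof.
rewrite /cut le_max lexx ge_max ler01 /= gerBl divr_ge0 ?tube_ge0//.
by have := mu_gt0; lra.
Qed.

Lemma cut_far k p : mu / 8 <= tube (c k) (Rad k t) (Nt k t) p -> cut k t p = 0.
Proof.
move=> h; apply: max_l; rewrite subr_le0 ler_pdivlMr ?mul1r//.
by have := mu_gt0; lra.
Qed.

Lemma cut_lip k p q : `|cut k t p - cut k t q| <= 16 / mu * nrm (p - q).
Proof.
have mu0 := mu_gt0.
have h := tube_lip (c k) (Rad k t) p q (Nt_unit k t).
have mx (a b : R) : `|Num.max 0 a - Num.max 0 b| <= `|a - b|.
  case: (leP 0 a) => ha; case: (leP 0 b) => hb; rewrite ?subrr ?normr0//.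
  - by rewrite subr0 (ger0_norm ha) (le_trans _ (ler_norm _))//; lra.
  - by rewrite sub0r normrN (ger0_norm hb) distrC (le_trans _ (ler_norm _))//; lra.
apply: le_trans (mx _ _) _; rewrite opprB addrC addrA subrK -mulrBl normrM distrC.
rewrite (@ger0_norm _ (_^-1)) ?invr_ge0; last lra.
apply: le_trans (ler_wpM2r _ h) _; first by rewrite invr_ge0; lra.
by rewrite le_eqVlt; apply/orP; left; apply/eqP; field; rewrite gt_eqF.
Qed.

Lemma term_lip k p q :
  nrm (cut k t p *: A k t (p - c k) - cut k t q *: A k t (q - c k)) <=
  C1 * lk k * nrm (p - q).
Proof.
have l0 := lk_ge0 k; have d0 := nrm_ge0 (p - q); have mu0 := mu_gt0.
have C0 := C1_ge1.
(* If both points are outside the support, both terms vanish; otherwise the roles are arranged so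
   that [q], to which the difference of cut-offs is attached, is inside. *)
wlog : p q d0 / tube (c k) (Rad k t) (Nt k t) q < mu / 8.
  move=> H; have [hq|hq] := ltP (tube (c k) (Rad k t) (Nt k t) q) (mu / 8); first exact: H.
  have [hp|hp] := ltP (tube (c k) (Rad k t) (Nt k t) p) (mu / 8).
    by rewrite (nrm_distC p q) [leLHS]nrm_distC; apply: H => //; rewrite nrm_ge0.
  rewrite !cut_far// !scale0r subrr nrm0 mulr_ge0// mulr_ge0//; lra.
move=> hq.
have qB : nrm (q - c k) <= Rm + mu.
  have [z cz qz] := tube_near (c k) q (ltW (Rad_gt0 k t)) (Nt_unit k t).
  have := nrm_triangle z q (c k); rewrite (circ_nrm cz).
  by have := Rad_Rm k t_ge0; lra.
have -> : cut k t p *: A k t (p - c k) - cut k t q *: A k t (q - c k) =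
    cut k t p *: A k t (p - q) + (cut k t p - cut k t q) *: A k t (q - c k).
  have -> : A k t (p - q) = A k t (p - c k) - A k t (q - c k).
    by rewrite /A -tiltB; congr (tilt _ _ _); apply/rowP => a; rewrite !mxE; ring.
  move: (A k t (p - c k)) (A k t (q - c k)) => u v.
  by apply/rowP => a; rewrite !mxE; ring.
apply: le_trans (nrmD _ _) _; rewrite !nrmZ.
have [c0 c1] := andP (cut_le1 k p); rewrite (ger0_norm c0).
have h1 : cut k t p * nrm (A k t (p - q)) <= lk k * nrm (p - q).
  rewrite -[leRHS]mul1r; apply: ler_pM => //; first exact: nrm_ge0.
  exact: A_bound.
have h2 : `|cut k t p - cut k t q| * nrm (A k t (q - c k)) <=
    (16 / mu * nrm (p - q)) * (lk k * (Rm + mu)).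
  apply: ler_pM; rewrite ?nrm_ge0//; first exact: cut_lip.
  by apply: le_trans (A_bound _ _) _; rewrite ler_wpM2l.
apply: le_trans (lerD h1 h2) _.
rewrite le_eqVlt; apply/orP; left; apply/eqP; rewrite /C1; field.
by rewrite gt_eqF.
Qed.

Lemma V_lip p q : nrm (V t p - V t q) <= LL t / 2 * nrm (p - q).
Proof.
rewrite /V -sumrB; apply: le_trans (nrm_sum _) _.
rewrite (_ : LL t / 2 = \sum_k C1 * lk k).
  by rewrite mulr_suml; apply: ler_sum => k _; exact: term_lip.
by rewrite -mulr_sumr /LL /var; field.
Qed.

Lemma V_coord a p q : V t p 0 a - V t q 0 a <= LL t / 2 * nrm (p - q).
Proof.
apply: le_trans (V_lip p q); apply: le_trans (coord_le_nrm _ a).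
by rewrite !mxE ler_norm.
Qed.

(** Another ring of age at most 4 is at distance at least [mu / 2], beyond the reach [mu / 8] of its
    cut-off; an older one no longer changes. *)
Lemma V_on k y : age k t <= 4 -> circ k t y -> V t y = A k t (y - c k).
Proof.
move=> ak cy; rewrite /V (bigD1 k)//= [X in _ + X]big1 ?addr0.
  rewrite /cut tube_circle ?(ltW (Rad_gt0 _ _)) ?Nt_unit// mul0r subr0.
  by rewrite max_r ?scale1r.
move=> j jk; have [aj|aj] := leP (age j t) 4; last by rewrite A_static ?scaler0//; lra.
rewrite cut_far ?scale0r//.
have [z cz yz] := tube_near (c j) y (ltW (Rad_gt0 j t)) (Nt_unit j t).
have a5 : age k t <= 5 by lra. have a5' : age j t <= 5 by lra.
rewrite eq_sym in jk; have := alive_sep jk t_ge0 a5 a5' cy cz.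
by have := mu_gt0; lra.
Qed.

(** Only rings of age less than 2 move, and they stay at distance at least [mu / 2 - dl] from [c k].
    So a ring is released where the field vanishes, and nothing jumps. *)
Lemma V_flat k p : 3 <= age k t <= 4 -> nrm (p - c k) <= mu / 4 -> V t p = 0.
Proof.
move=> /andP[a3 a4] pk; apply: big1 => j _.
have [aj|aj] := leP 2 (age j t); first by rewrite A_static ?scaler0.
have kj : k != j by apply/eqP => kj; rewrite kj in a3; lra.
rewrite cut_far ?scale0r//.
have [z cz pz] := tube_near (c j) p (ltW (Rad_gt0 j t)) (Nt_unit j t).
have a5 : -1 <= age k t <= 5 by lra. have a5' : age j t <= 5 by lra.
have := alive_center kj t_ge0 a5 a5' cz; have := nrm_triangle p (c k) z.
by rewrite (nrm_distC (c k) p); have := mu_gt0; have := dl_mu'; lra.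
Qed.

Lemma V_flat_bound k p a : 3 <= age k t <= 4 ->
  `|V t p 0 a| <= LL t / 2 * Num.max 0 (nrm (p - c k) - mu / 4).
Proof.
move=> ak; have mu0 := mu_gt0; have L0 := LL_ge0.
have [pk|pk] := leP (nrm (p - c k)) (mu / 4).
  by rewrite (V_flat ak pk) mxE normr0 mulr_ge0 ?divr_ge0// le_max lexx.
set d := nrm _ in pk *.
(* The radial projection of [p] to the ball where the field vanishes. *)
pose q := c k + (mu / 4 / d) *: (p - c k).
have d0 : 0 < d by lra.
have qk : nrm (q - c k) = mu / 4.
  by rewrite /q addrC addKr nrmZ ger0_norm ?divr_ge0 ?(ltW d0)// -/d ?divfK ?gt_eqF//; lra.
have pq : nrm (p - q) = d - mu / 4.
  have -> : p - q = (1 - mu / 4 / d) *: (p - c k).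
    by apply/rowP => b; rewrite !mxE; ring.
  rewrite nrmZ -/d ger0_norm ?mulrBl ?mul1r ?divfK ?gt_eqF// subr_ge0.
  by rewrite ler_pdivrMr// mul1r ltW.
rewrite max_r; last by lra.
rewrite -pq; apply: le_trans (V_lip p q).
by rewrite (V_flat ak (_ : nrm (q - c k) <= _)) ?qk// subr0 coord_le_nrm.
Qed.

Variable x : 'I_n -> 'rV[R]_3.
Let re i := rho i * free i t.

Lemma re_ge0 i : 0 <= re i.
Proof. by rewrite mulr_ge0 ?free_ge0// ltW ?rho_gt0. Qed.

Lemma re_rho i : re i <= rho i.
Proof. by rewrite -[leRHS]mulr1 ler_wpM2l ?free_le1// ltW ?rho_gt0. Qed.

Lemma sp_ge0 i j : 0 <= sp t x i j. Proof. exact: gap_ge0. Qed.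

Lemma sp_refl i : sp t x i i = 0.
Proof. by rewrite /sp subrr gap_refl// re_ge0. Qed.

Lemma sp_dist i j : nrm (x i - x j) <= sp t x i j + re i + re j.
Proof. exact: gap_dist. Qed.

Lemma disp_flat k i a : 3 <= age k t <= 4 ->
  `|disp t x i 0 a| <= LL t / 2 * Num.max 0 (nrm (x i - c k) - mu / 8).
Proof.
move=> ak; have L0 := LL_ge0; have mu0 := mu_gt0; have L2 : 0 <= LL t / 2 by rewrite divr_ge0.
rewrite mxE ler_norml; apply/andP; split.
  have := @regularise_flat R n 3 (sp t x) x re sp_ge0 sp_dist (LL t)
    (fun j => V t (x j) 0 a) L0 re_ge0 (c k) (mu / 4) (mu / 8) i _ _.
  have -> : nrm (x i - c k) + mu / 8 - mu / 4 = nrm (x i - c k) - mu / 8 by lra.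
  apply => [j|l].
    by have := V_flat_bound (x j) a ak; rewrite ler_norml => /andP[].
  apply: le_trans (_ : 2 * n%:R * dl <= _).
    by rewrite ler_wpM2l ?mulr_ge0 ?ler0n// (le_trans (re_rho l) (rho_dl l)).
  by move: dl_mu; rewrite -!mulrA; move: (n%:R * dl) => K; lra.
apply: le_trans (regularise_le _ _ _ _) _.
have := V_flat_bound (x i) a ak; rewrite ler_norml => /andP[_ h].
apply: le_trans h _; rewrite ler_wpM2l// ge_max !le_max lexx /=.
by apply/orP; right; lra.
Qed.

(** Above, a regularisation is a minorant; below, [regularise_near] applies. The factor 3 counts the
    coordinates, which are regularised separately. *)
Lemma disp_near k y i : age k t <= 4 -> circ k t y ->
  (forall l, 6 * n%:R * re l <= nrm (x l - y)) ->
  nrm (disp t x i - A k t (y - c k)) <= 3 * LL t * nrm (x i - y).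
Proof.
move=> ak cy tame; have L0 := LL_ge0; rewrite -(V_on ak cy).
suff h a : `|(disp t x i - V t y) 0 a| <= LL t * nrm (x i - y).
  by apply: le_trans (nrm_le_sum _) _; have := h 0; have := h 1; have := h 2; lra.
have d0 : 0 <= LL t * nrm (x i - y) by rewrite mulr_ge0 ?nrm_ge0.
rewrite !mxE ler_norml; apply/andP; split.
  have := @regularise_near R n 3 (sp t x) x re sp_ge0 sp_dist (LL t)
    (fun j => V t (x j) 0 a) L0 re_ge0 n_gt0 y i (fun j => V_coord a _ _) tame.
  have := V_coord a y (x i); rewrite (nrm_distC y).
  by lra.
have := regularise_le (sp t x) (LL t) (fun j => V t (x j) 0 a) i.
by have := V_coord a (x i) y; lra.
Qed.

(** During its release, the ring [k] may itself violate the smallness required by [regularise_near],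
    being at distance only its own radius from [y]. The vanishing of the field around it is used
    instead. *)
Lemma disp_near_flat k y i : 3 <= age k t <= 4 -> circ k t y ->
  nrm (disp t x i - A k t (y - c k)) <= 3 * LL t * nrm (x i - y).
Proof.
move=> ak cy; have [a3 a4] := andP ak; have L0 := LL_ge0.
rewrite A_static ?subr0; last lra.
have yk : nrm (y - c k) <= mu / 8.
  have am1 : -1 <= age k t by lra.
  rewrite (circ_nrm cy); have := Rad_dl am1.
  by have := dl_mu'; have := mu_gt0; lra.
have h : Num.max 0 (nrm (x i - c k) - mu / 8) <= nrm (x i - y).
  rewrite ge_max nrm_ge0 /=; have := nrm_triangle y (x i) (c k); lra.
have L2 : 0 <= LL t / 2 by rewrite divr_ge0.
have hh := ler_wpM2l L2 h; have d0 : 0 <= LL t * nrm (x i - y) by rewrite mulr_ge0 ?nrm_ge0.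
apply: le_trans (nrm_le_sum _) _.
by have := disp_flat i 0 ak; have := disp_flat i 1 ak; have := disp_flat i 2 ak; lra.
Qed.

Lemma disp_self i : 3 <= age i t <= 4 -> x i = c i -> disp t x i = 0.
Proof.
move=> ai xi; apply/rowP => a; rewrite [RHS]mxE; apply/eqP; rewrite -normr_le0.
apply: le_trans (disp_flat i a ai) _.
by rewrite xi subrr nrm0 max_l ?mulr0//; have := mu_gt0; lra.
Qed.

Lemma disp_lip i j : 4 <= age i t -> 4 <= age j t ->
  nrm (disp t x i - disp t x j) <= 3 * LL t * gap (rho i) (rho j) (x i - x j).
Proof.
move=> ai aj.
have sE : sp t x i j = gap (rho i) (rho j) (x i - x j).
  by rewrite /sp !free1// !mulr1.
have sE' : sp t x j i = gap (rho i) (rho j) (x i - x j).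
  by rewrite /sp !free1// !mulr1 -gapN opprB.
suff h a : `|(disp t x i - disp t x j) 0 a| <= LL t * gap (rho i) (rho j) (x i - x j).
  by apply: le_trans (nrm_le_sum _) _; have := h 0; have := h 1; have := h 2; lra.
rewrite !mxE ler_norml lerBlDr -{2}sE -lerBlDl.
have hl := regularise_lip sp_ge0 (fun l => V t (x l) 0 a) LL_ge0 sp_refl.
have := hl i j; have := hl j i; rewrite sE sE' => h1 h2.
by apply/andP; split; lra.
Qed.

End one_step.

Record invariant t x : Prop := Invariant {
  inv_alive : forall i, age i t <= 4 -> x i = c i;
  inv_mixed : forall i k y, i != k -> 4 < age i t -> age k t <= 4 ->
    circ k t y -> Q i t <= nrm (x i - y);
  inv_dead : forall i k, i != k -> 4 < age i t -> 4 < age k t ->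
    0 < gap (rho i) (rho k) (x i - x k) }.

Lemma Phi_homo k t t' : t <= t' -> Phi k t <= Phi k t'.
Proof.
move=> tt; rewrite /Phi; apply: lerD; [apply: lerD|].
- by rewrite lerN2 ler_wpM2r ?invr_ge0 ?(ltW dl_gt0)// base_anti.
- by rewrite ler_wpM2l// clamp_homo// lerD2r age_homo.
- by rewrite ler_wpM2l ?mulr_ge0// clamp_homo// age_homo.
Qed.

Lemma Q_mu i t : 4 <= age i t -> Q i t <= mu / 4.
Proof.
rewrite /age ler_pdivlMr ?w_gt0// => ai.
rewrite /Q -[leRHS]mulr1 ler_wpM2l//; first by have := mu_gt0; lra.
rewrite -[leRHS]expR0 ler_expR oppr_le0 mulr_ge0//; first by have := C1_ge1; lra.
apply: sumr_ge0 => k _; rewrite subr_ge0 Phi_homo//; lra.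
Qed.

(** The exponent drops by [12 * C1 * var t], that is [2 * (3 * LL t)], which [expR_small] turns into
    the contraction factor allowed by [disp_near]. *)
Lemma Q_step i t : 0 <= t -> Q i (t + eta) <= (1 - 3 * LL t) * Q i t.
Proof.
move=> t0; have L0 := LL_ge0 t; have L1 := LL_small t0.
rewrite /Q mulrCA ler_wpM2l//; first by have := mu_gt0; lra.
have -> : - (12 * C1 * \sum_k (Phi k (t + eta) - Phi k (r i ^+ 2 + 4 * w))) =
  - (2 * (3 * LL t)) + - (12 * C1 * \sum_k (Phi k t - Phi k (r i ^+ 2 + 4 * w))).
  rewrite /LL /var !sumrB; ring.
by rewrite expRD ler_wpM2r ?expR_ge0// expR_small//; lra.
Qed.

(** This is the smallness hypothesis of [disp_near]. The bound 3 on the age of [k] excludes [l = k]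
    among the rings with nonzero [free]. *)
Lemma tame_reach t x k y : 0 <= t -> invariant t x -> age k t <= 3 -> circ k t y ->
  forall l, 6 * n%:R * (rho l * free l t) <= nrm (x l - y).
Proof.
move=> t0 [IA IB IC] ak cy l; have [al|al] := leP (age l t) 3.
  by rewrite free0// mulr0 mulr0 nrm_ge0.
have lk : l != k by apply/eqP => lk; rewrite lk in al; lra.
have h : 6 * n%:R * (rho l * free l t) <= 6 * n%:R * rho l.
  by rewrite ler_wpM2l ?mulr_ge0 ?ler0n// re_rho.
apply: le_trans h _; have [al4|al4] := leP (age l t) 4.
  rewrite IA//; have a5 : -1 <= age l t <= 5 by lra.
  have ak5 : age k t <= 5 by lra.
  have := alive_center lk t0 a5 ak5 cy.
  have := ler_wpM2l (_ : 0 <= 6 * n%:R) (rho_dl l); rewrite mulr_ge0 ?ler0n// => /(_ isT).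
  move: dl_mu dl_mu'; rewrite -!mulrA; move: (n%:R * dl) (n%:R * rho l) => K K'.
  by have := mu_gt0; lra.
have ak4 : age k t <= 4 by lra.
apply: le_trans (IB l k y lk al4 ak4 cy); apply: Q_rho.
by move: al4; rewrite ltNge ageP -ltNge => /ltW.
Qed.

(* A point [y'] of the ring [k] comes from a point [y], whose motion differs from
   that of the center [x i] by at most [3 * LL t] times their distance. *)
Lemma drag_close t x i k y' : 0 <= t -> invariant t x -> i != k ->
  4 < age i t -> age k t <= 4 -> circ k (t + eta) y' ->
  Q i (t + eta) <= nrm (next t x i - y').
Proof.
move=> t0 I ik ai ak cy'.
have R0 := Rad_gt0 k t; have R0' := Rad_gt0 k (t + eta).
have [y cy ->] : exists2 y, circ k t y & y' = y + A k t (y - c k).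
  apply: (tilt_onto (ltW R0) _ (Nt_unit k t) (Nt_unit k (t + eta)) (Nt_dot t0 k)).
    by rewrite divr_gt0.
  by rewrite divfK ?gt_eqF.
have h : nrm (disp t x i - A k t (y - c k)) <= 3 * LL t * nrm (x i - y).
  have [a3|a3] := leP (age k t) 3.
    by apply: disp_near => //; exact: tame_reach t0 I a3 cy.
  by apply: disp_near_flat => //; rewrite ak ltW.
have := inv_mixed I ik ai ak cy; have L1 := LL_small t0; have L0 := LL_ge0 t.
move=> q; apply: le_trans (Q_step i t0) _.
rewrite /next free1 ?scale1r; last lra.
have := nrm_triangle (disp t x i - A k t (y - c k) + (x i - y)) 0 (x i - y).
have e : x i + disp t x i - (y + A k t (y - c k)) =
  (disp t x i - A k t (y - c k)) + (x i - y).
  by apply/rowP => a; rewrite !mxE; ring.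
rewrite e; set D := disp _ _ _ - _ in h *; set z := x i - y in h q *.
move=> _; have := nrmB (D + z) D; rewrite addrC addKr => hz.
have : (1 - 3 * LL t) * Q i t <= (1 - 3 * LL t) * nrm z by rewrite ler_wpM2l//; lra.
by lra.
Qed.

Lemma inv_step t x : 0 <= t -> invariant t x -> invariant (t + eta) (next t x).
Proof.
move=> t0 I; have t0' : 0 <= t + eta by rewrite addr_ge0.
have aa i : age i t <= age i (t + eta) by apply: age_homo; rewrite lerDl.
have stay i : age i t <= 4 -> next t x i = c i.
  move=> ai; rewrite /next (inv_alive I ai).
  have [a3|a3] := leP (age i t) 3; first by rewrite free0// scale0r addr0.
  by rewrite disp_self ?scaler0 ?addr0 ?(inv_alive I ai)// ai ltW.
have young i : 4 < age i (t + eta) -> age i t <= 4 -> -1 <= age i (t + eta) <= 5.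
  by move=> h1 h2; have := age_step i t; lra.
(* Here the release of [k] ends during the step: [k] is still at its initial centre, and its new age
   is at most 5, so that the estimates for surviving rings still apply to it. *)
have apart i k : i != k -> 4 < age i (t + eta) -> 4 < age k (t + eta) ->
    age k t <= 4 -> 0 < gap (rho i) (rho k) (next t x i - next t x k).
  move=> ik ai ak ak4; rewrite (stay k ak4).
  apply: gap_gt0; [exact: ltW (rho_gt0 _)|exact: ltW (rho_gt0 _)|move=> y cy].
  have cy' : circ k (t + eta) y by rewrite /circ Rad_rho ?Nt_end//; lra.
  have [ai4|ai4] := leP (age i t) 4.
    rewrite stay//; have := alive_center ik t0' (young _ ai ai4) _ cy'.
    have [_ h] := andP (young _ ak ak4) => /(_ h).
    by have := rho_dl i; have := dl_mu'; have := dl_gt0; lra.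
  apply: lt_le_trans (drag_close t0 I ik ai4 ak4 cy').
  apply: lt_le_trans (Q_rho _); last first.
    by move: ai; rewrite ltNge ageP -ltNge => /ltW.
  exact: rho_lt.
split.
- by move=> i ai; apply: stay; apply: le_trans (aa i) ai.
- move=> i k y ik ai ak cy; have ak4 := le_trans (aa k) ak.
  have [ai4|ai4] := leP (age i t) 4; last exact: drag_close t0 I ik ai4 ak4 cy.
  rewrite stay//; apply: le_trans (Q_mu (ltW ai)) _.
  have := alive_center ik t0' (young _ ai ai4) _ cy.
  by have := dl_mu'; have := dl_gt0 => h1 h2 /(_ _) h3; have := h3 ltac:(lra); lra.
- move=> i k ik ai ak; have [ak4|ak4] := leP (age k t) 4; first exact: apart.
  have [ai4|ai4] := leP (age i t) 4.
    by rewrite -[_ - _]opprB gapN; apply: apart => //; rewrite eq_sym.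
  (* The gap changes by at most [2 * (3 * LL t)] times itself, hence by at most half of itself since
     [LL t <= 12^-1]. *)
  have L1 := LL_small t0; have L0 := LL_ge0 t.
  have g0 := inv_dead I ik ai4 ak4.
  rewrite /next !free1 ?scale1r; try lra.
  have := gap_lip (rho i) (rho k) (x i - x k) (x i + disp t x i - (x k + disp t x k)).
  have -> : x i - x k - (x i + disp t x i - (x k + disp t x k)) =
    disp t x k - disp t x i by apply/rowP => a; rewrite !mxE; ring.
  have := disp_lip x (ltW ai4) (ltW ak4); rewrite nrm_distC.
  by set g' := gap _ _ (_ + _ - _); nra.
Qed.

Lemma inv_pos m : invariant (m%:R * eta) (pos m).
Proof.
elim: m => [|m IH] /=; last by rewrite -natr1 mulrDl mul1r; apply: inv_step => //; exact: mulr_ge0.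
have a0 i : age i (0%:R * eta) <= 4.
  by rewrite mul0r ageP; have := sqr_ge0 (r i); have := w_gt0; lra.
by split=> // [i k y _ h|i k _ h]; rewrite ltNge a0 in h.
Qed.

Lemma inv_disjoint t x i j : 0 <= t -> invariant t x -> i != j ->
  circle (x i) (Rad i t) (Nt i t) `&` circle (x j) (Rad j t) (Nt j t) = set0.
Proof.
move=> t0 I; wlog : i j / age j t <= age i t.
  move=> H ij; have [h|h] := leP (age j t) (age i t); first exact: H.
  by rewrite setIC; apply: H; rewrite ?(ltW h)// eq_sym.
move=> aij ij; have [ai|ai] := leP (age i t) 4.
  rewrite !(inv_alive I) ?(le_trans aij)//.
  rewrite -subset0 => p [pi pj].
  have := alive_sep ij t0 _ _ pi pj; rewrite subrr nrm0 => H.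
  by have := H ltac:(lra) ltac:(lra); have := mu_gt0; lra.
have [ai2 ai1] : 2 <= age i t /\ 1 <= age i t by split; lra.
rewrite (Rad_rho ai2) (Nt_end ai1); have [aj|aj] := leP (age j t) 4.
  rewrite (inv_alive I aj) -subset0 => p [pi pj].
  have := inv_mixed I ij ai aj pj.
  have [h _] := (circleP (x i) ex p (ltW (rho_gt0 i))).1 pi.
  rewrite nrm_distC h; have := Q_rho (_ : r i ^+ 2 + 4 * w <= t).
  have h4 : r i ^+ 2 + 4 * w <= t.
    by move: ai; rewrite ltNge ageP -ltNge => /ltW.
  by move=> /(_ h4); have := rho_lt i; lra.
have [aj2 aj1] : 2 <= age j t /\ 1 <= age j t by split; lra.
rewrite (Rad_rho aj2) (Nt_end aj1).
by apply: gap_disjoint; rewrite ?(ltW (rho_gt0 _))//; exact: (inv_dead I).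
Qed.

(** The third coordinate of the field vanishes on the xy-plane, and the regularisation of 0 is 0.
    This keeps the motion inside [UW] when the homotopy is in [W]. *)
Lemma pos_flat m : (forall i, c i 0 2 = 0) -> (forall i s, N i s 0 2 = 0) ->
  forall i, pos m i 0 2 = 0.
Proof.
move=> c2 N2; elim: m => [|m IH] i //=; set t := m%:R * eta.
have V2 p : p 0 2 = 0 -> V t p 0 2 = 0.
  move=> p2; rewrite /V summxE big1// => k _.
  rewrite /A /tilt !mxE c2 p2 /Nt !N2; ring.
have d2 : disp t (pos m) i 0 2 = 0.
  rewrite mxE; have L0 := LL_ge0 t; apply/eqP; rewrite eq_le; apply/andP; split.
    by apply: le_trans (regularise_le _ _ _ _) _; rewrite V2.
  apply: regularise_ge => p _; rewrite V2// add0r mulr_ge0//.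
  apply: walk_cost_ge0; exact: sp_ge0.
by rewrite /next !mxE IH; rewrite mxE in d2; rewrite d2 mulr0 addr0.
Qed.

End dragging.

(** * Continuity *)

Section continuity_toolkit.
Context {R : realType} {T : topologicalType}.
Implicit Types (f g : T -> R).

Lemma ctsD f g : continuous f -> continuous g -> continuous (fun t => f t + g t).
Proof. by move=> cf cg t; apply: (@cvgD _ R); [exact: cf|exact: cg]. Qed.

Lemma ctsN f : continuous f -> continuous (fun t => - f t).
Proof. by move=> cf t; apply: (@cvgN _ R); exact: cf. Qed.

Lemma ctsB f g : continuous f -> continuous g -> continuous (fun t => f t - g t).
Proof. by move=> cf cg; apply: ctsD => //; exact: ctsN. Qed.

Lemma ctsM f g : continuous f -> continuous g -> continuous (fun t => f t * g t).
Proof. by move=> cf cg t; apply: cvgM; [exact: cf|exact: cg]. Qed.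

Lemma ctsV f : continuous f -> (forall t, f t != 0) -> continuous (fun t => (f t)^-1).
Proof. by move=> cf f0 t; apply: cvgV; [exact: f0|exact: cf]. Qed.

Lemma cts_norm f : continuous f -> continuous (fun t => `|f t|).
Proof. by move=> cf t; apply: (@cvg_norm _ R); exact: cf. Qed.

Lemma cts_sqrt f : continuous f -> continuous (fun t => Num.sqrt (f t)).
Proof. by move=> cf; apply: (cts_comp (@sqrt_continuous R) cf). Qed.

Lemma cts_expR f : continuous f -> continuous (fun t => expR (f t)).
Proof. by move=> cf; apply: (cts_comp (@continuous_expR R) cf). Qed.

Lemma cts_clamp f : continuous f -> continuous (fun t => clamp (f t)).
Proof. by move=> cf; apply: (cts_comp (@clamp_continuous R) cf). Qed.

Lemma cts_exp f k : continuous f -> continuous (fun t => f t ^+ k).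
Proof.
move=> cf; elim: k => [|k IH]; first exact: cts_cst.
by under eq_fun do rewrite exprS; exact: ctsM.
Qed.

Lemma cts_sum (I : Type) (s : seq I) (F : I -> T -> R) :
  (forall i, continuous (F i)) -> continuous (fun t => \sum_(i <- s) F i t).
Proof.
move=> cF; elim: s => [|i s IH].
  by under eq_fun do rewrite big_nil; exact: cts_cst.
by under eq_fun do rewrite big_cons; exact: ctsD.
Qed.

Lemma cts_bigmin (I : Type) (s : seq I) (F : I -> T -> R) f :
  continuous f -> (forall i, continuous (F i)) ->
  continuous (fun t => \big[Num.min/f t]_(i <- s) F i t).
Proof.
move=> cf cF; elim: s => [|i s IH].
  by under eq_fun do rewrite big_nil.
by under eq_fun do rewrite big_cons; apply: cts_min.
Qed.

Section vectors.
Variable m : nat.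
Implicit Types (u v : T -> 'rV[R]_m).

Lemma ctsvD u v : continuous u -> continuous v -> continuous (fun t => u t + v t).
Proof. by move=> cu cv t; apply: (@cvgD _ 'rV[R]_m); [exact: cu|exact: cv]. Qed.

Lemma ctsvZ f u : continuous f -> continuous u -> continuous (fun t => f t *: u t).
Proof. by move=> cf cu t; apply: (@cvgZ _ 'rV[R]_m); [exact: cf|exact: cu]. Qed.

Lemma ctsvN u : continuous u -> continuous (fun t => - u t).
Proof.
by move=> cu; under eq_fun do rewrite -scaleN1r; apply: ctsvZ => //; exact: cts_cst.
Qed.

Lemma ctsvB u v : continuous u -> continuous v -> continuous (fun t => u t - v t).
Proof. by move=> cu cv; apply: ctsvD => //; exact: ctsvN. Qed.

Lemma cts_coord u i j : continuous u -> continuous (fun t => u t i j).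
Proof. by move=> cu; apply: (cts_comp (@coord_continuous R 1 m i j) cu). Qed.

Lemma ctsv_sum (I : Type) (s : seq I) (F : I -> T -> 'rV[R]_m) :
  (forall i, continuous (F i)) -> continuous (fun t => \sum_(i <- s) F i t).
Proof.
move=> cF; elim: s => [|i s IH].
  by under eq_fun do rewrite big_nil; exact: cts_cst.
by under eq_fun do rewrite big_cons; exact: ctsvD.
Qed.

Lemma cts_row u : (forall i, continuous (fun t => u t 0 i)) -> continuous u.
Proof.
move=> cu; have -> : u = fun t => \sum_i u t 0 i *: delta_mx 0 i.
  by apply/funext => t; exact: row_sum_delta.
by apply: ctsv_sum => i; apply: ctsvZ => //; exact: cts_cst.
Qed.

Lemma cts_dotp u v : continuous u -> continuous v -> continuous (fun t => dotp (u t) (v t)).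
Proof. by move=> cu cv; apply: cts_sum => i; apply: ctsM; exact: cts_coord. Qed.

Lemma cts_nrm u : continuous u -> continuous (fun t => nrm (u t)).
Proof. by move=> cu; apply: cts_sqrt; exact: cts_dotp. Qed.

End vectors.

Lemma cts_vec3 f g h : continuous f -> continuous g -> continuous h ->
  continuous (fun t => vec3 (f t) (g t) (h t)).
Proof.
move=> cf cg ch; apply: cts_row => i; under eq_fun do rewrite mxE.
by case: (i == 0) => //; case: (i == 1).
Qed.

End continuity_toolkit.

Ltac cts1 :=
  lazymatch goal with
  | |- forall x, continuous_at x (fun _ => ?c) => apply: cts_cst
  | |- forall x, continuous_at x (fun t => (@?f t - @?g t)%R) =>
      first [apply: (@ctsB _ _ f g) | apply: (@ctsvB _ _ _ f g)]
  | |- forall x, continuous_at x (fun t => (@?f t + @?g t)%R) =>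
      first [apply: (@ctsD _ _ f g) | apply: (@ctsvD _ _ _ f g)]
  | |- forall x, continuous_at x (fun t => (- @?f t)%R) =>
      first [apply: (@ctsN _ _ f) | apply: (@ctsvN _ _ _ f)]
  | |- forall x, continuous_at x (fun t => (@?f t * @?g t)%R) =>
      apply: (@ctsM _ _ f g)
  | |- forall x, continuous_at x (fun t => (@?f t *: @?g t)%R) =>
      apply: (@ctsvZ _ _ _ f g)
  | |- forall x, continuous_at x (fun t => (`|@?f t|)%R) =>
      apply: (@cts_norm _ _ f)
  | |- forall x, continuous_at x (fun t => Num.sqrt (@?f t)) =>
      apply: (@cts_sqrt _ _ f)
  | |- forall x, continuous_at x (fun t => expR (@?f t)) =>
      apply: (@cts_expR _ _ f)
  | |- forall x, continuous_at x (fun t => clamp (@?f t)) =>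
      apply: (@cts_clamp _ _ f)
  | |- forall x, continuous_at x (fun t => Num.min (@?f t) (@?g t)) =>
      apply: (@cts_min _ _ f g)
  | |- forall x, continuous_at x (fun t => Num.max (@?f t) (@?g t)) =>
      apply: (@cts_max _ _ f g)
  | |- forall x, continuous_at x (fun t => (@?f t ^+ _)%R) =>
      apply: (@cts_exp _ _ f)
  | |- forall x, continuous_at x (fun t => vec3 (@?f t) (@?g t) (@?h t)) =>
      apply: (@cts_vec3 _ _ f g h)
  | |- forall x, continuous_at x (fun t => dotp (@?f t) (@?g t)) =>
      apply: (@cts_dotp _ _ _ f g)
  | |- forall x, continuous_at x (fun t => nrm (@?f t)) =>
      apply: (@cts_nrm _ _ _ f)
  | |- forall x, continuous_at x (fun t => fun_of_matrix (@?f t) _ _) =>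
      apply: (@cts_coord _ _ _ f)
  end.

Ltac cts := repeat first [assumption | progress cts1].

Lemma cts_regularise (R : realType) (T : topologicalType) n
    (s : T -> 'I_n -> 'I_n -> R) (L : T -> R) (f : T -> 'I_n -> R) i :
  (forall i j, continuous (fun t => s t i j)) -> continuous L ->
  (forall i, continuous (fun t => f t i)) ->
  continuous (fun t => regularise (s t) (L t) (f t) i).
Proof.
move=> cs cL cf; apply: cts_bigmin => // p; apply: ctsD => //; apply: ctsM => //.
elim: (tval p) i => [|j q IH] i; first exact: cts_cst.
exact: ctsD.
Qed.

Lemma cts_tilt (R : realType) (T : topologicalType) (k : T -> R) (N N' y : T -> 'rV[R]_3) :
  continuous k -> continuous N -> continuous N' -> continuous y ->
  (forall t, 1 + dotp (N t) (N' t) != 0) ->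
  continuous (fun t => tilt (k t) (N t) (N' t) (y t)).
Proof. by move=> ck cN cN' cy n0; rewrite /tilt; cts; apply: ctsV => //; cts. Qed.

Lemma cts_tube (R : realType) (T : topologicalType) (r : T -> R) (c N x : T -> 'rV[R]_3) :
  continuous r -> continuous c -> continuous N -> continuous x ->
  continuous (fun t => tube (c t) (r t) (N t) (x t)).
Proof. by move=> cr cc cN cx; rewrite /tube /par; cts. Qed.

Lemma cts_gap (R : realType) (T : topologicalType) (r r' : T -> R) (D : T -> 'rV[R]_3) :
  continuous r -> continuous r' -> continuous D ->
  continuous (fun t => gap (r t) (r' t) (D t)).
Proof. by move=> cr cr' cD; rewrite /gap /flat; cts. Qed.

Lemma compact_positive_min (R : realType) (T : topologicalType) (K : set T) (f : T -> R) :
  compact K -> continuous f -> (forall x, K x -> 0 < f x) ->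
  exists2 e : R, 0 < e & forall x, K x -> e <= f x.
Proof.
move=> cK cf f0; have [K0|/set0P K0] := eqVneq K set0.
  by exists 1 => // x; rewrite K0.
have [x /set_mem Kx xmin] := compact_EVT_min K0 cK (continuous_subspaceT cf).
by exists (f x); [exact: f0|move=> y Ky; apply: xmin; exact: mem_set].
Qed.

Lemma compact_upper_bound (R : realType) (T : topologicalType) (K : set T) (f : T -> R) :
  compact K -> continuous f -> exists b : R, forall x, K x -> f x <= b.
Proof.
move=> cK cf; have [K0|/set0P K0] := eqVneq K set0.
  by exists 0 => x; rewrite K0.
have [x /set_mem Kx xmax] := compact_EVT_max K0 cK (continuous_subspaceT cf).
by exists (f x) => y Ky; apply: xmax; exact: mem_set.
Qed.

Section dragging_continuity.
Context {R : realType} {n : nat} {T : topologicalType}.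
Variables (c : 'I_n -> T -> 'rV[R]_3) (r : 'I_n -> T -> R).
Variables (N : 'I_n -> R -> T -> 'rV[R]_3) (lam : 'I_n -> T -> R) (eta : T -> R).
Variables (mu w dl Rm LN : R).
Hypothesis c_cts : forall i, continuous (c i).
Hypothesis r_cts : forall i, continuous (r i).
Hypothesis N_cts : forall i, continuous (fun q : R * T => N i q.1 q.2).
Hypothesis lam_cts : forall i, continuous (lam i).
Hypothesis eta_cts : continuous eta.
Hypothesis dl_gt0 : 0 < dl.
Hypothesis dl_w : dl ^+ 2 = w.
Hypothesis N_dot : forall i q m,
  0 <= dotp (Nt (r^~ q) (fun i s => N i s q) w i (m%:R * eta q))
    (Nt (r^~ q) (fun i s => N i s q) w i (m%:R * eta q + eta q)).

Lemma cts_base i (s : T -> R) : continuous s ->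
  continuous (fun q => base (r^~ q) w i (s q)).
Proof. by move=> cs; rewrite /base; cts. Qed.

Lemma cts_late i (s : T -> R) : continuous s ->
  continuous (fun q => late (r^~ q) w i (s q)).
Proof. by move=> cs; rewrite /late /age; cts. Qed.

Lemma cts_Rad i (s : T -> R) : continuous s ->
  continuous (fun q => Rad (r^~ q) w (lam^~ q) i (s q)).
Proof. by move=> cs; rewrite /Rad; cts; [exact: cts_base|exact: lam_cts|exact: cts_late]. Qed.

Lemma cts_Nt i (s : T -> R) : continuous s ->
  continuous (fun q => Nt (r^~ q) (fun i s => N i s q) w i (s q)).
Proof.
move=> cs; have h : continuous (fun q => (clamp (age (r^~ q) w i (s q)), q)).
  by apply: cts_pair; [rewrite /age; cts|exact: cts_id].
exact: (@cts_comp T (R * T)%type _ (fun q : R * T => N i q.1 q.2) _ (@N_cts i) h).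
Qed.

Lemma cts_Phi i (s : T -> R) : continuous s ->
  continuous (fun q => Phi (r^~ q) w dl LN (lam^~ q) i (s q)).
Proof. by move=> cs; rewrite /Phi /age; cts; [exact: cts_base|exact: lam_cts|exact: cts_late|exact: r_cts]. Qed.

(** A step is an explicit expression in the preceding positions; [N_dot] keeps the denominator in
    [tilt] away from 0. *)
Lemma cts_pos m i : continuous (fun q => pos (c^~ q) (r^~ q)
  (fun i s => N i s q) mu w dl Rm LN (eta q) (lam^~ q) m i).
Proof.
elim: m i => [|m IH] i /=; first exact: c_cts.
pose x q := pos (c^~ q) (r^~ q) (fun i s => N i s q) mu w dl Rm LN (eta q)
  (lam^~ q) m.
have cx j : continuous (fun q => x q j) by exact: IH.
have ct : continuous (fun q => m%:R * eta q) by cts.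
have ct' : continuous (fun q => m%:R * eta q + eta q) by cts.
have cfree j : continuous (fun q => free (r^~ q) w j (m%:R * eta q)).
  by rewrite /free /age; cts.
apply: ctsvD => //; apply: ctsvZ => //; apply: cts_row => a.
under eq_fun do rewrite mxE; apply: cts_regularise => [j k||j].
- by apply: cts_gap; rewrite /rho; cts.
- by rewrite /LL /var; cts; apply: cts_sum => k; apply: ctsB; exact: cts_Phi.
rewrite /V; under eq_fun do rewrite summxE; apply: cts_sum => k.
under eq_fun do rewrite mxE; apply: ctsM.
  rewrite /cut; cts; apply: cts_tube => //; [exact: cts_Rad|exact: cts_Nt].
apply: cts_coord; rewrite /A; apply: cts_tilt.
- apply: ctsM; first exact: cts_Rad.
  apply: ctsV; first exact: cts_Rad.
  by move=> q; rewrite gt_eqF// (Rad_gt0 _ _ dl_gt0 dl_w).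
- exact: cts_Nt.
- exact: cts_Nt.
- exact: ctsvB.
- by move=> q; rewrite gt_eqF//; have := N_dot k q m; lra.
Qed.

End dragging_continuity.

(** * Lipschitz approximation of paths of normals *)

Section piecewise_linear_path.
Context {R : realType}.

Definition hat (x : R) : R := Num.max 0 (1 - `|x|).

Lemma hat_ge0 x : 0 <= hat x. Proof. by rewrite le_max lexx. Qed.

Lemma hat_far x : 1 <= `|x| -> hat x = 0.
Proof. by move=> h; apply: max_l; lra. Qed.

Lemma hat_near x : `|x| <= 1 -> hat x = 1 - `|x|.
Proof. by move=> h; apply: max_r; lra. Qed.

Lemma hat_lip x y : `|hat x - hat y| <= `|x - y|.
Proof.
have xy := lerB_dist x y; have yx := lerB_dist y x; rewrite distrC in yx.
rewrite /hat; case: (leP 0 (1 - `|x|)) => hx; case: (leP 0 (1 - `|y|)) => hy;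
  rewrite ler_norml; apply/andP; split; lra.
Qed.

Lemma hat_sum (S : nat) x : 0 <= x <= S%:R -> \sum_(k < S.+1) hat (x - k%:R) = 1.
Proof.
elim: S => [|S IH] /andP[x0 xS].
  have -> : x = 0 by apply/eqP; rewrite eq_le x0 xS.
  by rewrite big_ord_recr big_ord0 /= add0r subrr hat_near normr0 ?subr0.
rewrite big_ord_recr /=; have [xS'|xS'] := leP x S%:R.
  rewrite IH ?x0//= hat_far ?addr0// ler0_norm -natr1; lra.
rewrite big_ord_recr /= big1 ?add0r.
  have h1 : `|x - S%:R| = x - S%:R by rewrite ger0_norm; lra.
  have h2 : `|x - S.+1%:R| = S.+1%:R - x by rewrite distrC ger0_norm; lra.
  rewrite !hat_near ?h1 ?h2 -?natr1; [lra| |].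
    by move: xS'; lra.
  by move: xS; rewrite -natr1; lra.
move=> k _; apply: hat_far.
have : (k.+1)%:R <= S%:R :> R by rewrite ler_nat.
by rewrite -natr1 => kS; rewrite ger0_norm; lra.
Qed.

Lemma normalise_lip (m : nat) (a b : 'rV[R]_m) : 2^-1 <= nrm a -> 2^-1 <= nrm b ->
  nrm ((nrm a)^-1 *: a - (nrm b)^-1 *: b) <= 4 * nrm (a - b).
Proof.
move=> a2 b2; have a0 : 0 < nrm a by lra. have b0 : 0 < nrm b by lra.
have -> : (nrm a)^-1 *: a - (nrm b)^-1 *: b =
  (nrm a)^-1 *: (a - b) + ((nrm b - nrm a) / (nrm a * nrm b)) *: b.
  by apply/rowP => i; rewrite !mxE; field; rewrite !gt_eqF.
apply: le_trans (nrmD _ _) _; rewrite !nrmZ.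
rewrite normrM (ger0_norm (_ : 0 <= (nrm a)^-1)) ?invr_ge0 ?(ltW a0)//.
rewrite (ger0_norm (_ : 0 <= (nrm a * nrm b)^-1)) ?invr_ge0 ?mulr_ge0 ?nrm_ge0//.
rewrite distrC; have l := nrm_lip a b.
have i2 : (nrm a)^-1 <= 2 by rewrite -[leRHS]invrK lef_pV2 ?posrE ?invr_gt0.
have h1 : (nrm a)^-1 * nrm (a - b) <= 2 * nrm (a - b).
  by rewrite ler_wpM2r ?nrm_ge0.
have -> : `|nrm a - nrm b| / (nrm a * nrm b) * nrm b = (nrm a)^-1 * `|nrm a - nrm b|.
  by field; rewrite !gt_eqF.
have h2 : (nrm a)^-1 * `|nrm a - nrm b| <= 2 * nrm (a - b).
  by apply: ler_pM => //; rewrite invr_ge0 nrm_ge0.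
by lra.
Qed.

Lemma normalise_unit (m : nat) (a : 'rV[R]_m) : 0 < nrm a ->
  dotp ((nrm a)^-1 *: a) ((nrm a)^-1 *: a) = 1.
Proof.
by move=> a0; rewrite dotpZl dotpZr -nrm_sqr; field; rewrite gt_eqF.
Qed.

Lemma square_compact : compact (`[0, 1]%classic `*` `[0, 1]%classic : set (R * R)).
Proof. by apply: compact_setX; exact: segment_compact. Qed.

(** [F] is merely continuous in [s], while [Phi] needs normals that are uniformly Lipschitz. The
    path is replaced by a polygon with vertices so dense that it stays within 1/2 of the
    sphere-valued path, hence away from 0, and then normalised. This respects the ends, constant
    paths at [ex], and paths of horizontal vectors. *)
Lemma lipschitz_path (F : R -> R * R -> 'rV[R]_3) :
  continuous (fun q : R * (R * R) => F q.1 q.2) ->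
  (forall s p, dotp (F s p) (F s p) = 1) ->
  (forall s p, F s (clamp2 p) = F s p) -> (forall p, F 1 p = ex) ->
  exists N : R -> R * R -> 'rV[R]_3, exists LN : R,
  [/\ 0 <= LN, continuous (fun q : R * (R * R) => N q.1 q.2),
      forall s p, dotp (N s p) (N s p) = 1,
      forall p s s', s <= s' -> nrm (N s' p - N s p) <= LN * (s' - s) &
  [/\ forall p, N 0 p = F 0 p, forall p, N 1 p = ex,
      forall p, (forall s, F s p = ex) -> forall s, N s p = ex &
      forall p, (forall s, F s p 0 2 = 0) -> forall s, N s p 0 2 = 0]].
Proof.
move=> cF F1 Fc Fe.
have nF s p : nrm (F s p) = 1 by rewrite /nrm F1 sqrtr1.
have cFc (T : topologicalType) (u : T -> R) (v : T -> R * R) :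
    continuous u -> continuous v -> continuous (fun t => F (u t) (v t)).
  move=> cu cv.
  exact: (@cts_comp _ _ _ (fun q : R * (R * R) => F q.1 q.2) _ cF (cts_pair cu cv)).
have c21 : continuous (fun q : R * (R * (R * R)) => q.2.1).
  exact: (@cts_comp _ _ _ (fun q : R * (R * R) => q.1) _ (@cts_fst _ _) (@cts_snd _ _)).
have c22 : continuous (fun q : R * (R * (R * R)) => q.2.2).
  exact: (@cts_comp _ _ _ (fun q : R * (R * R) => q.2) _ (@cts_snd _ _) (@cts_snd _ _)).
have c1 : continuous (fun q : R * (R * (R * R)) => q.1) by exact: cts_fst.
(* The minimum [e] of [f] on the compact set is a modulus of continuity: if [|s - s'| < e], the
   second term of [f] is positive, so the two values differ by less than 1/2. *)
pose f (q : R * (R * (R * R))) : R := `|q.1 - q.2.1| +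
  Num.max 0 (2^-1 - nrm (F q.1 q.2.2 - F q.2.1 q.2.2)).
have cf : continuous f.
  by rewrite /f; cts; exact: cFc.
pose I : set R := `[0, 1]%classic.
pose B : set (R * (R * (R * R))) := I `*` (I `*` (I `*` I)).
have cB : compact B.
  by do 2![apply: compact_setX; first exact: segment_compact]; exact: square_compact.
have f_gt0 q : B q -> 0 < f q.
  move=> _; rewrite /f; have [->|h] := eqVneq q.1 q.2.1.
    by rewrite !subrr nrm0 normr0 add0r lt_max; apply/orP; right; lra.
  by rewrite ltr_pwDl ?normr_gt0 ?subr_eq0// le_max lexx.
have [e e0 he] := compact_positive_min cB cf f_gt0.
have close s s' p : 0 <= s <= 1 -> 0 <= s' <= 1 -> `|s - s'| < e ->
    nrm (F s p - F s' p) <= 2^-1.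
  move=> s01 s01' ss; rewrite -(Fc s) -(Fc s').
  have Bq : B (s, (s', clamp2 p)).
    by split; [|split; [|exact: clamp2_itv]]; rewrite /I /= in_itv.
  have := he _ Bq; rewrite /f /=; rewrite leNgt => /negP h.
  rewrite leNgt; apply/negP => lt; apply: h.
  by rewrite max_l ?addr0//; lra.
pose S := (Num.bound e^-1).+1.
have S0 : 0 < S%:R :> R by rewrite ltr0n.
have Se : S%:R^-1 < e.
  rewrite -[ltRHS]invrK ltf_pV2 ?posrE ?invr_gt0//.
  have := @archi_boundP R e^-1; rewrite invr_ge0 (ltW e0) => /(_ isT) h.
  by rewrite (lt_trans h)// ltr_nat.
pose poly s p := \sum_(k < S.+1) hat (S%:R * s - k%:R) *: F (k%:R / S%:R) p.
have poly_close s p : 0 <= s <= 1 -> nrm (poly s p - F s p) <= 2^-1.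
  move=> s01; have Ss : 0 <= S%:R * s <= S%:R.
    by case/andP: s01 => s0 s1; rewrite mulr_ge0 ?(ltW S0)//= ler_piMr ?(ltW S0).
  rewrite -[F s p]scale1r -(hat_sum Ss) scaler_suml -sumrB.
  apply: le_trans (nrm_sum _) _.
  apply: (@le_trans _ _ (\sum_(k < S.+1) hat (S%:R * s - k%:R) * 2^-1)); last first.
    by rewrite -mulr_suml hat_sum ?mul1r.
  apply: ler_sum => k _; rewrite -scalerBr nrmZ ger0_norm ?hat_ge0//.
  have [h|h] := leP 1 `|S%:R * s - k%:R|; first by rewrite hat_far// !mul0r.
  rewrite ler_wpM2l ?hat_ge0//; apply: close => //.
    rewrite divr_ge0 ?ler0n//= ler_pdivrMr// mul1r ler_nat -ltnS; exact: ltn_ord.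
  apply: lt_trans Se.
  have -> : k%:R / S%:R - s = - ((S%:R * s - k%:R) / S%:R) by field; rewrite gt_eqF.
  rewrite normrN normrM (@ger0_norm _ (_^-1)) ?invr_ge0 ?(ltW S0)//.
  by rewrite ltr_pdivrMr// mulVf ?gt_eqF.
have poly_ge s p : 0 <= s <= 1 -> 2^-1 <= nrm (poly s p).
  move=> /(poly_close s p); have := nrm_triangle (poly s p) (F s p) 0.
  by rewrite !subr0 nF nrm_distC; lra.
have poly_ex s p : 0 <= s <= 1 -> (forall k : nat, (k <= S)%N ->
    hat (S%:R * s - k%:R) = 0 \/ F (k%:R / S%:R) p = F s p) -> poly s p = F s p.
  move=> s01 h; have Ss : 0 <= S%:R * s <= S%:R.
    by case/andP: s01 => s0 s1; rewrite mulr_ge0 ?(ltW S0)//= ler_piMr ?(ltW S0).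
  rewrite -[RHS]scale1r -(hat_sum Ss) scaler_suml; apply: eq_bigr => k _.
  have kS : (k <= S)%N by rewrite -ltnS ltn_ord.
  by have [->|->//] := h k kS; rewrite !scale0r.
have norm_id s p : poly s p = F s p -> (nrm (poly s p))^-1 *: poly s p = F s p.
  by move=> ->; rewrite nF invr1 scale1r.
have cl (s : R) : 0 <= clamp s <= 1 by rewrite clamp_ge0 clamp_le1.
have cl0 : clamp 0 = 0 :> R by rewrite clampE// lexx ler01.
have cl1 : clamp 1 = 1 :> R by rewrite clampE// lexx ler01.
exists (fun s p => (nrm (poly (clamp s) p))^-1 *: poly (clamp s) p).
exists (4 * (S.+1%:R * S%:R)); split; last split.
- by rewrite !mulr_ge0 ?ler0n.
- have cp : continuous (fun q : R * (R * R) => poly (clamp q.1) q.2).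
    apply: ctsv_sum => k; apply: ctsvZ.
      rewrite /hat; cts; exact: cts_fst.
    by apply: cFc; [exact: cts_cst|exact: cts_snd].
  apply: ctsvZ => //; apply: ctsV; first by cts.
  by move=> q; rewrite gt_eqF//; have := poly_ge _ q.2 (cl q.1); lra.
- move=> s p; apply: normalise_unit.
  by have := poly_ge _ p (cl s); lra.
- move=> p s s' ss; apply: le_trans (normalise_lip (poly_ge _ p (cl s')) (poly_ge _ p (cl s))) _.
  rewrite -mulrA ler_wpM2l// /poly -sumrB.
  apply: le_trans (nrm_sum _) _.
  apply: (@le_trans _ _ (\sum_(k < S.+1) S%:R * (s' - s))); last first.
    by rewrite sumr_const card_ord -[leLHS]mulr_natl mulrA.
  apply: ler_sum => k _; rewrite -scalerBl nrmZ nF mulr1.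
  apply: le_trans (hat_lip _ _) _; rewrite opprB addrA subrK -mulrBr normrM.
  rewrite (ger0_norm (ltW S0)) ler_wpM2l ?(ltW S0)//.
  rewrite ger0_norm ?subr_ge0 ?clamp_homo//.
  exact: clamp_lip.
- move=> p; rewrite cl0 norm_id// poly_ex ?lexx ?ler01// => -[|k] _.
    by right; rewrite mul0r.
  by left; rewrite mulr0 sub0r hat_far// normrN ger0_norm ?ler1n.
- move=> p; rewrite cl1 norm_id ?Fe// poly_ex ?lexx ?ler01// => k.
  rewrite leq_eqVlt => /orP[/eqP ->|kS]; first by right; rewrite divff// gt_eqF.
  left; rewrite mulr1 hat_far// ger0_norm.
    by rewrite lerBrDr nat1r ler_nat.
  by rewrite subr_ge0 ler_nat ltnW.
- move=> p h s; rewrite norm_id ?h// poly_ex// => k _; right; rewrite !h//.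
- move=> p h s; rewrite mxE /poly summxE [X in _ * X]big1 ?mulr0// => k _.
  by rewrite mxE h mulr0.
Qed.

End piecewise_linear_path.

(** * A uniform distance between slices *)

Section margin.
Context {R : realType} {n : nat}.

Lemma finite_positive_min (I : finType) (f : I -> R) :
  (forall i, 0 < f i) -> exists2 e : R, 0 < e & forall i, e <= f i.
Proof.
move=> f0; exists (\big[Num.min/1]_i f i); last by move=> j; exact: (bigmin_le 1 j f).
by elim/big_ind : _ => // x y x0 y0; rewrite lt_min x0.
Qed.

(** Unit directions parametrise a circle by a compact set even when its radius is 0, as happens for
    the last slice. *)
Lemma circle_direction c (r : R) N y : 0 <= r -> dotp N N = 1 -> circle c r N y ->
  exists u, [/\ dotp u u = 1, dotp N u = 0 & y = c + r *: u].
Proof.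
move=> r0 N1 [yr yN]; have [rz|rz] := eqVneq r 0.
  have [u u1 Nu] := exists_orthogonal N; exists u; split=> //.
  rewrite rz scale0r addr0; apply/eqP; rewrite -subr_eq0; apply/eqP.
  by apply: nrm_eq0; rewrite /nrm -/(sqdist y c) yr rz expr0n sqrtr0.
exists (r^-1 *: (y - c)); split.
- by rewrite dotpZl dotpZr -/(sqdist y c) yr; field.
- by rewrite dotpZr yN mulr0.
- by rewrite scalerA divff// scale1r addrC subrK.
Qed.

Lemma unit_cube (u : 'rV[R]_3) i : dotp u u = 1 -> -1 <= u 0 i <= 1.
Proof.
move=> u1; rewrite -ler_norml; apply: le_trans (coord_le_nrm u i) _.
by rewrite /nrm u1 sqrtr1.
Qed.

Variables (c N : 'I_n -> R * R -> 'rV[R]_3) (r : 'I_n -> R * R -> R).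
Hypothesis c_cts : forall i, continuous (c i).
Hypothesis r_cts : forall i, continuous (r i).
Hypothesis N_cts : forall i, continuous (N i).
Hypothesis c_clamp : forall i p, c i (clamp2 p) = c i p.
Hypothesis r_clamp : forall i p, r i (clamp2 p) = r i p.
Hypothesis N_clamp : forall i p, N i (clamp2 p) = N i p.
Hypothesis N_unit : forall i p, dotp (N i p) (N i p) = 1.

Lemma slices_margin :
  (forall p i j h y, i != j -> 0 <= h -> h <= r i p ^+ 2 -> h <= r j p ^+ 2 ->
    circle (c i p) (Num.sqrt (r i p ^+ 2 - h)) (N i p) y ->
    circle (c j p) (Num.sqrt (r j p ^+ 2 - h)) (N j p) y -> False) ->
  exists2 mu : R, 0 < mu &
    forall p i j h y z, i != j -> 0 <= h -> h <= r i p ^+ 2 -> h <= r j p ^+ 2 ->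
    circle (c i p) (Num.sqrt (r i p ^+ 2 - h)) (N i p) y ->
    circle (c j p) (Num.sqrt (r j p ^+ 2 - h)) (N j p) z -> mu <= nrm (y - z).
Proof.
move=> sd.
suff H (ij : 'I_n * 'I_n) : exists m : R, 0 < m /\
    forall p h y z, ij.1 != ij.2 -> 0 <= h -> h <= r ij.1 p ^+ 2 -> h <= r ij.2 p ^+ 2 ->
    circle (c ij.1 p) (Num.sqrt (r ij.1 p ^+ 2 - h)) (N ij.1 p) y ->
    circle (c ij.2 p) (Num.sqrt (r ij.2 p ^+ 2 - h)) (N ij.2 p) z -> m <= nrm (y - z).
  have [m hm] := fin_all_exists H.
  have [e e0 he] := finite_positive_min (fun ij => (hm ij).1).
  exists e => // p i j h y z ij h0 hi hj cy cz.
  by apply: le_trans (he (i, j)) _; exact: (hm (i, j)).2 p h y z ij h0 hi hj cy cz.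
case: ij => i j /=; have [->|ij] := eqVneq i j.
  by exists 1; split=> // p h y z; rewrite eqxx.
pose T := (R * R * (R * ('rV[R]_3 * 'rV[R]_3)))%type.
(* All seven terms are nonnegative; they vanish together exactly when the slices at [h], in the
   directions [u] and [v], have a common point. *)
pose f (q : T) : R := nrm (c i q.1 + Num.sqrt (r i q.1 ^+ 2 - q.2.1) *: q.2.2.1
     - (c j q.1 + Num.sqrt (r j q.1 ^+ 2 - q.2.1) *: q.2.2.2))
  + (`|dotp q.2.2.1 q.2.2.1 - 1| + `|dotp q.2.2.2 q.2.2.2 - 1|
  + (`|dotp (N i q.1) q.2.2.1| + `|dotp (N j q.1) q.2.2.2|
  + (Num.max 0 (q.2.1 - r i q.1 ^+ 2) + Num.max 0 (q.2.1 - r j q.1 ^+ 2)))).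
have c1 : continuous (fun q : T => q.1) by exact: cts_fst.
have c2 : continuous (fun q : T => q.2) by exact: cts_snd.
have ch : continuous (fun q : T => q.2.1).
  exact: (@cts_comp _ _ _ fst _ (@cts_fst _ _) c2).
have c22 : continuous (fun q : T => q.2.2).
  exact: (@cts_comp _ _ _ snd _ (@cts_snd _ _) c2).
have cu : continuous (fun q : T => q.2.2.1).
  exact: (@cts_comp _ _ _ fst _ (@cts_fst _ _) c22).
have cv : continuous (fun q : T => q.2.2.2).
  exact: (@cts_comp _ _ _ snd _ (@cts_snd _ _) c22).
have cc k : continuous (fun q : T => c k q.1) by exact: (@cts_comp _ _ _ (c k) _ (@c_cts k) c1).
have cr k : continuous (fun q : T => r k q.1) by exact: (@cts_comp _ _ _ (r k) _ (@r_cts k) c1).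
have cN k : continuous (fun q : T => N k q.1) by exact: (@cts_comp _ _ _ (N k) _ (@N_cts k) c1).
have cf : continuous f.
  by rewrite /f; cts; first [exact: cc|exact: cr|exact: cN].
have [b hb] := compact_upper_bound (@square_compact R) (cts_exp (k := 2) (@r_cts i)).
pose cube : set 'rV[R]_3 := [set v | forall a, `[(-1), 1]%classic (v ord0 a)].
have ccube : compact cube.
  by apply: (@rV_compact R 3 (fun=> `[(-1), 1]%classic)) => _; exact: segment_compact.
pose I01 : set R := `[0, 1]%classic.
pose B : set T := (I01 `*` I01) `*` (`[0, b]%classic `*` (cube `*` cube)).
have cB : compact B.
  apply: compact_setX; first exact: square_compact.
  apply: compact_setX; first exact: segment_compact.
  exact: compact_setX.
have pos4 (a1 a2 a3 a4 a5 a6 a7 : R) : 0 <= a1 -> 0 <= a2 -> 0 <= a3 -> 0 <= a4 ->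
    0 <= a5 -> 0 <= a6 -> 0 <= a7 -> a1 + (a2 + a3 + (a4 + a5 + (a6 + a7))) <= 0 ->
    [/\ a1 = 0, a2 = 0 & a3 = 0] /\ [/\ a4 = 0, a5 = 0, a6 = 0 & a7 = 0].
  by move=> *; split; split; lra.
have f_gt0 q : B q -> 0 < f q.
  case: q => p [h [u v]] [_ [/= hh _]]; rewrite in_itv /= in hh.
  have [h0 _] := andP hh.
  rewrite ltNge; apply/negP; rewrite /f /= => H.
  have m0 x : 0 <= Num.max 0 x :> R by rewrite le_max lexx.
  have [[yz u1 v1] [Nu Nv hi hj]] := pos4 _ _ _ _ _ _ _ (nrm_ge0 _) (normr_ge0 _)
    (normr_ge0 _) (normr_ge0 _) (normr_ge0 _) (m0 _) (m0 _) H.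
  have {}u1 : dotp u u = 1 by apply/eqP; rewrite -subr_eq0 -normr_eq0 u1.
  have {}v1 : dotp v v = 1 by apply/eqP; rewrite -subr_eq0 -normr_eq0 v1.
  have {}Nu : dotp (N i p) u = 0 by apply/eqP; rewrite -normr_eq0 Nu.
  have {}Nv : dotp (N j p) v = 0 by apply/eqP; rewrite -normr_eq0 Nv.
  have {}hi : h <= r i p ^+ 2.
    by rewrite -subr_le0 -hi le_max lexx orbT.
  have {}hj : h <= r j p ^+ 2.
    by rewrite -subr_le0 -hj le_max lexx orbT.
  move/nrm_eq0/eqP: yz; rewrite subr_eq0 => /eqP yz.
  have on k w : h <= r k p ^+ 2 -> dotp w w = 1 -> dotp (N k p) w = 0 ->
      circle (c k p) (Num.sqrt (r k p ^+ 2 - h)) (N k p)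
        (c k p + Num.sqrt (r k p ^+ 2 - h) *: w).
    move=> hk w1 Nw; rewrite /circle /= /sqdist (addrC (c k p)) addrK.
    by rewrite dotpZl !dotpZr w1 Nw mulr0 mulr1 expr2.
  have := on i u hi u1 Nu; rewrite yz => cy.
  exact: (sd p i j h _ ij h0 hi hj cy (on j v hj v1 Nv)).
have [m m0 hm] := compact_positive_min cB cf f_gt0.
exists m; split=> // p h y z _ h0 hi hj cy cz.
have [u [u1 Nu yE]] := circle_direction (sqrtr_ge0 _) (N_unit i p) cy.
have [v [v1 Nv zE]] := circle_direction (sqrtr_ge0 _) (N_unit j p) cz.
have Bq : B (clamp2 p, (h, (u, v))).
  split; first exact: clamp2_itv.
  split; first by rewrite /= in_itv /= h0 (le_trans hi)// -r_clamp hb//; exact: clamp2_itv.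
  by split=> a; rewrite /= in_itv; exact: unit_cube.
have := hm _ Bq; rewrite /f /= !c_clamp !r_clamp !N_clamp -yE -zE u1 v1 Nu Nv.
rewrite !subrr !normr0 !max_l ?subr_le0//.
by rewrite !addr0.
Qed.

End margin.

(** * Choice of the final radii and of the time step *)

Section schedule.
Context {R : realType} {n : nat}.
Variables (mu dl Rm LN : R).
Hypothesis n_gt0 : (0 < n)%N.
Hypothesis mu_gt0 : 0 < mu.
Hypothesis dl_gt0 : 0 < dl.
Hypothesis dl_mu : 100 * n%:R * dl <= mu.
Hypothesis dl_Rm : dl <= Rm.
Hypothesis LN_ge0 : 0 <= LN.

Let w : R := dl ^+ 2.
Let C : R := C1 mu Rm.

(** Lowering the squared radius by [2 * w] multiplies [depth] by [24 * C * n]. *)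
Definition rate : R := ln (24 * C * n%:R) / (2 * w).
(** Twice the loss in the exponent of [Q] caused by regular shrinking and turning, which add at most
    [Rm / dl + 2 * LN] to each of the [n] clocks. *)
Definition floor_lam : R := 24 * C * n%:R * (Rm / dl + 2 * LN).

(* A ring which dies later must remain much larger than the ones which died
   before, by a margin covering the losses due to its own shrinking. *)
Definition depth (s : R) : R := floor_lam * expR (rate * (Rm ^+ 2 - s ^+ 2)).
(** The last factor bounds the growth of a clock [Phi] per unit of [eta / w]; the first one makes
    [eta * load <= w] sufficient for [var_small]. *)
Definition load : R := 24 * C * n%:R * (1 + floor_lam * expR (rate * Rm ^+ 2) + 2 * LN).

Let n_ge1 : 1 <= n%:R :> R. Proof. by rewrite ler1n. Qed.
Let w_gt0 : 0 < w. Proof. exact: exprn_gt0. Qed.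
Let Rm_gt0 : 0 < Rm. Proof. exact: lt_le_trans dl_Rm. Qed.
Let C_ge1 : 1 <= C.
Proof.
by rewrite /C /C1 lerDl divr_ge0 ?(ltW mu_gt0)// mulr_ge0// addr_ge0 ?ltW.
Qed.
Let Cn_ge1 : 1 <= C * n%:R.
Proof. by rewrite -[leLHS]mul1r ler_pM. Qed.

Lemma rate_ge0 : 0 <= rate.
Proof.
apply: divr_ge0; last by rewrite mulr_ge0// ltW.
by apply: ln_ge0; rewrite -mulrA; have := Cn_ge1; lra.
Qed.

Lemma floor_lam_ge0 : 0 <= floor_lam.
Proof.
apply: mulr_ge0; first by rewrite -mulrA; have := Cn_ge1; lra.
by apply: addr_ge0; [rewrite divr_ge0// ltW|rewrite mulr_ge0].
Qed.

Lemma depth_ge0 s : 0 <= depth s.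
Proof. by rewrite mulr_ge0 ?floor_lam_ge0 ?expR_ge0. Qed.

Lemma depth_ge s : 0 < s -> s <= Rm -> floor_lam <= depth s.
Proof.
move=> s0 sR; rewrite -[leLHS]mulr1 ler_wpM2l ?floor_lam_ge0// -[leLHS]expR0 ler_expR.
by rewrite mulr_ge0 ?rate_ge0// subr_ge0; nra.
Qed.

Lemma depth_le s : depth s <= floor_lam * expR (rate * Rm ^+ 2).
Proof.
rewrite ler_wpM2l ?floor_lam_ge0// ler_expR ler_wpM2l ?rate_ge0//.
by rewrite gerBl sqr_ge0.
Qed.

Lemma depth_later s s' : s ^+ 2 + 2 * w <= s' ^+ 2 ->
  24 * C * n%:R * depth s' <= depth s.
Proof.
move=> ss; have K0 : 0 < 24 * C * n%:R by rewrite -mulrA mulr_gt0//; have := Cn_ge1; lra.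
rewrite /depth mulrCA ler_wpM2l ?floor_lam_ge0//.
have {1}-> : 24 * C * n%:R = expR (rate * (2 * w)).
  by rewrite /rate divfK ?lnK ?posrE// mulf_neq0// gt_eqF.
rewrite -expRD ler_expR -mulrDr ler_wpM2l ?rate_ge0//; lra.
Qed.

Lemma load_ge : 1 <= load.
Proof.
rewrite /load -[leLHS]mulr1; apply: ler_pM => //.
  by rewrite -mulrA; have := Cn_ge1; lra.
rewrite -addrA lerDl; apply: addr_ge0; rewrite mulr_ge0 ?expR_ge0//.
exact: floor_lam_ge0.
Qed.

Variable r : 'I_n -> R.
Hypothesis r_gt0 : forall i, 0 < r i.
Hypothesis r_Rm : forall i, r i <= Rm.
Let lam i := depth (r i).

Lemma base_lip i t eta : 0 <= eta -> base r w i t - base r w i (t + eta) <= eta / dl.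
Proof.
move=> e0; have dw : dl ^+ 2 = w by [].
have b1 := base_ge r dl_gt0 dw i t; have b2 := base_ge r dl_gt0 dw i (t + eta).
have b3 : base r w i (t + eta) <= base r w i t by apply: (base_anti r dl_gt0 dw); rewrite lerDl.
have s1 : base r w i t ^+ 2 = Num.max (r i ^+ 2 - t) w.
  by rewrite sqr_sqrtr// le_max (ltW w_gt0) orbT.
have s2 : base r w i (t + eta) ^+ 2 = Num.max (r i ^+ 2 - (t + eta)) w.
  by rewrite sqr_sqrtr// le_max (ltW w_gt0) orbT.
rewrite ler_pdivlMr//.
have h : base r w i t ^+ 2 - base r w i (t + eta) ^+ 2 <= eta.
  rewrite s1 s2; case: (leP (r i ^+ 2 - t) w) => h1; case: (leP (r i ^+ 2 - (t + eta)) w) => h2; lra.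
move: h; rewrite subr_sqr; set x := _ - _; set y := _ + _ => h.
apply: le_trans h; rewrite ler_wpM2l ?subr_ge0// /y; have := dl_gt0; lra.
Qed.

Lemma var_small_schedule eta t : 0 <= eta -> eta * load <= w ->
  var r w dl LN eta lam t <= (24 * C)^-1.
Proof.
move=> e0 ew; set K := 1 + floor_lam * expR (rate * Rm ^+ 2) + 2 * LN.
have C0 : 0 < C by have := C_ge1; lra.
have wn : w != 0 by rewrite gt_eqF.
apply: (@le_trans _ _ (\sum_(k < n) K * (eta / w))).
  apply: ler_sum => k _; rewrite /Phi.
  have h1 : (base r w k t - base r w k (t + eta)) / dl <= eta / w.
    have -> : eta / w = eta / dl / dl by rewrite /w; field; rewrite gt_eqF.
    by rewrite ler_wpM2r ?invr_ge0 ?(ltW dl_gt0)// base_lip.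
  have aa : age r w k (t + eta) - age r w k t = eta / w by rewrite /age; field.
  have age_le : age r w k t <= age r w k (t + eta).
    by rewrite -subr_ge0 aa divr_ge0// ltW.
  have h2 : late r w k (t + eta) - late r w k t <= eta / w.
    rewrite -aa /late; apply: le_trans (clamp_lip _) _; lra.
  have h3 : clamp (age r w k (t + eta)) - clamp (age r w k t) <= eta / w.
    by rewrite -aa clamp_lip.
  have ew0 : 0 <= eta / w by rewrite divr_ge0// ltW.
  have h4 := ler_wpM2l (depth_ge0 (r k)) h2.
  have h5 := ler_wpM2r ew0 (depth_le (r k)).
  have h6 := ler_wpM2l LN_ge0 h3.
  by rewrite -/(lam k) in h4 h5; rewrite /K; lra.
rewrite sumr_const card_ord -[leLHS]mulr_natl mulrA.
rewrite (_ : _ * (eta / w) = (eta * load / w) / (24 * C)); last first.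
  by rewrite /load -/K; field; rewrite wn gt_eqF.
rewrite ler_pdivrMr ?mulr_gt0// mulVf ?gt_eqF ?mulr_gt0//.
by rewrite ler_pdivrMr// mul1r.
Qed.

(** Half of [lam i] pays for regular shrinking and turning, being at least [floor_lam / 2]; the
    other half pays for the final shrinking of the other rings. The factor between radii and
    distances is covered by [100 * n * dl <= mu]. *)
Lemma Q_rho_schedule i t : r i ^+ 2 + 4 * w <= t ->
  6 * n%:R * rho dl lam i <= Q r mu w dl Rm LN lam i t.
Proof.
move=> ht; set t1 := r i ^+ 2 + 4 * w in ht.
have C0 : 0 < C by have := C_ge1; lra.
have dw : dl ^+ 2 = w by [].
have t10 : 0 <= t1 by rewrite addr_ge0 ?sqr_ge0// mulr_ge0// ltW.
have li0 := depth_ge0 (r i); rewrite -/(lam i) in li0.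
pose K := 24 * C * n%:R.
have K0 : 0 < K by rewrite /K -mulrA mulr_gt0//; have := Cn_ge1; lra.
have each k : Phi r w dl LN lam k t - Phi r w dl LN lam k t1 <=
    (Rm / dl + 2 * LN) + lam i / K.
  have bt : 0 <= base r w k t / dl by rewrite divr_ge0 ?sqrtr_ge0// ltW.
  have bt1 : base r w k t1 / dl <= Rm / dl.
    rewrite ler_wpM2r ?invr_ge0 ?(ltW dl_gt0)//.
    rewrite -[leRHS](@ger0_norm _ Rm) ?(ltW Rm_gt0)// -sqrtr_sqr.
    rewrite ler_wsqrtr// ge_max; apply/andP; split.
      by have := r_Rm k; have := r_gt0 k; nra.
    by rewrite -dw; have := dl_gt0; have := dl_Rm; nra.
  have c1 := ler_wpM2l LN_ge0 (clamp_le1 (age r w k t)).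
  have c0 := mulr_ge0 LN_ge0 (clamp_ge0 (age r w k t1)).
  suff : lam k * late r w k t - lam k * late r w k t1 <= lam i / K by rewrite /Phi; lra.
  have lk0 := depth_ge0 (r k); rewrite -/(lam k) in lk0.
  (* In the first case the ring [k] has age at least 2 at [t1], so its final shrinking is over; in
     the second [lam k] is at most [lam i / K]. *)
  rewrite -mulrBr; have [rk|rk] := leP (r k ^+ 2) (r i ^+ 2 + 2 * w).
    rewrite [late r w k t1]clamp_eq1.
      apply: (@le_trans _ _ 0); last by rewrite divr_ge0// ltW.
      by rewrite mulr_ge0_le0// subr_le0 clamp_le1.
    rewrite lerBrDr /age ler_pdivlMr; last exact: w_gt0.
    by rewrite /t1; lra.
  have := depth_later (ltW rk); rewrite -/(lam i) -/(lam k) -/K => kk.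
  rewrite ler_pdivlMr// mulrC; apply: le_trans kk; rewrite ler_wpM2l ?(ltW K0)//.
  rewrite -[leRHS]mulr1 ler_wpM2l//.
  by have := clamp_le1 (age r w k t - 1); have := clamp_ge0 (age r w k t1 - 1); rewrite /late; lra.
have S : \sum_k (Phi r w dl LN lam k t - Phi r w dl LN lam k t1) <=
    n%:R * (Rm / dl + 2 * LN) + lam i / (24 * C).
  apply: le_trans (ler_sum _ (fun k _ => each k)) _.
  rewrite sumr_const card_ord -[leLHS]mulr_natl mulrDr.
  rewrite lerD2l /K le_eqVlt; apply/orP; left; apply/eqP; field.
  by rewrite gt_eqF//= pnatr_eq0 -lt0n.
rewrite /Q -/t1 -/C.
have fl := depth_ge (r_gt0 i) (r_Rm i); rewrite -/(lam i) in fl.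
have e1 : expR (- lam i) <= expR (- (12 * C * \sum_k
    (Phi r w dl LN lam k t - Phi r w dl LN lam k t1))).
  rewrite ler_expR lerN2.
  apply: le_trans (ler_wpM2l _ S) _; first by rewrite mulr_ge0// ltW.
  rewrite mulrDr; have -> : 12 * C * (lam i / (24 * C)) = lam i / 2.
    by field; rewrite gt_eqF.
  have -> : 12 * C * (n%:R * (Rm / dl + 2 * LN)) = floor_lam / 2.
    by rewrite /floor_lam -/C; field; rewrite gt_eqF.
  by lra.
rewrite /rho mulrA; apply: ler_pM => //; rewrite ?expR_ge0//.
  by rewrite !mulr_ge0 ?ler0n// ltW.
by move: dl_mu; rewrite -!mulrA; move: (n%:R * dl) => z; have := mu_gt0; lra.
Qed.

End schedule.

(** * Untwisting a family of rings *)

Section untwist.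
Context {R : realType} {n : nat}.
Variables (c : 'I_n -> R * R -> 'rV[R]_3) (r : 'I_n -> R * R -> R).
Variable F : 'I_n -> R -> R * R -> 'rV[R]_3.
Hypothesis n_gt0 : (0 < n)%N.
Hypothesis c_cts : forall i, continuous (c i).
Hypothesis r_cts : forall i, continuous (r i).
Hypothesis F_cts : forall i, continuous (fun q : R * (R * R) => F i q.1 q.2).
Hypothesis c_clamp : forall i p, c i (clamp2 p) = c i p.
Hypothesis r_clamp : forall i p, r i (clamp2 p) = r i p.
Hypothesis F_clamp : forall i s p, F i s (clamp2 p) = F i s p.
Hypothesis r_gt0 : forall i p, 0 < r i p.
Hypothesis F_unit : forall i s p, dotp (F i s p) (F i s p) = 1.
Hypothesis F_end : forall i p, F i 1 p = ex.
Hypothesis slices : forall p i j h y, i != j -> 0 <= h ->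
  h <= r i p ^+ 2 -> h <= r j p ^+ 2 ->
  circle (c i p) (Num.sqrt (r i p ^+ 2 - h)) (F i 0 p) y ->
  circle (c j p) (Num.sqrt (r j p ^+ 2 - h)) (F j 0 p) y -> False.

Theorem untwist : exists (X : 'I_n -> R * (R * R) -> 'rV[R]_3)
    (Y : 'I_n -> R * (R * R) -> R) (Z : 'I_n -> R * (R * R) -> 'rV[R]_3),
  [/\ forall i, [/\ continuous (X i), continuous (Y i) & continuous (Z i)],
      forall i q, 0 < Y i q /\ dotp (Z i q) (Z i q) = 1,
      forall i j q, i != j ->
        circle (X i q) (Y i q) (Z i q) `&` circle (X j q) (Y j q) (Z j q) = set0,
      forall i p, [/\ X i (0, p) = c i p, Y i (0, p) = r i p & Z i (0, p) = F i 0 p] &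
  [/\ forall i p, Z i (1, p) = ex,
      forall i h p, (forall s, F i s p = ex) -> Z i (h, p) = ex &
      (forall i p, c i p 0 2 = 0) -> (forall i s p, F i s p 0 2 = 0) ->
        forall i q, X i q 0 2 = 0]].
Proof.
have /fin_all_exists[N /fin_all_exists[LNs hN]] : forall i, _ := fun i =>
  lipschitz_path (@F_cts i) (F_unit i) (F_clamp i) (F_end i).
have N_cts i : continuous (fun q : R * (R * R) => N i q.1 q.2) by case: (hN i).
have N_unit i s p : dotp (N i s p) (N i s p) = 1 by case: (hN i).
have N0 i p : N i 0 p = F i 0 p by case: (hN i) => _ _ _ _ [].
have N1 i p : N i 1 p = ex by case: (hN i) => _ _ _ _ [].
have Nex i p : (forall s, F i s p = ex) -> forall s, N i s p = ex.
  by case: (hN i) => _ _ _ _ [_ _ h _]; exact: h.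
have Nflat i p : (forall s, F i s p 0 2 = 0) -> forall s, N i s p 0 2 = 0.
  by case: (hN i) => _ _ _ _ [_ _ _ h]; exact: h.
have LNs0 i : 0 <= LNs i by case: (hN i).
pose LN := \sum_i LNs i.
have LN0 : 0 <= LN by exact: sumr_ge0.
have N_lip p i s s' : s <= s' -> nrm (N i s' p - N i s p) <= LN * (s' - s).
  move=> ss; case: (hN i) => _ _ _ h _; apply: le_trans (h p s s' ss) _.
  rewrite ler_wpM2r ?subr_ge0// /LN (bigD1 i)//= lerDl.
  exact: sumr_ge0.
have F0_cts i : continuous (F i 0).
  have c0 : continuous (fun p : R * R => (0 : R, p)).
    by apply: cts_pair; [exact: cts_cst|exact: cts_id].
  exact: (@cts_comp _ _ _ (fun q : R * (R * R) => F i q.1 q.2) _ (@F_cts i) c0).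
have [mu mu0 hmu] := slices_margin c_cts r_cts F0_cts c_clamp r_clamp
  (fun i p => F_clamp i 0 p) (fun i p => F_unit i 0 p) slices.
have /fin_all_exists[b hb] : forall i, exists b, forall p, r i p <= b.
  move=> i; have [b hb] := compact_upper_bound (@square_compact R) (@r_cts i).
  by exists b => p; rewrite -r_clamp hb//; exact: clamp2_itv.
have b_ge0 i : 0 <= b i by apply: le_trans (hb i 0); rewrite ltW.
have /fin_all_exists[e he] : forall i, exists e : R, 0 < e /\ forall p, e <= r i p.
  move=> i; have [p _|e e0 he] := compact_positive_min (@square_compact R) (@r_cts i).
    exact: r_gt0.
  by exists e; split=> // p; rewrite -r_clamp he//; exact: clamp2_itv.
have [rmin rmin0 hrmin] := finite_positive_min (fun i => (he i).1).
pose Rm := mu + \sum_i b i.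
have Rm_mu : mu <= Rm by rewrite lerDl sumr_ge0.
have r_Rm p i : r i p <= Rm.
  apply: le_trans (hb i p) _; rewrite /Rm (bigD1 i)//= addrCA lerDl.
  by rewrite addr_ge0 ?(ltW mu0)// sumr_ge0.
have n1 : 1 <= n%:R :> R by rewrite ler1n.
have n100 : 0 < 100 * n%:R :> R by rewrite mulr_gt0// ltr0n.
(* The bound by [rmin] makes every age at most -1 at time 0, so that the motion starts at the given
   radii. *)
pose dl := Num.min (mu / (100 * n%:R)) rmin.
have dl0 : 0 < dl by rewrite lt_min rmin0 divr_gt0.
have dl_mu : 100 * n%:R * dl <= mu.
  rewrite mulrC -ler_pdivlMr//; by rewrite ge_min lexx.
have dl_Rm : dl <= Rm.
  apply: le_trans Rm_mu; apply: le_trans dl_mu.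
  by rewrite -[leLHS]mul1r ler_wpM2r ?(ltW dl0)//; lra.
have dl_r i p : dl <= r i p.
  apply: le_trans ((he i).2 p); apply: le_trans (hrmin i).
  by rewrite ge_min lexx orbT.
pose w := dl ^+ 2.
have w0 : 0 < w by exact: exprn_gt0.
have dw : dl ^+ 2 = w by [].
pose lam i p := depth (n := n) mu dl Rm LN (r i p).
have lam0 p i : 0 <= lam i p by exact: depth_ge0.
pose K := load (n := n) mu dl Rm LN.
have K1 : 1 <= K by exact: load_ge.
have K0 : 0 <= K := le_trans ler01 K1.
(* At this time every age is at least 1, hence every normal is [ex]. *)
pose T0 := Rm ^+ 2 + w.
have T00 : 0 <= T0 by rewrite addr_ge0 ?sqr_ge0// ltW.
pose M := (Num.bound (T0 * K / w)).+1.
have M0 : 0 < M%:R :> R by rewrite ltr0n.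
(* [M] is taken large enough for the bound [eta h * K <= w] at all [h]; at [h = 0] nothing moves. *)
pose eta (h : R) := clamp h * (T0 / M%:R).
have eta0 h : 0 <= eta h by rewrite mulr_ge0 ?clamp_ge0// divr_ge0// ltW.
have etaK h : eta h * K <= w.
  apply: (@le_trans _ _ (T0 / M%:R * K)).
    rewrite ler_wpM2r// /eta -[leRHS]mul1r.
    by rewrite ler_wpM2r ?clamp_le1// divr_ge0// ltW.
  rewrite mulrAC ler_pdivrMr// [leRHS]mulrC -ler_pdivrMr//.
  have := @archi_boundP R (T0 * K / w).
  rewrite (divr_ge0 (mulr_ge0 T00 K0) (ltW w0)).
  by move=> /(_ isT) /ltW h1; apply: le_trans h1 _; rewrite ler_nat.
have etaw h : 0 <= eta h <= w.
  rewrite eta0/=; apply: le_trans (etaK h); rewrite -[leLHS]mulr1.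
  by rewrite ler_wpM2l.
have Meta h : M%:R * eta h = clamp h * T0.
  by rewrite /eta; field; rewrite gt_eqF.
have r0 p i : 0 < r i p by [].
have vs p h t : 0 <= t ->
    var (r^~ p) w dl LN (eta h) (lam^~ p) t <= (24 * C1 mu Rm)^-1.
  move=> _; exact: (var_small_schedule n_gt0 mu0 dl0 dl_Rm LN0 _ _ (eta0 h) (etaK h)).
have Qr p i t : r i p ^+ 2 + 4 * w <= t ->
    6 * n%:R * rho dl (lam^~ p) i <= Q (r^~ p) mu w dl Rm LN (lam^~ p) i t.
  exact: (Q_rho_schedule n_gt0 mu0 dl0 dl_mu dl_Rm LN0 (r0 p) (r_Rm p)).
have sl p i j h y z : i != j -> 0 <= h -> h <= r i p ^+ 2 -> h <= r j p ^+ 2 ->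
    circle (c i p) (Num.sqrt (r i p ^+ 2 - h)) (N i 0 p) y ->
    circle (c j p) (Num.sqrt (r j p ^+ 2 - h)) (N j 0 p) z -> mu <= nrm (y - z).
  by rewrite !N0; exact: hmu.
have Nu p i s : dotp (N i s p) (N i s p) = 1 by [].
have inv h p m := inv_pos n_gt0 mu0 dl0 dw dl_mu dl_Rm (r0 p) (r_Rm p) LN0
  (lam0 p) (etaw h) (Nu p) (N_lip p) (N1^~ p) (sl p) (vs p h) (Qr p) m.
have dis p := inv_disjoint (N := fun i s => N i s p) n_gt0 mu0 dl0 dw dl_mu
  (lam0 p) (N1^~ p) (sl p) (Qr p).
have ndot h p := Nt_dot mu0 dl0 dw dl_Rm (lam0 p) (etaw h) (Nu p) (N_lip p) (vs p h).
have me0 h m : 0 <= m%:R * eta h by rewrite mulr_ge0 ?ler0n.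
have sc : continuous (fun q : R * (R * R) => q.2) by exact: cts_snd.
have c' i : continuous (fun q : R * (R * R) => c i q.2).
  exact: (@cts_comp _ _ _ (c i) _ (@c_cts i) sc).
have r' i : continuous (fun q : R * (R * R) => r i q.2).
  exact: (@cts_comp _ _ _ (r i) _ (@r_cts i) sc).
have N' i : continuous (fun q : R * (R * (R * R)) => N i q.1 q.2.2).
  have h : continuous (fun q : R * (R * (R * R)) => (q.1, q.2.2)).
    apply: cts_pair; first exact: cts_fst.
    exact: (@cts_comp _ _ _ snd _ (@cts_snd _ _) (@cts_snd _ _)).
  exact: (@cts_comp _ _ _ (fun q : R * (R * R) => N i q.1 q.2) _ (@N_cts i) h).
have lam' i : continuous (fun q : R * (R * R) => lam i q.2).
  by rewrite /lam /depth; cts; exact: r'.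
have eta' : continuous (fun q : R * (R * R) => eta q.1).
  by rewrite /eta; cts; exact: cts_fst.
have Me' : continuous (fun q : R * (R * R) => M%:R * eta q.1) by cts.
exists (fun i q => pos (c^~ q.2) (r^~ q.2) (fun i s => N i s q.2) mu w dl Rm LN
  (eta q.1) (lam^~ q.2) M i).
exists (fun i q => Rad (r^~ q.2) w (lam^~ q.2) i (M%:R * eta q.1)).
exists (fun i q => Nt (r^~ q.2) (fun i s => N i s q.2) w i (M%:R * eta q.1)).
split; last split.
- move=> i; split.
  + exact: (cts_pos c' r' N' lam' eta' dl0 dw (fun i q m => ndot q.1 q.2 _ (me0 q.1 m) i)).
  + exact: (cts_Rad r' lam' Me').
  + exact: (cts_Nt r' N' Me').
- move=> i q; split; first exact: Rad_gt0 dl0 dw _ _.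
  exact: N_unit.
- move=> i j q ij; exact: dis (me0 q.1 M) (inv q.1 q.2 M) ij.
- move=> i p /=; have e0 : M%:R * eta 0 = 0 by rewrite Meta clamp_eq0 ?mul0r.
  have a0 : age (r^~ p) w i 0 <= -1.
    rewrite /age ler_pdivrMr// sub0r mulN1r lerN2 /w.
    by rewrite ler_sqr ?nnegrE ?(ltW dl0) ?(ltW (r0 _ _)).
  split.
  + have := inv 0 p M; rewrite e0 => I; apply: (inv_alive I); lra.
  + rewrite e0 (Rad_alive _ dl0 dw a0) subr0 sqrtr_sqr ger0_norm// ltW//.
  + rewrite e0 Nt_alive ?N0//; lra.
- move=> i p /=; apply: Nt_end => //.
  rewrite Meta clamp_eq1// mul1r /age ler_pdivlMr// mul1r /T0.
  by have := r_Rm p i; have := r0 p i; nra.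
- by move=> i h p hF; rewrite /Nt Nex.
- move=> cf Ff i q; apply: (pos_flat _ mu0 dl0 dw dl_Rm (lam0 q.2) (etaw q.1)
    (N_lip q.2)) => [j|j s]; first exact: cf.
  exact: Nflat.
Qed.

End untwist.

(** * Linked circles *)

Section cross_product.
Context {R : realType}.
Implicit Types (u v w z M N : 'rV[R]_3).

Definition crossp u v : 'rV[R]_3 :=
  vec3 (u 0 1 * v 0 2 - u 0 2 * v 0 1) (u 0 2 * v 0 0 - u 0 0 * v 0 2)
       (u 0 0 * v 0 1 - u 0 1 * v 0 0).

Lemma dotp_cross_rot u v w : dotp u (crossp v w) = dotp v (crossp w u).
Proof. by rewrite !dotp3 /crossp !vec3E; ring. Qed.

Lemma dotp_crossl u v : dotp u (crossp u v) = 0.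
Proof. by rewrite !dotp3 /crossp !vec3E; ring. Qed.

Lemma dotp_crossr u v : dotp v (crossp u v) = 0.
Proof. by rewrite !dotp3 /crossp !vec3E; ring. Qed.

Lemma cross_self u : crossp u u = 0.
Proof. by apply: row3P; rewrite /crossp !vec3E mxE; ring. Qed.

Lemma cross_cross M N z : crossp M (crossp N z) = dotp M z *: N - dotp M N *: z.
Proof. by apply: row3P; rewrite /crossp !vec3E !mxE !dotp3; ring. Qed.

Lemma cross_eq0 N z : dotp N N = 1 -> crossp N z = 0 -> z = dotp N z *: N.
Proof.
move=> N1 c0; have := cross_cross N N z; rewrite c0 N1 scale1r => e.
apply/esym/eqP; rewrite -subr_eq0 -e; apply/eqP.
by apply: row3P; rewrite /crossp !vec3E !mxE; ring.
Qed.

(** Cramer's rule for a vector with prescribed products with [M], [N] and [w]. *)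
Lemma triple_expansion M N w z : dotp w (crossp M N) *: z =
  dotp M z *: crossp N w + dotp N z *: crossp w M + dotp w z *: crossp M N.
Proof. by apply: row3P; rewrite !mxE !dotp3 /crossp ?(vec3E, mxE) /=; ring. Qed.

Lemma exists_orthogonal3 M N w : dotp M M = 1 -> dotp w (crossp M N) = 0 ->
  exists g, [/\ dotp g g != 0, dotp M g = 0, dotp N g = 0 & dotp w g = 0].
Proof.
have nz g : g != 0 -> dotp g g != 0.
  by apply: contra => /eqP g0; apply/eqP/nrm_eq0; rewrite /nrm g0 sqrtr0.
move=> M1 D0; have [c0|c0] := eqVneq (crossp M N) 0; last first.
  by exists (crossp M N); rewrite dotp_crossl dotp_crossr D0; split=> //; exact: nz.
have NM := cross_eq0 M1 c0.
have [d0|d0] := eqVneq (crossp M w) 0; last first.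
  exists (crossp M w); rewrite dotp_crossl dotp_crossr NM dotpZl dotp_crossl mulr0.
  by split=> //; exact: nz.
have wM := cross_eq0 M1 d0; have [g g1 Mg] := exists_orthogonal M.
by exists g; rewrite NM wM !dotpZl Mg !mulr0 g1 oner_neq0.
Qed.

Lemma cts_crossp (T : topologicalType) (u v : T -> 'rV[R]_3) :
  continuous u -> continuous v -> continuous (fun t => crossp (u t) (v t)).
Proof. by move=> cu cv; rewrite /crossp; cts. Qed.

End cross_product.

Section closed_projection.
Context {R : realType} {T U : topologicalType}.

(** By the tube lemma: if [G] has no zero on the fibre over [t], it has none on the fibres
    nearby. *)
Lemma closed_projection (K : set U) (G : T * U -> R) : compact K -> continuous G ->
  closed [set t | exists2 v, K v & G (t, v) = 0].
Proof.
move=> cK cG; rewrite -[X in closed X]setCK; apply: open_closedC.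
rewrite openE => t nt.
have A : \forall t' \near t, K `<=` (fun v => G (t', v) != 0).
  apply: ((compact_near_coveringP K).1 cK) => v Kv.
  have g0 : G (t, v) != 0 by apply/eqP => e; apply: nt; exists v.
  have [-[A B] /= [tA vB] AB] : nbhs (t, v) (G @^-1` [set x | x != 0]).
    by apply: cG; apply: open_nbhs_nbhs; split => //; exact: open_neq.
  by exists (B, A) => //= -[v' t'] [/= Bv At]; exact: (AB (t', v')).
apply: filterS A => t' /= H [v Kv e].
by have := H v Kv; rewrite e eqxx.
Qed.

End closed_projection.

Section linking.
Context {R : realType}.
Implicit Types (c d v w M N : 'rV[R]_3) (r s : R).

(* [c + r v] lies in the spans of both circles, at the same power [h] with
   respect to them: it is on the circles of squared radii [r^2 - h] and
   [s^2 - h].  The conditions other than [dotp v v <= 1] are linear in [v]. *)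
Definition meets c r M d s N v :=
  [/\ dotp M v = 0, dotp N v = - dotp N (c - d) / r,
      dotp (c - d) v = (s ^+ 2 - r ^+ 2 - dotp (c - d) (c - d)) / (2 * r) &
      dotp v v <= 1].

Lemma meets_circle c r M d s N v : 0 < r -> meets c r M d s N v -> dotp v v = 1 ->
  circle c r M (c + r *: v) /\ circle d s N (c + r *: v).
Proof.
move=> r0 [Mv Nv wv _] v1; have rn : r != 0 by rewrite gt_eqF.
have e : c + r *: v - d = (c - d) + r *: v by apply/rowP => i; rewrite !mxE; ring.
rewrite /circle /= /sqdist e addrAC subrr add0r; move: (c - d) Nv wv => w Nv wv.
rewrite !dotpE v1 Mv Nv (dotpC v w) wv; do ![split].
- by ring.
- by ring.
- by field.
- by field.
Qed.

(** If [dotp v v = 1], the point is on both circles. If the determinant vanishes, the linear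
    conditions hold along a whole line through [v], which crosses the unit sphere at such a
    point. *)
Lemma meets_nondegenerate c r M d s N v : 0 < r -> dotp M M = 1 ->
  circle c r M `&` circle d s N = set0 -> meets c r M d s N v ->
  dotp v v < 1 /\ dotp (c - d) (crossp M N) != 0.
Proof.
move=> r0 M1 dj mv.
have no u : meets c r M d s N u -> dotp u u = 1 -> False.
  move=> mu u1; have [a b] := meets_circle r0 mu u1.
  by have : set0 (c + r *: u) by rewrite -dj.
have v1 : dotp v v < 1.
  case: (mv) => _ _ _ v1; rewrite lt_neqAle v1 andbT.
  by apply/eqP => /(no _ mv).
split=> //; apply/eqP => D0; have [g [g0 Mg Ng wg]] := exists_orthogonal3 M1 D0.
pose a := dotp g g; pose b := dotp v g; pose q := b ^+ 2 + a * (1 - dotp v v).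
have a0 : 0 < a by rewrite lt_def g0 dotp_ge0.
have q0 : 0 <= q by rewrite addr_ge0 ?sqr_ge0// mulr_ge0 ?ltW// subr_gt0.
pose t := (- b + Num.sqrt q) / a.
have sq : Num.sqrt q ^+ 2 = q by rewrite sqr_sqrtr.
have e : dotp (v + t *: g) (v + t *: g) = 1.
  rewrite !dotpE (dotpC g v) -/a -/b.
  have an : a != 0 by rewrite gt_eqF.
  have -> : dotp v v = 1 - (q - b ^+ 2) / a.
    by rewrite /q; field.
  by rewrite -sq /t; field.
apply: (no _ _ e); case: mv => Mv Nv wv _; split.
- by rewrite !dotpE Mv Mg; ring.
- by rewrite dotpDr dotpZr Ng mulr0 addr0.
- by rewrite dotpDr dotpZr wg mulr0 addr0.
- by rewrite e.
Qed.

Variables (c d M N : R -> 'rV[R]_3) (r s : R -> R).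
Hypothesis c_cts : continuous c.
Hypothesis d_cts : continuous d.
Hypothesis M_cts : continuous M.
Hypothesis N_cts : continuous N.
Hypothesis r_cts : continuous r.
Hypothesis s_cts : continuous s.
Hypothesis r_gt0 : forall u, 0 < r u.
Hypothesis M_unit : forall u, dotp (M u) (M u) = 1.
Hypothesis disjoint_circles :
  forall u, circle (c u) (r u) (M u) `&` circle (d u) (s u) (N u) = set0.

Let meet := [set u | exists v, meets (c u) (r u) (M u) (d u) (s u) (N u) v].

(** The conditions are the vanishing of the continuous function [G], and [v] ranges over a compact
    cube. *)
Lemma meet_closed : closed meet.
Proof.
pose K := [set v : 'rV[R]_3 | forall i, `[-1, 1]%classic (v 0 i)].
pose be u := - dotp (N u) (c u - d u) / r u.
pose ga u := (s u ^+ 2 - r u ^+ 2 - dotp (c u - d u) (c u - d u)) / (2 * r u).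
pose G (q : R * 'rV[R]_3) := `|dotp (M q.1) q.2| + `|dotp (N q.1) q.2 - be q.1|
  + `|dotp (c q.1 - d q.1) q.2 - ga q.1| + Num.max 0 (dotp q.2 q.2 - 1).
have rn u : r u != 0 by rewrite gt_eqF.
have r2n u : 2 * r u != 0 by rewrite mulf_neq0.
have G_cts : continuous G.
  rewrite /G /be /ga; cts; try exact: cts_snd.
  all: try (apply: ctsV => [|q]; [cts|by []]).
  all: do 1?[exact: (cts_comp c_cts (@cts_fst _ _))|exact: (cts_comp d_cts (@cts_fst _ _))
    |exact: (cts_comp M_cts (@cts_fst _ _))|exact: (cts_comp N_cts (@cts_fst _ _))
    |exact: (cts_comp r_cts (@cts_fst _ _))|exact: (cts_comp s_cts (@cts_fst _ _))].
have K_cpt : compact K.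
  have := @rV_compact R 3 (fun=> `[-1, 1]%classic) (fun=> @segment_compact R (-1) 1).
  by congr compact; apply/funext => v.
have := closed_projection K_cpt G_cts; congr closed; apply/seteqP; split=> u /=.
  case=> v _ G0; exists v.
  have [a0 b0] := (normr_ge0 (dotp (M u) v), normr_ge0 (dotp (N u) v - be u)).
  have k0 := normr_ge0 (dotp (c u - d u) v - ga u).
  have m0 : 0 <= Num.max 0 (dotp v v - 1) by rewrite le_max lexx.
  move: G0; rewrite /G /= => G0.
  have e1 : `|dotp (M u) v| = 0 by lra.
  have e2 : `|dotp (N u) v - be u| = 0 by lra.
  have e3 : `|dotp (c u - d u) v - ga u| = 0 by lra.
  have e4 : Num.max 0 (dotp v v - 1) = 0 by lra.
  split.
  - exact: normr0_eq0.
  - by apply/eqP; rewrite -subr_eq0; apply/eqP/normr0_eq0.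
  - by apply/eqP; rewrite -subr_eq0; apply/eqP/normr0_eq0.
  - have : dotp v v - 1 <= Num.max 0 (dotp v v - 1) by rewrite le_max lexx orbT.
    by rewrite e4 subr_le0.
case=> v [e1 e2 e3 e4]; exists v.
  move=> i; rewrite /= in_itv /= -ler_norml; apply: le_trans (coord_le_nrm v i) _.
  by rewrite -(sqrtr1 R) ler_wsqrtr.
rewrite /G /= e1 e2 e3 !subrr !normr0 !add0r; apply/max_idPl.
by rewrite subr_le0.
Qed.

(** The determinant is nonzero and the inequality strict at [u], so the solution given by Cramer's
    rule persists nearby. *)
Lemma meet_open : open meet.
Proof.
rewrite openE => u [v mv]; have [v1 D0] := meets_nondegenerate (r_gt0 u) (M_unit u) (disjoint_circles u) mv.
pose D t := dotp (c t - d t) (crossp (M t) (N t)).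
pose be t := - dotp (N t) (c t - d t) / r t.
pose ga t := (s t ^+ 2 - r t ^+ 2 - dotp (c t - d t) (c t - d t)) / (2 * r t).
pose x t := (D t)^-1 *: (be t *: crossp (c t - d t) (M t) + ga t *: crossp (M t) (N t)).
have rn t : r t != 0 by rewrite gt_eqF.
have r2n t : 2 * r t != 0 by rewrite mulf_neq0.
have D_cts : continuous D by rewrite /D; cts; apply: cts_crossp.
have xv : x u = v.
  have := triple_expansion (M u) (N u) (c u - d u) v; case: (mv) => -> -> -> _.
  rewrite scale0r add0r -/(be u) -/(ga u) -/(D u) => e.
  by rewrite /x -e scalerA mulVf// scale1r.
have x_cts : {for u, continuous x}.
  apply: (@cvgZ _ 'rV[R]_3); first by apply: cvgV => //; exact: D_cts.
  have : continuous (fun t => be t *: crossp (c t - d t) (M t) + ga t *: crossp (M t) (N t)).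
    rewrite /be /ga; cts; try (by apply: ctsV => //; cts); apply: cts_crossp => //; cts.
  by apply.
have x1 : \forall t \near u, dotp (x t) (x t) < 1.
  have h : {for u, continuous (fun t => dotp (x t) (x t))}.
    apply: (continuous_comp x_cts (g := fun y => dotp y y)).
    by apply: (@cts_dotp _ _ _ id id); exact: cts_id.
  by apply: (h [set y | y < 1]); apply: open_nbhs_nbhs; split; [exact: open_lt|rewrite /= xv].
have Dn : \forall t \near u, D t != 0.
  by apply: (D_cts u [set y | y != 0]); apply: open_nbhs_nbhs; split; [exact: open_neq|exact: D0].
near=> t.
have Dt : D t != 0 by near: t.
have Dt' : dotp (M t) (crossp (N t) (c t - d t)) = D t by rewrite -dotp_cross_rot.
have Dt'' : dotp (N t) (crossp (c t - d t) (M t)) = D t by rewrite dotp_cross_rot -Dt' dotp_cross_rot.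
exists (x t); split.
- by rewrite /x dotpZr [X in _ * X = _]dotpDr (dotpZr (be t)) (dotpZr (ga t)) dotp_crossl dotp_crossr !mulr0 addr0 mulr0.
- by rewrite /x dotpZr [X in _ * X = _]dotpDr (dotpZr (be t)) (dotpZr (ga t)) dotp_crossr Dt'' mulr0 addr0 mulrCA mulVf ?mulr1.
- rewrite /x dotpZr [X in _ * X = _]dotpDr (dotpZr (be t)) (dotpZr (ga t)) -/(D t) dotp_crossl.
  by rewrite mulr0 add0r mulrCA mulVf ?mulr1.
- by apply/ltW; near: t.
Unshelve. all: by end_near.
Qed.

Lemma meet_transport u0 u1 : meet u1 -> meet u0.
Proof.
move=> m1; have : meet `&` [set: R] !=set0 by exists u1.
have RC : connected [set: R] by apply/connected_intervalP.
have -> // : meet = [set: R].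
apply: RC; first by exists u1.
  by exists meet; [exact: meet_open|rewrite setTI].
by exists meet; [exact: meet_closed|rewrite setTI].
Qed.

End linking.

Section slices.
Context {R : realType} {n : nat}.
Variables (c N : 'I_n -> R * R -> 'rV[R]_3) (r : 'I_n -> R * R -> R).
Hypothesis c_cts : forall i, continuous (c i).
Hypothesis r_cts : forall i, continuous (r i).
Hypothesis N_cts : forall i, continuous (N i).
Hypothesis r_gt0 : forall i p, 0 < r i p.
Hypothesis N_unit : forall i p, dotp (N i p) (N i p) = 1.
Hypothesis disjoint_circles : forall p i j, i != j ->
  circle (c i p) (r i p) (N i p) `&` circle (c j p) (r j p) (N j p) = set0.
Hypothesis base_normal : forall i, N i (0, 0) = ex.

(* As long as the circles stay disjoint, the condition that some of these slices
   meet is open and closed in the parameter: it says that the circles are linked.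
   It fails at the base point, where the normals are parallel. *)
Lemma disjoint_slices p i j h y : i != j ->
  0 <= h -> h <= r i p ^+ 2 -> h <= r j p ^+ 2 ->
  circle (c i p) (Num.sqrt (r i p ^+ 2 - h)) (N i p) y ->
  circle (c j p) (Num.sqrt (r j p ^+ 2 - h)) (N j p) y -> False.
Proof.
move=> ij h0 hi hj [ci Ni] [cj Nj].
(* The line from the base point through [p], along which linking is transported. *)
pose l u : R * R := (u * p.1, u * p.2).
have l_cts : continuous l by apply: cts_pair; cts; exact: cts_id.
have L (V : topologicalType) (f : R * R -> V) : continuous f -> continuous (fun u => f (l u)).
  by move=> cf; exact: (cts_comp cf l_cts).
have l1 : l 1 = p by rewrite /l !mul1r; case: (p).
have l0 : l 0 = (0, 0) by rewrite /l !mul0r.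
have T u1 := @meet_transport _ _ _ _ _ _ _ (L _ _ (@c_cts i)) (L _ _ (@c_cts j)) (L _ _ (@N_cts i))
  (L _ _ (@N_cts j)) (L _ _ (@r_cts i)) (L _ _ (@r_cts j)) (fun u => r_gt0 i (l u))
  (fun u => N_unit i (l u)) (fun u => disjoint_circles (l u) ij) 0 u1.
have [|v] := T 1.
  rewrite /= l1; set a := r i p in ci hi *; set b := r j p in cj hj *.
  have a0 : 0 < a by exact: r_gt0.
  have an : a != 0 by rewrite gt_eqF.
  (* The common point of the two slices in units of the first radius; [h >= 0] says that it has norm
     at most 1. *)
  exists (a^-1 *: (y - c i p)).
  have e : y - c j p = (y - c i p) + (c i p - c j p) by rewrite addrA subrK.
  move: cj Nj; rewrite /sqdist e; move: ci Ni; rewrite /sqdist.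
  rewrite /meets; move: (y - c i p) (c i p - c j p) => z w.
  rewrite !sqr_sqrtr ?subr_ge0// => ci Ni cj; rewrite dotpDr => Nj.
  split; rewrite ?dotpZr.
  - by rewrite Ni mulr0.
  - have -> : dotp (N j p) z = - dotp (N j p) w by lra.
    by rewrite mulrC.
  - move: cj; rewrite !dotpE ci (dotpC z w) => cj.
    have -> : dotp w z = (b ^+ 2 - a ^+ 2 - dotp w w) / 2 by lra.
    by field.
  - rewrite dotpZl ci mulrA -expr2 exprVn mulrC ler_pdivrMr ?exprn_gt0// mul1r.
    by rewrite gerBl.
rewrite /= l0 => mv.
have [_] := meets_nondegenerate (r_gt0 i _) (N_unit i _) (disjoint_circles (0,0) ij) mv.
by rewrite !base_normal cross_self dotp0r eqxx.
Qed.

End slices.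

(** * Parking *)

Section parking_schedule.
Context {R : realType}.
Implicit Types s t a b : R.

Lemma clampP s : (s <= 0 /\ clamp s = 0) \/ (1 <= s /\ clamp s = 1) \/
  (0 < s < 1 /\ clamp s = s).
Proof.
have [s0|s0] := lerP s 0; first by left; rewrite clamp_eq0.
have [s1|s1] := lerP 1 s; first by right; left; rewrite clamp_eq1.
by right; right; rewrite clampE// !ltW.
Qed.

Lemma clamp_affine_up a b s : b <= 0 -> 1 <= a + b -> 0 <= a ->
  clamp (a * clamp s + b) = clamp (a * s + b).
Proof.
move=> b0 ab a0; have [[s0 ->]|[[s1 ->]|[_ ->//]]] := clampP s.
- by rewrite mulr0 add0r !clamp_eq0//; nra.
- by rewrite mulr1 !clamp_eq1//; nra.
Qed.

Lemma clamp_affine_down a b s : 1 <= b -> b <= a -> 0 <= a ->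
  clamp (b - a * clamp s) = clamp (b - a * s).
Proof.
move=> b1 ab a0; have [[s0 ->]|[[s1 ->]|[_ ->//]]] := clampP s.
- by rewrite mulr0 subr0 !clamp_eq1//; nra.
- by rewrite mulr1 !clamp_eq0//; nra.
Qed.

Lemma clampK s : clamp (clamp s) = clamp s :> R.
Proof. by rewrite clampE// clamp_ge0 clamp_le1. Qed.

(* While [s] runs through [0, 1], the loop is run through first; then the rings
   are parked, the normals run backwards through their paths, and the rings are
   put back. *)
Definition go s := 4 * s.
Definition back s := Num.min (clamp (4 * s)) (clamp (3 - 4 * s)).
(** The homotopy takes place in the middle third of the [t]-interval. On the outer thirds the loops
    are those of the two ends, with the parking faded in and out. *)
Definition across t := 3 * t + -1.
Definition parked (p : R * R) :=
  Num.min (Num.min (clamp (4 * p.1 + -1)) (clamp (4 - 4 * p.1)))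
          (Num.min (clamp (3 * p.2 + 0)) (clamp (3 - 3 * p.2))).

Lemma go_clamp s : clamp (go (clamp s)) = clamp (go s).
Proof. by rewrite /go -[4 * s]addr0 -[4 * _]addr0 clamp_affine_up//; lra. Qed.

Lemma across_clamp t : clamp (across (clamp t)) = clamp (across t).
Proof. by rewrite clamp_affine_up//; lra. Qed.

Lemma back_clamp s : back (clamp s) = back s.
Proof. by rewrite /back -!/(go _) go_clamp clamp_affine_down//; lra. Qed.

Lemma parked_clamp p : parked (clamp2 p) = parked p.
Proof.
by rewrite /parked /= !clamp_affine_up ?clamp_affine_down//; lra.
Qed.

Lemma parked_itv p : 0 <= parked p <= 1.
Proof.
by rewrite /parked !le_min !clamp_ge0 /= 2!ge_min clamp_le1.
Qed.

(** In each case the normals at [(back s, across t)] are the original ones at [(go s, across t)]: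
    either the parameters agree, or all the normals concerned lie over the boundary and are [ex]. *)
Lemma parked_eq0 (s t : R) : parked (s, t) = 0 ->
  clamp (go s) = back s \/ (back s = 0 /\ clamp (go s) = 1) \/
  (clamp (across t) = 0 \/ clamp (across t) = 1).
Proof.
rewrite /parked /back /go /across /= => m0.
have [s1|s1] := lerP (4 * s) 1.
  left; rewrite (clamp_eq1 (_ : 1 <= 3 - 4 * s)); last lra.
  by rewrite min_l// clamp_le1.
have [s4|s4] := lerP 4 (4 * s).
  right; left; rewrite (clamp_eq0 (_ : 3 - 4 * s <= 0)); last lra.
  rewrite min_r ?clamp_ge0// clamp_eq1//; lra.
right; right; have [t0|t0] := lerP t 0; first by left; rewrite clamp_eq0//; lra.
have [t1|t1] := lerP 1 t; first by right; rewrite clamp_eq1//; lra.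
have pos (x : R) : 0 < x -> 0 < clamp x.
  by move=> x0; rewrite /clamp lt_max lt_min ltr01 x0 orbT.
suff : 0 < 0 :> R by rewrite ltxx.
by rewrite -{2}m0 !lt_min !pos//; lra.
Qed.

Lemma parked_gt0 (s t : R) : 0 < parked (s, t) -> clamp (go s) = 1.
Proof.
rewrite /parked !lt_min /= -!andbA => /and4P[m0 _ _ _].
apply: clamp_eq1; rewrite /go leNgt; apply/negP => s1.
by move: m0; rewrite clamp_eq0 ?ltxx//; lra.
Qed.

(** While rings travel to or from their parking places, the normals are taken on the boundary of the
    square, so that all rings are parallel. *)
Lemma parked_lt1 (s t : R) : 0 < parked (s, t) < 1 ->
  (back s = 0 \/ back s = 1) \/ (clamp (across t) = 0 \/ clamp (across t) = 1).
Proof.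
move=> /andP[m0 m1]; have := parked_gt0 m0; rewrite /go => s1.
have {}s1 : 1 < 4 * s.
  rewrite ltNge; apply/negP => s1'; move: m0; rewrite /parked !lt_min /=.
  by rewrite clamp_eq0 ?ltxx//; lra.
have [s2|s2] := lerP (4 * s) 2.
  by left; right; rewrite /back !clamp_eq1 ?minxx//; lra.
have [s3|s3] := lerP 3 (4 * s).
  left; left; rewrite /back (clamp_eq0 (_ : 3 - 4 * s <= 0)); last lra.
  by rewrite min_r ?clamp_ge0.
right; rewrite /across; have [t0|t0] := lerP (3 * t) 1; first by left; rewrite clamp_eq0//; lra.
have [t1|t1] := lerP 2 (3 * t); first by right; rewrite clamp_eq1//; lra.
suff : 1 < 1 :> R by rewrite ltxx.
by rewrite -{1}(_ : parked (s, t) = 1)// /parked /= !clamp_eq1 ?minxx//; lra.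
Qed.

End parking_schedule.

(** * Parking places *)

Section ranking.
Context {R : realType} {n : nat}.
Variable x : 'I_n -> R.

(** Ties are broken by the index, so that even rings in the same plane get distinct ranks. *)
Definition before i j := (x i < x j) || ((x i == x j) && (i < j)%N).
Definition rank j := #|[pred i | before i j]|.

Lemma rank_mono i j : before i j -> (rank i < rank j)%N.
Proof.
move=> ij; apply: proper_card; apply/properP; split.
  apply/fintype.subsetP => k; rewrite !inE; move: ij; rewrite /before.
  move=> /orP[xij|/andP[/eqP xij lij]] /orP[xki|/andP[/eqP xki lki]].
  - by rewrite (lt_trans xki xij).
  - by rewrite xki xij.
  - by rewrite -xij xki.
  - by rewrite xki xij eqxx (ltn_trans lki lij) orbT.
by exists i; rewrite !inE// /before ltxx eqxx ltnn.
Qed.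

(** Displacements proportional to the rank never reverse the order of the points, and they separate
    the tied ones. *)
Lemma ranked_gap i j (m : R) : i != j -> 0 <= m ->
  m <= `|x i + m * (rank i)%:R - (x j + m * (rank j)%:R)|.
Proof.
move=> ij m0.
have main k l : before k l ->
  m <= `|x k + m * (rank k)%:R - (x l + m * (rank l)%:R)|.
  move=> kl; rewrite distrC; apply: le_trans (ler_norm _).
  have xkl : x k <= x l by case/orP: kl => [/ltW//|/andP[/eqP ->]].
  have : (rank k)%:R + 1 <= (rank l)%:R :> R by rewrite natr1 ler_nat rank_mono.
  nra.
have [xij|xij|xij] := ltgtP (x i) (x j).
- by apply: main; rewrite /before xij.
- by rewrite distrC; apply: main; rewrite /before xij.
have [lij|lij|lij] := ltngtP i j.
- by apply: main; rewrite /before xij eqxx lij orbT.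
- by rewrite distrC; apply: main; rewrite /before xij eqxx lij orbT.
- by move/negP: ij; case; apply/eqP/val_inj.
Qed.

End ranking.

Section parking.
Context {R : realType} {n : nat}.
Variables (c N : 'I_n -> R * R -> 'rV[R]_3) (r : 'I_n -> R * R -> R).
Hypothesis n_gt0 : (0 < n)%N.
Hypothesis c_cts : forall i, continuous (c i).
Hypothesis r_cts : forall i, continuous (r i).
Hypothesis N_cts : forall i, continuous (N i).
Hypothesis c_clamp : forall i p, c i (clamp2 p) = c i p.
Hypothesis r_clamp : forall i p, r i (clamp2 p) = r i p.
Hypothesis N_clamp : forall i p, N i (clamp2 p) = N i p.
Hypothesis r_gt0 : forall i p, 0 < r i p.
Hypothesis N_unit : forall i p, dotp (N i p) (N i p) = 1.
Hypothesis disjoint_circles : forall p i j, i != j ->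
  circle (c i p) (r i p) (N i p) `&` circle (c j p) (r j p) (N j p) = set0.
Hypothesis c_side : forall i t, c i (0, t) = c i (0, 0) /\ c i (1, t) = c i (1, 0).
Hypothesis r_side : forall i t, r i (0, t) = r i (0, 0) /\ r i (1, t) = r i (1, 0).
Hypothesis N_side : forall i t, N i (0, t) = ex /\ N i (1, t) = ex.
Hypothesis N_ends : forall i s, N i (s, 0) = ex /\ N i (s, 1) = ex.

Let e i : R := (rank (fun i => c i (1, 0) 0 0) i)%:R.
Let C i p := c i (go p.1, across p.2) + (parked p * e i) *: ex.
(** A fully parked ring has radius 1/4, while the parked centres are at distance at least 1. *)
Let r' i p := (1 - parked p) * r i (go p.1, across p.2) + parked p / 4.
(** As [h] grows, the part of the path that is run forth and back is shortened, down to the side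
    [s = 0], where [N] is [ex]. *)
Let F i h p := N i ((1 - h) * back p.1, clamp (across p.2)).

Let clamped (V : Type) (f : R * R -> V) : (forall p, f (clamp2 p) = f p) ->
  forall s t s' t', clamp s = clamp s' -> clamp t = clamp t' -> f (s, t) = f (s', t').
Proof. by move=> fc s t s' t' ss tt; rewrite -(fc (s, t)) -(fc (s', t')) /clamp2 /= ss tt. Qed.

(** Without parking these are slices of the given family; travelling rings are in distinct parallel
    planes; parked rings lie in disjoint balls. *)
Lemma parked_disjoint p i j h y : i != j -> 0 <= h -> h <= r' i p ^+ 2 -> h <= r' j p ^+ 2 ->
  circle (C i p) (Num.sqrt (r' i p ^+ 2 - h)) (F i 0 p) y ->
  circle (C j p) (Num.sqrt (r' j p ^+ 2 - h)) (F j 0 p) y -> False.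
Proof.
case: p => s t ij h0; have /andP[m0 m1] := parked_itv (s, t).
have F0 k : F k 0 (s, t) = N k (back s, clamp (across t)) by rewrite /F subr0 mul1r.
have [mz|mz] := eqVneq (parked (s, t)) 0.
  have C0 k : C k (s, t) = c k (go s, across t) by rewrite /C mz mul0r scale0r addr0.
  have R0 k : r' k (s, t) = r k (go s, across t) by rewrite /r' mz subr0 mul1r mul0r addr0.
  have N0 k : F k 0 (s, t) = N k (go s, across t).
    rewrite F0; case: (parked_eq0 mz) => [e1|[[e1 e2]|[e1|e1]]].
    - by apply: (clamped (N_clamp k)); rewrite -?e1 clampK.
    - rewrite e1 (N_side _ _).1 -N_clamp /clamp2 /= e2.
      by rewrite (N_side _ _).2.
    - by rewrite e1 (N_ends _ _).1 -N_clamp /clamp2 /= e1 (N_ends _ _).1.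
    - by rewrite e1 (N_ends _ _).2 -N_clamp /clamp2 /= e1 (N_ends _ _).2.
  rewrite !C0 !R0 !N0; apply: disjoint_slices => //.
  by move=> k; exact: (N_side _ _).1.
have mp : 0 < parked (s, t) by rewrite lt_def mz.
have cE k : c k (go s, across t) = c k (1, 0).
  rewrite -c_clamp /clamp2 /= (parked_gt0 mp); exact: (c_side _ _).2.
have [m_lt|m_ge] := ltrP (parked (s, t)) 1.
  have NE k : F k 0 (s, t) = ex.
    rewrite F0; case: (@parked_lt1 _ s t); rewrite ?mp// => -[]->.
    - exact: (N_side _ _).1.
    - exact: (N_side _ _).2.
    - exact: (N_ends _ _).1.
    - exact: (N_ends _ _).2.
  rewrite !NE => _ _ [_ +] [_ +]; rewrite !dotp_ex => yi yj.
  have := ranked_gap (fun i => c i (1, 0) 0 0) ij m0; rewrite -/(e i) -/(e j).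
  have X k : (y - C k (s, t)) 0 0 = 0 ->
    c k (1, 0) 0 0 + parked (s, t) * e k = y 0 0.
    by rewrite /C cE !mxE /= => ?; lra.
  by rewrite (X _ yi) (X _ yj) subrr normr0 leNgt mp.
have mE : parked (s, t) = 1 by apply/eqP; rewrite eq_le m1.
have RE k : r' k (s, t) = 1 / 4 by rewrite /r' mE subrr mul0r add0r.
rewrite !RE => h1 h2.
have s0 : 0 <= Num.sqrt ((1 / 4) ^+ 2 - h) <= 1 / 4.
  rewrite sqrtr_ge0 /= -[leRHS]ger0_norm; last by lra.
  by rewrite -sqrtr_sqr ler_wsqrtr// gerBl.
have /andP[s00 s1] := s0.
move=> /(circleP _ _ _ s00)[yi _] /(circleP _ _ _ s00)[yj _].
have := ranked_gap (fun i => c i (1, 0) 0 0) ij ler01; rewrite -/(e i) -/(e j).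
have := coord_le_nrm (C i (s, t) - C j (s, t)) 0.
have := nrm_triangle y (C i (s, t)) (C j (s, t)); rewrite (nrm_distC _ y) yi yj.
rewrite {3}/C {3}/C !cE mE !mxE /= !mulr1 => h3 h4 h5.
by move: (le_trans h5 (le_trans h4 h3)) s1; rewrite !mul1r; lra.
Qed.

(** It is 0 on the boundary of the square and 1 on the middle ninth. Where it is intermediate,
    [3 * p - 1] is outside the open unit square, and the normals are [ex] for every [h]. *)
Let height (p : R * R) := Num.min
  (Num.min (clamp (3 * p.1)) (clamp (3 - 3 * p.1)))
  (Num.min (clamp (3 * p.2)) (clamp (3 - 3 * p.2))).

Let height1 p : height p = 1 \/
  forall i h, F i h (3 * p.1 + -1, 3 * p.2 + -1) = ex.
Proof.
have back0 x : x <= 0 \/ 1 <= x -> back x = 0.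
  move=> [x0|x1]; rewrite /back.
    by rewrite clamp_eq0 ?min_l ?clamp_ge0//; lra.
  by rewrite (@clamp_eq0 _ (3 - 4 * x)) ?min_r ?clamp_ge0//; lra.
have side (s t : R) : s <= 0 \/ 1 <= s -> forall i h, F i h (s, t) = ex.
  by move=> st i h; rewrite /F back0// mulr0 (N_side _ _).1.
have ends (s t : R) : t <= 0 \/ 1 <= t -> forall i h, F i h (s, t) = ex.
  move=> [t0|t1] i h; rewrite /F /across /=.
    by rewrite clamp_eq0 ?(N_ends _ _).1//; lra.
  by rewrite clamp_eq1 ?(N_ends _ _).2//; lra.
have [s0|s0] := lerP (3 * p.1) 1; first by right; apply: side; left; lra.
have [s1|s1] := lerP 2 (3 * p.1); first by right; apply: side; right; lra.
have [t0|t0] := lerP (3 * p.2) 1; first by right; apply: ends; left; lra.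
have [t1|t1] := lerP 2 (3 * p.2); first by right; apply: ends; right; lra.
by left; rewrite /height !clamp_eq1 ?minxx//; lra.
Qed.

Theorem straighten : exists (X : 'I_n -> R * R -> 'rV[R]_3) (Y : 'I_n -> R * R -> R),
  [/\ forall i, continuous (X i) /\ continuous (Y i),
      forall i p, 0 < Y i p,
      forall p i j, i != j ->
        circle (X i p) (Y i p) ex `&` circle (X j p) (Y j p) ex = set0,
      (forall i p, c i p 0 2 = 0) -> (forall i p, N i p 0 2 = 0) ->
        forall i p, X i p 0 2 = 0 &
  [/\ forall i s, X i (s, 0) = c i (go (3 * s + -1), 0) /\
                  Y i (s, 0) = r i (go (3 * s + -1), 0),
      forall i s, X i (s, 1) = c i (go (3 * s + -1), 1) /\
                  Y i (s, 1) = r i (go (3 * s + -1), 1),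
      forall i t, X i (0, t) = c i (0, 0) /\ Y i (0, t) = r i (0, 0) &
      forall i t, X i (1, t) = c i (1, 0) /\ Y i (1, t) = r i (1, 0)]].
Proof.
have go_cts : continuous (fun p : R * R => go p.1).
  by rewrite /go; cts; exact: cts_fst.
have across_cts : continuous (fun p : R * R => across p.2).
  by rewrite /across; cts; exact: cts_snd.
have ga_cts := cts_pair go_cts across_cts.
have parked_cts : continuous (@parked R).
  by rewrite /parked; cts; first [exact: cts_fst|exact: cts_snd].
have C_cts i : continuous (C i).
  by rewrite /C; cts; exact: (cts_comp (@c_cts i) ga_cts).
have r'_cts i : continuous (r' i).
  by rewrite /r'; cts; exact: (cts_comp (@r_cts i) ga_cts).
have F_cts i : continuous (fun q : R * (R * R) => F i q.1 q.2).
  have c21 : continuous (fun q : R * (R * R) => q.2.1).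
    exact: (@cts_comp _ _ _ (fun p : R * R => p.1) _ (@cts_fst _ _) (@cts_snd _ _)).
  have c22 : continuous (fun q : R * (R * R) => q.2.2).
    exact: (@cts_comp _ _ _ (fun p : R * R => p.2) _ (@cts_snd _ _) (@cts_snd _ _)).
  apply: (cts_comp (@N_cts i)); apply: cts_pair; last by rewrite /across; cts.
  by rewrite /back; cts; exact: cts_fst.
have clampE2 (p : R * R) : clamp (go (clamp2 p).1) = clamp (go p.1) /\
    clamp (across (clamp2 p).2) = clamp (across p.2).
  by rewrite /= go_clamp across_clamp.
have C_clamp i p : C i (clamp2 p) = C i p.
  rewrite /C parked_clamp; congr (_ + _).
  by apply: (clamped (c_clamp i)); have [] := clampE2 p.
have r'_clamp i p : r' i (clamp2 p) = r' i p.
  rewrite /r' parked_clamp; congr (_ * _ + _).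
  by apply: (clamped (r_clamp i)); have [] := clampE2 p.
have F_clamp i h p : F i h (clamp2 p) = F i h p.
  by rewrite /F /= back_clamp across_clamp.
have r'_gt0 i p : 0 < r' i p.
  rewrite /r'; have /andP[] := parked_itv p; have := r_gt0 i (go p.1, across p.2).
  by move: (parked p) (r i _) => m a a0 m0 m1; nra.
have F_unit i h p : dotp (F i h p) (F i h p) = 1 by exact: N_unit.
have F_end i p : F i 1 p = ex by rewrite /F subrr mul0r (N_side _ _).1.
have [X [Y [Z [XYZ_cts YZ dj start [end1 stay flat]]]]] := untwist n_gt0 C_cts r'_cts F_cts
  C_clamp r'_clamp F_clamp r'_gt0 F_unit F_end parked_disjoint.
(* A surface in the untwisting on which all normals are [ex]: the middle ninth is at the end of the
   untwisting, and the frame around it joins it to the start. *)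
pose q (p : R * R) := (height p, (3 * p.1 + -1, 3 * p.2 + -1)).
have q_cts : continuous q.
  apply: cts_pair; last by apply: cts_pair; cts; first [exact: cts_fst|exact: cts_snd].
  by rewrite /height; cts; first [exact: cts_fst|exact: cts_snd].
have Zex i p : Z i (q p) = ex.
  rewrite /q; have [->|h] := height1 p; first exact: end1.
  by apply: stay => s; exact: h.
exists (fun i p => X i (q p)), (fun i p => Y i (q p)); split.
- move=> i; have [cX cY _] := XYZ_cts i.
  by split; [exact: (cts_comp cX)|exact: (cts_comp cY)].
- by move=> i p; have [] := YZ i (q p).
- by move=> p i j ij; rewrite -{1}(Zex i p) -(Zex j p); exact: dj.
- move=> c0 N0 i p; apply: flat => [k p'|k s p']; last exact: N0.
  by rewrite /C mxE c0 !mxE /= mulr0 addr0.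
have XY0 p i : height p = 0 -> parked (3 * p.1 + -1, 3 * p.2 + -1) = 0 ->
    X i (q p) = c i (go (3 * p.1 + -1), across (3 * p.2 + -1)) /\
    Y i (q p) = r i (go (3 * p.1 + -1), across (3 * p.2 + -1)).
  move=> h0 m0; rewrite /q h0; have [-> -> _] := start i (3 * p.1 + -1, 3 * p.2 + -1).
  by rewrite /C /r' m0 mul0r scale0r addr0 subr0 mul1r mul0r addr0.
have min0 (a b : R) : Num.min (Num.min (clamp a) (clamp b)) 0 = 0.
  by rewrite min_r// le_min !clamp_ge0.
have min0' (a b : R) : Num.min 0 (Num.min (clamp a) (clamp b)) = 0.
  by rewrite min_l// le_min !clamp_ge0.
have z0 (a b : R) : a <= 0 \/ b <= 0 -> Num.min (clamp a) (clamp b) = 0.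
  by case=> h; [rewrite clamp_eq0// min_l|rewrite (clamp_eq0 h) min_r]; rewrite ?clamp_ge0.
have ends s b : b = 0 \/ b = 1 -> height (s, b) = 0 /\ parked (3 * s + -1, 3 * b + -1) = 0.
  move=> hb; rewrite /height /parked /=; split; rewrite [X in Num.min _ X]z0 ?min0//.
    by case: hb => ->; [left|right]; lra.
  by case: hb => ->; [left|right]; lra.
have side b t : b = 0 \/ b = 1 -> height (b, t) = 0 /\ parked (3 * b + -1, 3 * t + -1) = 0.
  move=> hb; rewrite /height /parked /=; split; rewrite z0 ?min0'//.
    by case: hb => ->; [left|right]; lra.
  by case: hb => ->; [left|right]; lra.
have a0 : clamp (across (3 * 0 + -1)) = clamp 0 :> R by rewrite /across !clamp_eq0//; lra.
have a1 : clamp (across (3 * 1 + -1)) = clamp 1 :> R by rewrite /across !clamp_eq1//; lra.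
have g0 : clamp (go (3 * 0 + -1)) = clamp 0 :> R by rewrite /go !clamp_eq0//; lra.
have g1 : clamp (go (3 * 1 + -1)) = clamp 1 :> R by rewrite /go !clamp_eq1//; lra.
split.
- move=> i s; have [h0 k0] := ends s 0 (or_introl erefl).
  have [-> ->] := XY0 (s, 0) i h0 k0.
  by split; [apply: (clamped (c_clamp i))|apply: (clamped (r_clamp i))].
- move=> i s; have [h0 k0] := ends s 1 (or_intror erefl).
  have [-> ->] := XY0 (s, 1) i h0 k0.
  by split; [apply: (clamped (c_clamp i))|apply: (clamped (r_clamp i))].
- move=> i t; have [h0 k0] := side 0 t (or_introl erefl).
  have [-> ->] := XY0 (0, t) i h0 k0.
  rewrite (clamped (c_clamp i) g0 erefl) (clamped (r_clamp i) g0 erefl).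
  by rewrite (c_side _ _).1 (r_side _ _).1.
- move=> i t; have [h0 k0] := side 1 t (or_intror erefl).
  have [-> ->] := XY0 (1, t) i h0 k0.
  rewrite (clamped (c_clamp i) g1 erefl) (clamped (r_clamp i) g1 erefl).
  by rewrite (c_side _ _).2 (r_side _ _).2.
Qed.
End parking.

(** * Lifting to ordered configurations *)

Section circle_data.
Context {R : realType}.
Implicit Types (c v N M : 'rV[R]_3) (r s : R).

Lemma circleN c r N : circle c r (- N) = circle c r N.
Proof.
apply/seteqP; split=> y [yr yN]; split=> //; move: yN; rewrite dotpNl.
  by move/eqP; rewrite oppr_eq0 => /eqP.
by move->; rewrite oppr0.
Qed.

Lemma circle_sign (e : bool) c r N : circle c r ((-1) ^+ e *: N) = circle c r N.
Proof. by case: e; rewrite ?scaleN1r ?circleN// scale1r. Qed.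

Lemma parallel_of_orthogonal N M : dotp N N = 1 ->
  (forall u, dotp u u = 1 -> dotp N u = 0 -> dotp M u = 0) -> M = dotp N M *: N.
Proof.
move=> N1 h; pose v := M - dotp N M *: N.
have Nv : dotp N v = 0 by rewrite /v dotpBr dotpZr N1 mulr1 subrr.
suff v0 : nrm v = 0 by apply/eqP; rewrite -subr_eq0 -/v (nrm_eq0 v0).
apply/eqP; apply: contraT => vn.
have /eqP : dotp M ((nrm v)^-1 *: v) = 0.
  apply: h; last by rewrite dotpZr Nv mulr0.
  by rewrite dotpZl dotpZr -nrm_sqr; field.
rewrite dotpZr mulf_eq0 invr_eq0 (negbTE vn) /= => /eqP Mv.
by rewrite -sqrf_eq0 nrm_sqr {1}/v dotpBl dotpZl Mv Nv mulr0 subrr eqxx in vn.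
Qed.

Lemma parallel_sign N M : dotp N N = 1 -> dotp M M = 1 -> M = dotp N M *: N ->
  N = M \/ N = - M.
Proof.
move=> N1 M1 ME.
have : dotp N M ^+ 2 == 1 by apply/eqP; rewrite -[RHS]M1 {2}ME dotpZl -expr2.
rewrite sqrf_eq1 => /orP[]/eqP h.
  by left; rewrite ME h scale1r.
by right; rewrite ME h scaleN1r opprK.
Qed.

Lemma circle_diameter c r N u : dotp u u = 1 -> dotp N u = 0 ->
  circle c r N (c + r *: u) /\ circle c r N (c - r *: u).
Proof.
move=> u1 Nu; rewrite /circle /= /sqdist addrAC subrr add0r (addrAC c) subrr add0r.
by rewrite !dotpNl !dotpNr opprK !dotpZr !dotpZl u1 Nu !mulr0 oppr0 mulr1 -expr2.
Qed.

(** Both ends of every diameter of the first circle lie on the second. Adding and subtracting their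
    equations shows that [M] and [c - d] are orthogonal to each direction of the first plane, hence
    parallel to [N], while [M] is orthogonal to [c - d]. *)
Lemma circle_eq c r N d s M : 0 < r -> 0 < s -> dotp N N = 1 -> dotp M M = 1 ->
  circle c r N = circle d s M -> [/\ c = d, r = s & N = M \/ N = - M].
Proof.
move=> r0 s0 N1 M1 e; have rn : r != 0 by rewrite gt_eqF.
have key u : dotp u u = 1 -> dotp N u = 0 ->
    [/\ dotp (c - d) u = 0, dotp M u = 0, dotp M (c - d) = 0 &
        dotp (c - d) (c - d) + r ^+ 2 = s ^+ 2].
  move=> u1 Nu; have [] := circle_diameter c r u1 Nu; rewrite e /circle /= /sqdist.
  have -> : c + r *: u - d = (c - d) + r *: u by rewrite addrAC.
  have -> : c - r *: u - d = (c - d) - r *: u by rewrite addrAC.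
  move: (c - d) => w; rewrite !dotpE u1 (dotpC u w) => -[h1 h2] [h3 h4].
  have uw : dotp w u = 0 by apply: (mulfI rn); lra.
  split=> //; last by rewrite uw in h3; lra.
  - by apply: (mulfI rn); lra.
  - by lra.
have [u u1 Nu] := exists_orthogonal N; have [_ _ Mw rs] := key u u1 Nu.
have ME : M = dotp N M *: N.
  by apply: parallel_of_orthogonal => // v v1 /(key v v1)[].
have NM := parallel_sign N1 M1 ME.
have w0 : c - d = 0.
  rewrite (@parallel_of_orthogonal N (c - d))//; last by move=> v v1 /(key v v1)[].
  by case: NM => ->; rewrite ?dotpNl Mw ?oppr0 scale0r.
split=> //; first by apply/eqP; rewrite -subr_eq0 w0.
apply/eqP; rewrite -(eqrXn2 (_ : (0 < 2)%N)) ?ltW//; apply/eqP.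
by rewrite -rs w0 dotp0l add0r.
Qed.

End circle_data.

Section configuration_coordinates.
Context {R : realType} {n : nat}.
Local Notation O := (@ordered_config R n).
Implicit Types (a b : O) (i j : 'I_n).

Definition ctr a i := (val a 0 i).1.1.
Definition rad a i := (val a 0 i).1.2.
Definition nml a i := (val a 0 i).2.

Lemma ring_ofE a i : ring_of (val a 0 i) = circle (ctr a i) (rad a i) (nml a i).
Proof. by []. Qed.

Lemma config_is a : is_config (val a).
Proof. exact: set_mem (valP a). Qed.

Lemma rad_gt0 a i : 0 < rad a i.
Proof. by have [h _ _] := config_is a; exact: h. Qed.

Lemma nml_unit a i : dotp (nml a i) (nml a i) = 1.
Proof. by have [_ h _] := config_is a; exact: h. Qed.

Lemma rings_disjoint a i j : i != j -> ring_of (val a 0 i) `&` ring_of (val a 0 j) = set0.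
Proof. by have [_ _ h] := config_is a => /h[]. Qed.

Lemma ring_of_inj a : injective (fun i => ring_of (val a 0 i)).
Proof.
move=> i j ij; apply/eqP; apply: contraT => /(rings_disjoint a).
have [x ax] := circle_point (ctr a i) (rad a i) (nml a i).
by rewrite -ij setIid => e; have : set0 x by rewrite -e.
Qed.

Lemma ordered_ext a b : (forall i, [/\ ctr a i = ctr b i, rad a i = rad b i &
  nml a i = nml b i]) -> a = b.
Proof.
move=> e; apply: val_inj; apply/rowP => i; have := e i; rewrite /ctr /rad /nml.
by case: (val a 0 i) (val b 0 i) => [[? ?] ?] [[? ?] ?] /= [-> -> ->].
Qed.

Lemma cts_entry i : continuous (fun a : 'rV[@ring_data R]_n => a 0 i).
Proof.
move=> a W aW; exists (fun _ j => [set x | j = i -> W x]) => [k j|b /= ab].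
  have [->|ji] := eqVneq j i; first by rewrite (ord1 k); apply: filterS aW => x Wx _.
  have -> : [set x | j = i -> W x] = setT.
    by apply/seteqP; split=> // x _ /= e; rewrite e eqxx in ji.
  exact: (@filterT _ _ (@nbhs_filter _ (a k j : @ring_data R))).
exact: ab.
Qed.

Lemma cts_configuration (T : topologicalType) (f : T -> O) :
  (forall i, continuous (fun t => ctr (f t) i)) ->
  (forall i, continuous (fun t => rad (f t) i)) ->
  (forall i, continuous (fun t => nml (f t) i)) -> continuous f.
Proof.
move=> cc cr cN.
have ce i : continuous (fun t => val (f t) 0 i).
  have := cts_pair (cts_pair (cc i) (cr i)) (cN i).
  by rewrite (_ : (fun t => _) = fun t => val (f t) 0 i)//; apply/funext => t;
    rewrite /ctr /rad /nml; case: (val (f t) 0 i) => -[].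
have cv : continuous (fun t => val (f t) : 'rV[@ring_data R]_n).
  move=> t W [P tP PW].
  have : \forall t' \near t, forall j, P 0 j (val (f t') 0 j).
    by apply: filter_forall => j; apply: (ce j t); exact: tP.
  by apply: filterS => t' h; apply: PW => k j; rewrite ord1.
apply/continuousP => _ [W oW <-].
by move/continuousP: cv => /(_ _ oW).
Qed.

Lemma cts_val : continuous (val : O -> 'rV[@ring_data R]_n).
Proof. exact: initial_continuous. Qed.

Lemma cts_ctr i : continuous (fun a => ctr a i).
Proof.
exact: (cts_comp (cts_comp (@cts_fst _ _) (@cts_fst _ _)) (cts_comp (@cts_entry i) cts_val)).
Qed.

Lemma cts_rad i : continuous (fun a => rad a i).
Proof.
exact: (cts_comp (cts_comp (@cts_snd _ _) (@cts_fst _ _)) (cts_comp (@cts_entry i) cts_val)).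
Qed.

Lemma cts_nml i : continuous (fun a => nml a i).
Proof. exact: (cts_comp (@cts_snd _ _) (cts_comp (@cts_entry i) cts_val)). Qed.

End configuration_coordinates.

(** * Renumbering the rings and reversing their normals *)

Section relabelling.
Context {R : realType} {n : nat}.
Local Notation O := (@ordered_config R n).
Local Notation Q := (ring_config R n).
Implicit Types (a b : O) (i j : 'I_n) (q : Q).

Definition forget a : Q := (\pi_(ring_config R n) a)%qT.

Lemma forget_cts : continuous forget.
Proof. exact: pi_continuous. Qed.

Lemma forgetP a b : forget a = forget b <-> rings a = rings b.
Proof.
split=> [e|e]; first by rewrite -(rings_of_pi a) -(rings_of_pi b) -!/(forget _) e.
suff : (\pi_({eq_quot @same_rings R n}) a = \pi_({eq_quot @same_rings R n}) b)%qT by [].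
by apply/eqmodP/asboolP.
Qed.

Lemma forget_repr q : forget (repr q) = q.
Proof. exact: reprK. Qed.

Lemma same_rings_perm a b : forget a = forget b ->
  exists (s : {perm 'I_n}) (e : 'I_n -> bool), forall i,
  [/\ ctr b i = ctr a (s i), rad b i = rad a (s i) &
      nml b i = (-1) ^+ e i *: nml a (s i)].
Proof.
move=> /forgetP ab.
have /choice[s sE] : forall i, exists j, ring_of (val b 0 i) = ring_of (val a 0 j).
  move=> i; have : rings a (ring_of (val b 0 i)) by rewrite ab; exists i.
  by case=> j _ <-; exists j.
have s_inj : injective s.
  by move=> i j ij; apply: (@ring_of_inj _ _ b) => /=; rewrite !sE ij.
have /choice[e eE] : forall i, exists e : bool,
    [/\ ctr b i = ctr a (s i), rad b i = rad a (s i) &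
        nml b i = (-1) ^+ e *: nml a (s i)].
  move=> i; have [c r [N|N]] := circle_eq (rad_gt0 b i) (rad_gt0 a (s i))
    (nml_unit b i) (nml_unit a (s i)) (sE i).
    by exists false; rewrite scale1r.
  by exists true; rewrite scaleN1r.
by exists (perm s_inj), e => i; rewrite permE.
Qed.

Lemma relabel a (s : {perm 'I_n}) (e : 'I_n -> bool) : exists b, forget b = forget a /\
  forall i, [/\ ctr b i = ctr a (s i), rad b i = rad a (s i) &
                nml b i = (-1) ^+ e i *: nml a (s i)].
Proof.
pose m : 'rV[@ring_data R]_n :=
  \row_i (ctr a (s i), rad a (s i), (-1) ^+ e i *: nml a (s i)).
have mE i : ring_of (m 0 i) = ring_of (val a 0 (s i)).
  by rewrite mxE [LHS]circle_sign.
have m_config : is_config m.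
  split=> [i|i|i j ij].
  - by rewrite mxE; exact: rad_gt0.
  - by rewrite mxE /= dotpZl dotpZr nml_unit mulr1 -expr2 sqrr_sign.
  - rewrite !mE; have [_ _] := config_is a; apply.
    by rewrite (inj_eq perm_inj).
exists (SigSub (mem_set m_config)); split; last by move=> i; rewrite /ctr /rad /nml /= mxE.
apply/forgetP/seteqP; split=> C [i _ <-].
  by exists (s i) => //=; rewrite mE.
by exists ((s^-1)%g i) => //=; rewrite mE permKV.
Qed.

Definition odist a b : R := \sum_i
  (nrm (ctr a i - ctr b i) + `|rad a i - rad b i| + nrm (nml a i - nml b i)).

Lemma odist_term a b i :
  nrm (ctr a i - ctr b i) + `|rad a i - rad b i| + nrm (nml a i - nml b i) <= odist a b.
Proof.
rewrite /odist (bigD1 i)//= lerDl sumr_ge0// => j _.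
by rewrite !addr_ge0 ?nrm_ge0.
Qed.

Lemma odistC a b : odist a b = odist b a.
Proof.
apply: eq_bigr => i _.
by rewrite (nrm_distC (ctr a i)) distrC (nrm_distC (nml a i)).
Qed.

Lemma odist_triangle b a c : odist a c <= odist a b + odist b c.
Proof.
rewrite /odist -big_split; apply: ler_sum => i _ /=.
have := nrm_triangle (ctr b i) (ctr a i) (ctr c i).
have := nrm_triangle (nml b i) (nml a i) (nml c i).
have := ler_distD (rad b i) (rad a i) (rad c i); lra.
Qed.

Lemma odist_refl a : odist a a = 0.
Proof. by apply: big1 => i _; rewrite !subrr nrm0 normr0 !addr0. Qed.

Lemma odist_cts a : continuous (odist a).
Proof.
apply: cts_sum => i; cts; by [exact: cts_ctr|exact: cts_rad|exact: cts_nml].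
Qed.

(** The same permutation and signs applied to both configurations preserve [odist]. *)
Lemma odist_relabel a a' b : forget a' = forget a ->
  exists2 b', forget b' = forget b & odist a' b' = odist a b.
Proof.
move=> /esym/same_rings_perm[s [e aE]].
have [b' [b'b bE]] := relabel b s e; exists b' => //.
rewrite /odist [RHS](reindex_inj (@perm_inj _ s)); apply: eq_bigr => i _.
have [-> -> ->] := aE i; have [-> -> ->] := bE i; congr (_ + _).
rewrite -scalerBr nrmZ normrX normrN1 expr1n mul1r//.
Qed.

(** A distance below which a representative is unique: renumbering moves the centre and radius of
    some ring by at least this much, and reversing a normal moves it by 2, whence the cap 1. *)
Definition sep a : R :=
  \big[Num.min/1]_i \big[Num.min/1]_j
    if j == i then 1 else nrm (ctr a i - ctr a j) + `|rad a i - rad a j|.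

Lemma sep_ge a (x : R) : x <= 1 -> (forall i j, j != i ->
  x <= nrm (ctr a i - ctr a j) + `|rad a i - rad a j|) -> x <= sep a.
Proof.
move=> x1 h; rewrite /sep; elim/big_ind : _ => //.
  by move=> y z xy xz; rewrite le_min xy.
move=> i _; elim/big_ind : _ => //.
  by move=> y z xy xz; rewrite le_min xy.
by move=> j _; case: ifPn => // /h.
Qed.

Lemma sep_le a i j : j != i -> sep a <= nrm (ctr a i - ctr a j) + `|rad a i - rad a j|.
Proof.
move=> ji; rewrite /sep (bigD1 i)//= ge_min; apply/orP; left.
by rewrite (bigD1 j)//= ge_min (negbTE ji) lexx.
Qed.

Lemma sep_le1 a : sep a <= 1.
Proof.
rewrite /sep; elim/big_rec : _ => // i x _ x1.
by rewrite ge_min x1 orbT.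
Qed.

Lemma sep_relabel a b : forget a = forget b -> sep a = sep b.
Proof.
have half a' b' : forget a' = forget b' -> sep a' <= sep b'.
  move=> /same_rings_perm[s [e sE]]; apply: sep_ge; first exact: sep_le1.
  move=> i j ji; have [-> -> _] := sE i; have [-> -> _] := sE j.
  by apply: sep_le; rewrite (inj_eq perm_inj).
by move=> ab; apply/eqP; rewrite eq_le !half.
Qed.

(** Two rings with the same centre and radius would meet on a common line of their planes through
    the centre. *)
Lemma sep_gt0 a : 0 < sep a.
Proof.
have lmin (x y : R) : 0 < x -> 0 < y -> 0 < Num.min x y by move=> x0 y0; rewrite lt_min x0.
rewrite /sep; elim/big_ind : _ => // i _; elim/big_ind : _ => // j _.
case: ifPn => // ji; rewrite lt_def addr_ge0 ?nrm_ge0// andbT.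
apply/negP; rewrite paddr_eq0 ?nrm_ge0// normr_eq0 subr_eq0 => /andP[/eqP/nrm_eq0 cE /eqP rE].
have [g [gg gi gj]] : exists g, [/\ dotp g g != 0, dotp (nml a i) g = 0 & dotp (nml a j) g = 0].
  have [g [gg gi gj _]] := exists_orthogonal3 (nml_unit a i)
    (dotp0l (crossp (nml a i) (nml a j))).
  by exists g.
have gn : nrm g != 0 by apply: contra gg => /eqP h; rewrite -nrm_sqr h expr0n.
have cE' : ctr a i = ctr a j by apply/eqP; rewrite -subr_eq0 cE.
suff : set0 (ctr a i + (rad a i / nrm g) *: g) by [].
rewrite -(rings_disjoint a (_ : i != j)) 1?eq_sym//.
have e : (rad a i / nrm g) ^+ 2 * dotp g g = rad a i ^+ 2 by rewrite -nrm_sqr; field.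
by split; rewrite ring_ofE /circle /= /sqdist -?cE' -?rE addrAC subrr add0r !dotpZr dotpZl
  ?gi ?gj ?mulr0 mulrA -expr2 e.
Qed.

Lemma sep_cts : continuous sep.
Proof.
apply: cts_bigmin => [|i]; first exact: cts_cst.
apply: cts_bigmin => [|j]; first exact: cts_cst.
case: (j == i); first exact: cts_cst.
by cts; by [exact: cts_ctr|exact: cts_rad].
Qed.

Lemma sep_unique a b : forget a = forget b -> odist a b < sep a -> a = b.
Proof.
move=> /same_rings_perm[s [e sE]] ab.
have s1 i : s i = i.
  apply/eqP/negPn/negP => si; have := sep_le a si; have := odist_term a b i.
  have [-> -> _] := sE i; have := nrm_ge0 (nml a i - nml b i); lra.
apply: ordered_ext => i; have [-> -> ->] := sE i; rewrite s1; split=> //.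
case eE : (e i); last by rewrite scale1r.
have := odist_term a b i; have [-> -> ->] := sE i.
rewrite s1 eE scaleN1r opprK !subrr nrm0 normr0 !add0r.
have -> : nml a i + nml a i = 2 *: nml a i by rewrite scaler_nat mulr2n.
rewrite nrmZ /nrm nml_unit sqrtr1 mulr1 ger0_norm//.
by move=> ?; exfalso; have := sep_le1 a; lra.
Qed.

(* A metric on unordered configurations, presented by its open balls. *)
Definition close (e : R) q q' :=
  exists a b, [/\ forget a = q, forget b = q' & odist a b < e].

Lemma close_rep e q q' a : close e q q' -> forget a = q ->
  exists2 b, forget b = q' & odist a b < e.
Proof.
move=> [a' [b [<- <- ab]]] aa'; have [b' b'b e'] := odist_relabel b aa'.
by exists b' => //; rewrite e'.
Qed.

Lemma closeC e q q' : close e q q' -> close e q' q.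
Proof. by move=> [a [b [aq bq ab]]]; exists b, a; rewrite odistC. Qed.

Lemma close_trans e e' q q' q'' : close e q q' -> close e' q' q'' -> close (e + e') q q''.
Proof.
move=> [a [b [aq bq ab]]] /close_rep/(_ bq)[c cq bc]; exists a, c; split=> //.
by apply: le_lt_trans (odist_triangle b a c) _; lra.
Qed.

(** The preimage of a ball is a union of balls for [odist], because relabelling is isometric; so it
    is open, and the quotient topology applies. *)
Lemma close_near e q : 0 < e -> \forall q' \near q, close e q q'.
Proof.
move=> e0; apply: open_nbhs_nbhs; split; last first.
  by exists (repr q), (repr q); rewrite odist_refl !forget_repr.
suff : open (\bigcup_(a in [set a | forget a = q]) [set b | odist a b < e]).
  rewrite (_ : \bigcup_(a in _) _ = forget @^-1` [set q' | close e q q'])//.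
  apply/seteqP; split=> [b [a aq ab]|b [a [b' [aq b'b ab]]]]; first by exists a, b.
  have [a' a'a e'] := odist_relabel a (esym b'b).
  by exists a'; [rewrite /= a'a|rewrite /= odistC e' odistC].
apply: bigcup_open => a _.
have := @odist_cts a; rewrite continuousP => /(_ [set x | x < e]); apply; exact: open_lt.
Qed.

End relabelling.

Section lifting.
Context {R : realType} {n : nat}.
Local Notation O := (@ordered_config R n).
Local Notation Q := (ring_config R n).
Variable H : R * R -> Q.
Hypothesis H_cts : continuous H.

Let usep (q : Q) : R := sep (repr q).

Lemma usepE (a : O) : usep (forget a) = sep a.
Proof. by apply: sep_relabel; rewrite forget_repr. Qed.

Lemma usep_cts : continuous (usep : Q -> R).
Proof.
apply: (repr_comp_continuous (@sep_cts R n)) => a b /eqP ab; apply/eqP.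
exact: sep_relabel.
Qed.

Definition ray (t : R) (p : R * R) : R * R := (t * p.1, t * p.2).

Lemma ray_cts : continuous (fun q : R * (R * R) => ray q.1 q.2).
Proof.
apply: cts_pair; cts; first [exact: cts_fst
  |exact: (@cts_comp _ _ _ (fun p : R * R => p.1) _ (@cts_fst _ _) (@cts_snd _ _))
  |exact: (@cts_comp _ _ _ (fun p : R * R => p.2) _ (@cts_snd _ _) (@cts_snd _ _))].
Qed.

Let G (q : R * (R * R)) := H (ray q.1 (clamp2 q.2)).

Let G_cts : continuous G.
Proof.
apply: (cts_comp H_cts).
have : continuous (fun q : R * (R * R) => (q.1, clamp2 q.2)).
  apply: cts_pair; first exact: cts_fst.
  exact: (@cts_comp _ _ _ (@clamp2 R) _ (@clamp2_continuous R) (@cts_snd _ _)).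
by move=> h; exact: (@cts_comp _ _ _ (fun q : R * (R * R) => ray q.1 q.2) _ ray_cts h).
Qed.

Let K : set (R * (R * R)) := `[0, 1]%classic `*` (`[0, 1]%classic `*` `[0, 1]%classic).

Let K_compact : compact K.
Proof. by do 2?apply: compact_setX; exact: segment_compact. Qed.

Let K_in t p : 0 <= t <= 1 -> K (t, clamp2 p).
Proof. by move=> t01; split; [rewrite /= in_itv|exact: clamp2_itv]. Qed.

Let G_clamp t p : G (t, clamp2 p) = G (t, p).
Proof. by rewrite /G /clamp2 /= !clampK. Qed.

(** Uniform continuity in the radial parameter, from compactness of the family of rays. *)
Lemma uniform_step (e : R) : 0 < e -> exists2 d : R, 0 < d &
  forall t p h, 0 <= t <= 1 -> 0 <= h < d -> close e (G (t, p)) (G (t + h, p)).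
Proof.
move=> e0.
have : \forall h \near (0 : R), K `<=` (fun q => close e (G q) (G (q.1 + h, q.2))).
  apply: ((compact_near_coveringP K).1 K_compact R (nbhs (0 : R))
    (fun h q => close e (G q) (G (q.1 + h, q.2))) _) => -[t p] _.
  have e20 : 0 < e / 2 by rewrite divr_gt0.
  have sh_cts : continuous (fun x : (R * (R * R)) * R => (x.1.1 + x.2, x.1.2)).
    apply: cts_pair; last first.
      exact: (@cts_comp _ _ _ (fun q : R * (R * R) => q.2) _ (@cts_snd _ _) (@cts_fst _ _)).
    cts; last exact: cts_snd.
    exact: (@cts_comp _ _ _ (fun q : R * (R * R) => q.1) _ (@cts_fst _ _) (@cts_fst _ _)).
  have near_G (f : (R * (R * R)) * R -> R * (R * R)) : continuous f -> f ((t, p), 0) = (t, p) ->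
      \forall x \near ((t, p), 0 : R), close (e / 2) (G (t, p)) (G (f x)).
    move=> cf f0; have cGf := cts_comp G_cts cf.
    have : nbhs (G (f ((t, p), 0))) [set q | close (e / 2) (G (t, p)) q].
      by rewrite f0; exact: close_near.
    by move/(cGf ((t, p), 0)).
  have n1 := near_G _ (@cts_fst _ _) erefl.
  have n2 := near_G _ sh_cts (congr1 (pair^~ p) (addr0 t)).
  have := filterI n1 n2; case=> -[A B] /= [tA hB] AB.
  exists (A, B) => //= -[q h] [/= Aq Bh].
  have [/= c1 c2] := AB (q, h) (conj Aq Bh).
  have -> : e = e / 2 + e / 2 by field.
  exact: close_trans (closeC c1) c2.
move=> /nbhs_ballP[d /= d0 hd]; exists d => // t p h t01 /andP[h0 hd'].
have := hd h; rewrite /ball /= sub0r normrN ger0_norm// => /(_ hd') => /(_ (t, clamp2 p)).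
by move=> /(_ (K_in p t01)); rewrite /= !G_clamp.
Qed.

Definition lifts (a : R * R -> O) (t : R) := 
  [/\ forall p, forget (a p) = G (t, p),
      forall p e, 0 < e -> \forall p' \near p, odist (a p) (a p') < e &
      forall p, a (clamp2 p) = a p].

(** The lift [b p] within [e] of [a p] is the only one within [3 * e], as [sep] is at least [4 * e].
    Uniqueness gives continuity: a lift near [b p] over a nearby point must be the chosen one. *)
Lemma lift_step e t t' a : 0 < e -> (forall p, 4 * e <= usep (G (t', p))) ->
  (forall p, close e (G (t, p)) (G (t', p))) -> lifts a t ->
  exists2 b, lifts b t' & forget (a (0, 0)) = G (t', (0, 0)) -> b (0, 0) = a (0, 0).
Proof.
move=> e0 wide step [aG a_cts a_clamp].
have /choice[b bP] : forall p, exists x, forget x = G (t', p) /\ odist (a p) x < e.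
  by move=> p; have [x] := close_rep (step p) (aG p); exists x.
have uniq p x : forget x = G (t', p) -> odist (a p) x < 3 * e -> x = b p.
  have [bG ab] := bP p => xG ax; apply/esym/sep_unique; first by rewrite xG.
  rewrite -usepE bG; apply: lt_le_trans (wide p).
  have := odist_triangle (a p) (b p) x; rewrite (odistC (b p) (a p)); lra.
exists b; last first.
  by move=> h; apply/esym/uniq => //; rewrite odist_refl mulr_gt0.
split=> [p|p e1 e10|p]; first by case: (bP p).
- pose e2 := Num.min e1 e; have e20 : 0 < e2 by rewrite lt_min e10.
  have cGp : continuous (fun p' => G (t', p')).
    by apply: (cts_comp G_cts); apply: cts_pair; [exact: cts_cst|exact: cts_id].
  have n1 : \forall p' \near p, close e2 (G (t', p)) (G (t', p')).
    have : nbhs (G (t', p)) [set q | close e2 (G (t', p)) q] by exact: close_near.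
    by move/(cGp p).
  apply: filterS2 n1 (a_cts p e e0) => p' c1 aa'.
  have [x xG bx] := close_rep c1 (bP p).1.
  have bx1 : odist (b p) x < e1 by apply: lt_le_trans bx _; rewrite ge_min lexx.
  have bx2 : odist (b p) x < e by apply: lt_le_trans bx _; rewrite ge_min lexx orbT.
  rewrite -(uniq p' x)//.
  have := odist_triangle (a p) (a p') x; have := odist_triangle (b p) (a p) x.
  have := (bP p).2; rewrite (odistC (a p') (a p)); lra.
- have [h1 h2] := bP (clamp2 p); apply: uniq; first by rewrite h1 G_clamp.
  by move: h2; rewrite a_clamp; lra.
Qed.

(** The homotopy is lifted along all rays from the corner at once, in [N] short steps, starting from
    the constant lift. The point [(0, 0)] is fixed by the rays, so its lift never changes. *)
Theorem lift_square (alpha : O) : forget alpha = H (0, 0) -> exists a : R * R -> O,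
  [/\ forall p, forget (a p) = H (clamp2 p), a (0, 0) = alpha,
      forall p e, 0 < e -> \forall p' \near p, odist (a p) (a p') < e &
      forall p, a (clamp2 p) = a p].
Proof.
move=> alphaE.
have [e e0 wide] := compact_positive_min K_compact (cts_comp usep_cts G_cts)
  (fun q _ => sep_gt0 (repr (G q) : O)).
have {}wide t p : 0 <= t <= 1 -> e <= usep (G (t, p)).
  by move=> t01; rewrite -G_clamp; apply: wide; exact: K_in.
have e40 : 0 < e / 4 by rewrite divr_gt0.
have [d d0 step] := uniform_step e40.
pose N := Num.bound d^-1.
have Nd : d^-1 < N%:R by rewrite archi_boundP// invr_ge0 ltW.
have N0 : 0 < N%:R :> R by rewrite (lt_trans _ Nd)// invr_gt0.
have hd : N%:R^-1 < d by rewrite -(invrK d) ltf_pV2// posrE invr_gt0.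
have base (t : R) : G (t, (0, 0)) = H (0, 0).
  by rewrite /G /ray /clamp2 /= clampE ?lexx ?ler01// mulr0.
have main (k : nat) : (k <= N)%N -> exists2 a, lifts a (k%:R / N%:R) & a (0, 0) = alpha.
  elim: k => [_|k IH kN].
    exists (fun=> alpha) => //; split=> // [p|p e1 e10].
      by rewrite /G /ray /= !mul0r.
    by apply: (@filterS _ _ (nbhs_filter p) setT) => [p'|]; [rewrite odist_refl|exact: (@filterT _ _ (nbhs_filter p))].
  have [a la a0] := IH (ltnW kN).
  have k01 : 0 <= (k%:R / N%:R : R) <= 1.
    by apply/andP; split; [rewrite divr_ge0|rewrite (ler_pdivrMr _ _ N0) mul1r ler_nat ltnW].
  have k01' : 0 <= (k.+1%:R / N%:R : R) <= 1.
    by apply/andP; split; [rewrite divr_ge0|rewrite (ler_pdivrMr _ _ N0) mul1r ler_nat].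
  have kE : k.+1%:R / N%:R = k%:R / N%:R + N%:R^-1 :> R.
    by rewrite -natr1 mulrDl mul1r.
  have [||b lb hb] := @lift_step (e / 4) (k%:R / N%:R) (k.+1%:R / N%:R) a e40 _ _ la.
  - by move=> p; rewrite mulrC divfK//; exact: wide.
  - by move=> p; rewrite kE; apply: step => //; rewrite invr_ge0 ltW.
  by exists b => //; rewrite hb a0// base.
have [a] := main N (leqnn N); rewrite divff ?gt_eqF// => -[aG a_cts a_clamp] a0.
by exists a; split=> // p; rewrite aG /G /ray /= !mul1r; case: (p).
Qed.

End lifting.

Section locally_constant.
Context {R : realType}.

Lemma locally_constant (X : Type) (f : R -> X) :
  (forall u, \forall v \near u, f v = f u) -> forall u v, f u = f v.
Proof.
move=> lc u v.
have RC : connected [set: R] by apply/connected_intervalP.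
pose A := [set w | f w = f v].
have A_open : open A.
  by rewrite openE => w wA; apply: filterS (lc w) => w'; rewrite /A /= wA.
have A_closed : closed A.
  rewrite -[A]setCK; apply: open_closedC; rewrite openE => w wA.
  by apply: filterS (lc w) => w' ww' w'A; apply: wA; rewrite /A /= -ww'.
have A_full : A = [set: R].
  apply: RC; first by exists v.
    by exists A => //; rewrite setTI.
  by exists A => //; rewrite setTI.
by have : A u by rewrite A_full.
Qed.

Lemma constant_sign m (f : R -> 'rV[R]_m) (x : 'rV[R]_m) : dotp x x = 1 -> continuous f ->
  (forall u, f u = x \/ f u = - x) -> forall u v, f u = f v.
Proof.
move=> x1 f_cts fx; apply: locally_constant => u.
have d_cts : continuous (fun v => dotp (f v) (f u)) by cts; exact: cts_cst.
have fu : dotp (f u) (f u) = 1 by case: (fx u) => ->; rewrite ?dotpNl ?dotpNr ?opprK.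
have : nbhs (dotp (f u) (f u)) [set y | 0 < y].
  by apply: open_nbhs_nbhs; split; [exact: open_gt|rewrite /= fu].
move/(d_cts u) => h; have {}h : \forall v \near u, 0 < dotp (f v) (f u) by exact: h.
apply: filterS h => v.
case: (fx u) (fx v) => -> [] -> //; rewrite ?dotpNl ?dotpNr x1 => h; exfalso; lra.
Qed.

Lemma constant_lift n (a : R * R -> @ordered_config R n) (l : R -> R * R) c :
  (forall p e, 0 < e -> \forall p' \near p, odist (a p) (a p') < e) ->
  continuous l -> (forall u, forget (a (l u)) = c) -> forall u v, a (l u) = a (l v).
Proof.
move=> a_cts l_cts alc; apply: (locally_constant (f := fun u => a (l u))) => u.
have : nbhs (l u) [set p' | odist (a (l u)) (a p') < sep (a (l u))].
  by apply: a_cts; exact: sep_gt0.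
move/(l_cts u) => h.
have {}h : \forall v \near u, odist (a (l u)) (a (l v)) < sep (a (l u)) by exact: h.
apply: filterS h => v h.
by apply/esym/sep_unique => //; rewrite !alc.
Qed.

Lemma lift_coordinates_cts n (a : R * R -> @ordered_config R n) i :
  (forall p e, 0 < e -> \forall p' \near p, odist (a p) (a p') < e) ->
  [/\ continuous (fun p => ctr (a p) i), continuous (fun p => rad (a p) i) &
      continuous (fun p => nml (a p) i)].
Proof.
move=> a_cts.
have cmp p p' e : odist (a p) (a p') < e ->
  [/\ nrm (ctr (a p) i - ctr (a p') i) < e, `|rad (a p) i - rad (a p') i| < e &
      nrm (nml (a p) i - nml (a p') i) < e].
  move=> h; have := odist_term (a p) (a p') i.
  have := nrm_ge0 (ctr (a p) i - ctr (a p') i).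
  have := nrm_ge0 (nml (a p) i - nml (a p') i).
  have := normr_ge0 (rad (a p) i - rad (a p') i).
  by move=> ? ? ? ?; split; lra.
have vec m (f : R * R -> 'rV[R]_m) :
    (forall p p' e, odist (a p) (a p') < e -> nrm (f p - f p') < e) -> continuous f.
  move=> hf; apply: cts_row => j p; apply/cvgrPdist_lt => e e0.
  apply: filterS (a_cts p e e0) => p' /hf; apply: le_lt_trans.
  by have := coord_le_nrm (f p - f p') j; rewrite !mxE.
split.
- by apply: vec => p p' e /cmp[].
- move=> p; apply/cvgrPdist_lt => e e0.
  by apply: filterS (a_cts p e e0) => p' /cmp[].
- by apply: vec => p p' e /cmp[].
Qed.

End locally_constant.

(** * Spaces of parallel rings *)

Section parallel_circles.
Context {R : realType}.
Implicit Types (c d y : 'rV[R]_3) (r s : R).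

Lemma parallel_circles_meet c d r s : 0 < r -> 0 < s -> c 0 0 = d 0 0 ->
  `|r - s| <= nrm (d - c) -> nrm (d - c) <= r + s ->
  exists y, circle c r ex y /\ circle d s ex y.
Proof.
move=> r0 s0 cd; pose w := d - c; rewrite -/w; set D := nrm w.
have w0 : w 0 0 = 0 by rewrite !mxE cd subrr.
have dE : d = c + w by rewrite addrC subrK.
clearbody w; have [Dz|Dn] := eqVneq D 0.
  rewrite Dz normr_le0 subr_eq0 => /eqP <- _.
  have -> : d = c by rewrite dE (nrm_eq0 Dz) addr0.
  by have [y] := circle_point c r ex; exists y.
move=> h1 h2; have D0 : 0 < D by rewrite lt_def Dn nrm_ge0.
have D2 : D ^+ 2 = w 0 1 ^+ 2 + w 0 2 ^+ 2.
  by rewrite nrm_sqr dotp3 w0 mulr0 add0r -!expr2.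
(* The intersection point [c + p] in coordinates along [w] and orthogonally to it: [a] locates the
   radical line, and [b] follows from Pythagoras. *)
pose a := (D ^+ 2 + r ^+ 2 - s ^+ 2) / (2 * D ^+ 2).
have b0 : 0 <= r ^+ 2 / D ^+ 2 - a ^+ 2.
  have -> : r ^+ 2 / D ^+ 2 - a ^+ 2 =
      ((s ^+ 2 - (D - r) ^+ 2) * ((D + r) ^+ 2 - s ^+ 2)) / (2 * D ^+ 2) ^+ 2.
    by rewrite /a; field.
  rewrite divr_ge0 ?sqr_ge0// mulr_ge0//.
    by move: h1; rewrite ler_norml => /andP[]; nra.
  by move: h1; rewrite ler_norml => /andP[]; nra.
pose b := Num.sqrt (r ^+ 2 / D ^+ 2 - a ^+ 2).
have b2 : b ^+ 2 = r ^+ 2 / D ^+ 2 - a ^+ 2 by rewrite sqr_sqrtr.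
pose p := a *: w + b *: vec3 0 (- w 0 2) (w 0 1).
have p0 : p 0 0 = 0 by rewrite !mxE w0 /= !mulr0 addr0.
have pp : dotp p p = r ^+ 2.
  have -> : dotp p p = (a ^+ 2 + b ^+ 2) * D ^+ 2.
    by rewrite D2 dotp3 !mxE w0 /=; ring.
  by rewrite b2; field.
have pw : dotp p w = a * D ^+ 2 by rewrite D2 dotp3 !mxE w0 /=; ring.
clearbody p; exists (c + p); rewrite /circle /= /sqdist !dotp_ex addrAC subrr add0r.
have -> : c + p - d = p - w by rewrite dE opprD addrACA subrr add0r.
rewrite dotpBl !dotpBr (dotpC w p) pw pp -nrm_sqr -/D mxE p0.
rewrite [(- w) 0 0]mxE w0 oppr0 addr0; split=> //; split=> //.
by rewrite /a; field.
Qed.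

(** A disk with fixed boundary in the plane, bulging out of it along the first axis: flat for
    [k = 0], off the plane at every interior point for [k = 1]. *)
Definition cap c r (k : R) (z : 'rV[R]_2) : 'rV[R]_3 :=
  vec3 (c 0 0 + k * (1 - dotp z z)) (c 0 1 + r * z 0 0) (c 0 2 + r * z 0 1).

Lemma dotp2 (z : 'rV[R]_2) : dotp z z = z 0 0 ^+ 2 + z 0 1 ^+ 2.
Proof. by rewrite /dotp !big_ord_recl big_ord0 addr0 -!expr2; congr (_ + z _ _ ^+ 2); apply: val_inj. Qed.

Lemma cap_spanning c r k : 0 < r -> spanning_disk (cap c r k) (circle c r ex).
Proof.
move=> r0; have rn : r != 0 by rewrite gt_eqF.
split.
- apply: continuous_subspaceT; rewrite /cap; cts; exact: cts_id.
- move=> z z' _ _ e; apply/rowP => i.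
  have e1 : z 0 0 = z' 0 0.
    move: (congr1 (fun y : 'rV[R]_3 => y 0 1) e); rewrite /cap !vec3E => h.
    by apply: (mulfI rn); lra.
  have e2 : z 0 1 = z' 0 1.
    move: (congr1 (fun y : 'rV[R]_3 => y 0 2) e); rewrite /cap !vec3E => h.
    by apply: (mulfI rn); lra.
  case: i => -[|[|i]] hi //.
    by rewrite (_ : Ordinal hi = 0)//; apply: val_inj.
  by rewrite (_ : Ordinal hi = 1)//; apply: val_inj.
- apply/seteqP; split=> [_ [z z1 <-]|y [yr]].
    rewrite /unit_circle /= dotp2 in z1.
    rewrite /circle /= /sqdist dotp_ex dotp3 /cap !mxE /= dotp2 z1; split; last by ring.
    by rewrite subrr mulr0 addr0 subrr mul0r add0r !(addrC (c _ _)) !addrK -[in RHS](mulr1 (r ^+ 2)) -z1; ring.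
  rewrite dotp_ex !mxE => y0.
  pose z : 'rV[R]_2 := \row_i (if i == 0 then (y 0 1 - c 0 1) / r else (y 0 2 - c 0 2) / r).
  have z1 : dotp z z = 1.
    move: yr; rewrite dotp2 /sqdist dotp3 !mxE /= y0 mul0r add0r => yr.
    rewrite !expr_div_n -mulrDl !expr2 yr -expr2 divff// expf_neq0//.
  exists z => //; apply: row3P; rewrite /cap vec3E.
  - by rewrite z1 subrr mulr0 addr0; lra.
  - by rewrite mxE /=; field.
  - by rewrite mxE /=; field.
Qed.

(* Two disjoint circles of the same plane either bound disjoint disks, or one of
   them lies inside the other, whose disk is then bulged out of the plane. *)
Lemma parallel_unlinked c d r s : 0 < r -> 0 < s ->
  circle c r ex `&` circle d s ex = set0 -> unlinked (circle c r ex) (circle d s ex).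
Proof.
move=> r0 s0 dj.
have cap_in x t k z : 0 < t -> unit_disk z -> cap x t k z 0 0 = x 0 0 ->
    nrm (cap x t k z - x) <= t.
  rewrite /unit_disk /= dotp2 => t0 z1 e.
  rewrite -(ler_pXn2r (_ : (0 < 2)%N)) ?nnegrE ?nrm_ge0 ?(ltW t0)// nrm_sqr dotp3 !mxE /=.
  move: e; rewrite /cap vec3E => ->; rewrite subrr mul0r add0r.
  rewrite !(addrC (x _ _)) !addrK.
  have -> : t * z 0 0 * (t * z 0 0) + t * z 0 1 * (t * z 0 1) = t ^+ 2 * (z 0 0 ^+ 2 + z 0 1 ^+ 2) by ring.
  by have := ler_wpM2l (sqr_ge0 t) z1; rewrite mulr1.
have bulge x y t u : 0 < t -> 0 < u ->
    (forall p, circle x t ex p -> nrm (p - y) <= u -> False) -> x 0 0 = y 0 0 ->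
    cap x t 1 @` unit_disk `&` cap y u 0 @` unit_disk = set0.
  move=> t0 u0 h xy; apply/seteqP; split=> // p [[z zd <-] [z' z'd e]].
  have e0 : cap x t 1 z 0 0 = x 0 0 by rewrite -e /cap !vec3E mul0r addr0 xy.
  apply: (h (cap x t 1 z)); last first.
    by rewrite -e; apply: cap_in => //; rewrite e e0 xy.
  have [_ _ <-] := cap_spanning x 1 t0; exists z => //.
  by move: e0; rewrite /unit_circle /= /cap !vec3E; lra.
have [cd|cd] := eqVneq (c 0 0) (d 0 0); last first.
  exists (cap c r 0), (cap d s 0); split; do ?[exact: cap_spanning].
  apply/seteqP; split=> // p [[z zd <-] [z' z'd e]].
  move: (congr1 (fun y : 'rV[R]_3 => y 0 0) e); rewrite /cap !vec3E !mul0r !addr0 => e0.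
  by rewrite e0 eqxx in cd.
have [far|near] := ltrP (r + s) (nrm (d - c)).
  exists (cap c r 0), (cap d s 0); split; do ?[exact: cap_spanning].
  apply/seteqP; split=> // p [[z zd zp] [z' z'd z'p]].
  have h1 : nrm (p - c) <= r by rewrite -zp; apply: cap_in => //; rewrite /cap vec3E mul0r addr0.
  have h2 : nrm (p - d) <= s by rewrite -z'p; apply: cap_in => //; rewrite /cap vec3E mul0r addr0.
  have := nrm_triangle p d c; rewrite (nrm_distC d p); lra.
have [rs|rs] := ltrP (nrm (d - c)) `|r - s|; last first.
  have [y [yc yd]] := parallel_circles_meet r0 s0 cd rs near.
  by have : set0 y by rewrite -dj.
have [sr|sr] := lerP s r.
- exists (cap c r 1), (cap d s 0); split; do ?[exact: cap_spanning].
  apply: bulge => // p /(circleP _ _ _ (ltW r0))[pc _] pd.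
  rewrite ger0_norm ?subr_ge0// in rs.
  have := nrm_triangle d p c; lra.
- exists (cap c r 0), (cap d s 1); split; do ?[exact: cap_spanning].
  rewrite setIC; apply: bulge => // p /(circleP _ _ _ (ltW s0))[pd _] pc.
  rewrite ltr0_norm ?subr_lt0// in rs.
  have := nrm_triangle c p d; rewrite (nrm_distC c d); lra.
Qed.

End parallel_circles.

Section shapes.
Context {R : realType}.
Implicit Types (c N u v : 'rV[R]_3) (r : R).

Lemma circle_in_plane c r N v d : 0 < r -> circle c r N `<=` plane v d ->
  forall u, dotp u u = 1 -> dotp N u = 0 -> dotp v u = 0.
Proof.
move=> r0 h u u1 Nu; have [/h + /h] := circle_diameter c r u1 Nu.
rewrite /plane /= dotpDr dotpBr dotpZr => h1 h2.
by apply: (mulfI (lt0r_neq0 r0)); lra.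
Qed.

Lemma parallel_to_yz_circle c r N : 0 < r -> dotp N N = 1 ->
  parallel_to_yz (circle c r N) <-> N = ex \/ N = - ex.
Proof.
move=> r0 N1; split=> [[a h]|NE].
  apply: parallel_sign => //; first exact: ex_unit.
  apply: parallel_of_orthogonal => // u u1 Nu.
  apply: (@circle_in_plane c r N _ a) => // y /h /= ya.
  by rewrite /plane /= dotp_ex.
exists (c 0 0) => y [_ yN]; have : dotp ex (y - c) = 0.
  by case: NE yN => -> //; rewrite dotpNl => /eqP; rewrite oppr_eq0 => /eqP.
by rewrite dotp_ex !mxE /=; lra.
Qed.

Lemma vertical_circle c r N : 0 < r -> dotp N N = 1 ->
  vertical (circle c r N) -> N 0 2 = 0.
Proof.
move=> r0 N1 [v [d [v0 v2 h]]].
have vN := parallel_of_orthogonal N1 (circle_in_plane r0 h).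
move: v2 v0; rewrite vN mxE => /eqP; rewrite mulf_eq0 => /orP[/eqP ->|/eqP//].
by rewrite scale0r eqxx.
Qed.

Lemma antipodal c r N y y' : circle c r N y -> circle c r N y' ->
  sqdist y y' = (2 * r) ^+ 2 -> y + y' = 2 *: c.
Proof.
move=> [yr _] [y'r _]; rewrite /sqdist in yr y'r *.
have -> : y - y' = (y - c) - (y' - c) by rewrite opprB addrA subrK.
have -> : y = (y - c) + c by rewrite subrK.
have -> : y' = (y' - c) + c by rewrite subrK.
rewrite !addrK; move: (y - c) (y' - c) yr y'r => p p' pr p'r.
rewrite !dotpE pr p'r (dotpC p' p) => h.
have /nrm_eq0 pp : nrm (p + p') = 0.
  by rewrite /nrm !dotpE pr p'r (dotpC p' p) -(sqrtr0 R); congr Num.sqrt; lra.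
by rewrite addrACA pp add0r scaler_nat mulr2n.
Qed.

(** If the centre were off the xy-plane, the ends of the horizontal diameter would both lie on one
    side. The isometry, or its inverse, takes them to antipodal points on the other side, whose
    midpoint would again be the centre. *)
Lemma halved_center c r N : 0 < r -> dotp N N = 1 -> N 0 2 = 0 ->
  halved_by_xy (circle c r N) -> c 0 2 = 0.
Proof.
move=> r0 N1 N2 [h [h_iso h_img]].
pose u := vec3 (- N 0 1) (N 0 0) 0.
have u1 : dotp u u = 1 by rewrite -N1 !dotp3 /u !vec3E N2; ring.
have Nu : dotp N u = 0 by rewrite dotp3 /u !vec3E; ring.
have [yp ym] := circle_diameter c r u1 Nu.
have yp2 : (c + r *: u) 0 2 = c 0 2 by rewrite !mxE /= mulr0 addr0.
have ym2 : (c - r *: u) 0 2 = c 0 2 by rewrite !mxE /= mulr0 subr0.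
have far : sqdist (c + r *: u) (c - r *: u) = (2 * r) ^+ 2.
  have -> : sqdist (c + r *: u) (c - r *: u) = dotp ((2 * r) *: u) ((2 * r) *: u).
    by rewrite /sqdist opprB addrC addrA subrK -scalerDl; congr dotp; congr (_ *: _); ring.
  by rewrite dotpZl dotpZr u1 mulr1 expr2.
have sum2 y y' : circle c r N y -> circle c r N y' -> sqdist y y' = (2 * r) ^+ 2 ->
    y 0 2 + y' 0 2 = 2 * c 0 2.
  move=> yC y'C /(antipodal yC y'C) e.
  by move: (congr1 (fun z : 'rV[R]_3 => z 0 2) e); rewrite !mxE.
have [c0|c0|//] := ltgtP (c 0 2) 0.
- have low z : circle c r N z -> z 0 2 = c 0 2 ->
      exists2 p, circle c r N p /\ 0 <= p 0 2 & h p = z.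
    move=> zC z2; have : (circle c r N `&` [set p | p 0 2 <= 0]) z.
      by split=> //=; rewrite z2 ltW.
    by rewrite -h_img => -[p [pC p0] <-]; exists p.
  have [p [pC p0] hp] := low _ yp yp2; have [q [qC q0] hq] := low _ ym ym2.
  have := sum2 p q pC qC; rewrite -h_iso hp hq => /(_ far); lra.
- have up z : circle c r N z -> z 0 2 = c 0 2 ->
      circle c r N (h z) /\ h z 0 2 <= 0.
    move=> zC z2; suff : (circle c r N `&` [set p | p 0 2 <= 0]) (h z) by [].
    by rewrite -h_img; exists z => //; split=> //=; rewrite z2 ltW.
  have [pC p0] := up _ yp yp2; have [qC q0] := up _ ym ym2.
  have := sum2 _ _ pC qC; rewrite h_iso => /(_ far); lra.
Qed.

Lemma halved_flat c r : c 0 2 = 0 -> halved_by_xy (circle c r ex).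
Proof.
move=> c2; pose h (p : 'rV[R]_3) := vec3 (p 0 0) (p 0 1) (- p 0 2).
have h_iso p q : sqdist (h p) (h q) = sqdist p q.
  by rewrite /sqdist !dotp3 !mxE /=; ring.
have hh p : h (h p) = p by apply: row3P; rewrite !vec3E ?opprK.
have hc : h c = c by apply: row3P; rewrite !vec3E // c2 oppr0.
have hC p : circle c r ex p -> circle c r ex (h p).
  move=> [pr]; rewrite !dotp_ex => p0; split; first by rewrite -pr -[in LHS]hc h_iso.
  by rewrite dotp_ex; move: p0; rewrite !mxE.
exists h; split=> //; apply/seteqP; split=> [_ [p [pC p0] <-]|p [pC p0]].
  by split; [exact: hC|rewrite /= vec3E oppr_le0].
by exists (h p) => //; split; [exact: hC|rewrite /= vec3E oppr_ge0].
Qed.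

Lemma vertical_ex c r : vertical (circle c r ex : set 'rV[R]_3).
Proof.
exists ex, (c 0 0); split.
- apply/eqP => e0; have := ex_unit (R := R); rewrite e0 dotp0l.
  by move/eqP; rewrite eq_sym oner_eq0.
- by rewrite vec3E.
- move=> y [_]; rewrite /plane /= !dotp_ex !mxE /=; lra.
Qed.

End shapes.

Section spaces_of_parallel_rings.
Context {R : realType} {n : nat}.
Local Notation O := (@ordered_config R n).
Local Notation Q := (ring_config R n).
Implicit Types (a : O) (q : Q).

Lemma rings_sub a (P : set (set 'rV[R]_3)) :
  rings_of (forget a) `<=` P <-> forall i, P (circle (ctr a i) (rad a i) (nml a i)).
Proof.
rewrite rings_of_pi; split=> [h i|h _ [i _ <-]]; last exact: h.
by apply: h; exists i.
Qed.

Lemma in_UR a : UR R n (forget a) <-> forall i, nml a i = ex \/ nml a i = - ex.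
Proof.
rewrite /UR /= rings_sub; split=> h i.
  by apply/(parallel_to_yz_circle (ctr a i) (rad_gt0 a i) (nml_unit a i)); exact: h.
by apply/(parallel_to_yz_circle (ctr a i) (rad_gt0 a i) (nml_unit a i)); exact: h.
Qed.

Lemma in_W a : W R n (forget a) -> forall i, ctr a i 0 2 = 0 /\ nml a i 0 2 = 0.
Proof.
rewrite /W /= rings_sub => h i; have [v hv] := h i.
have N2 := vertical_circle (rad_gt0 a i) (nml_unit a i) v.
by split=> //; exact: halved_center (rad_gt0 a i) (nml_unit a i) N2 hv.
Qed.

Lemma in_UW a : UW R n (forget a) <->
  forall i, (nml a i = ex \/ nml a i = - ex) /\ ctr a i 0 2 = 0.
Proof.
split=> [[/in_W aW /in_UR aU] i|h]; first by have [] := aW i.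
split; last by apply/in_UR => i; have [] := h i.
rewrite /W /= rings_sub => i; have [N c0] := h i.
have -> : circle (ctr a i) (rad a i) (nml a i) = circle (ctr a i) (rad a i) ex.
  by case: N => ->; rewrite ?circleN.
by split; [exact: vertical_ex|exact: halved_flat].
Qed.

Lemma cts_set_type (T X : topologicalType) (A : set X) (f : T -> A) :
  continuous (fun t => set_val (f t)) -> continuous f.
Proof.
move=> cf; apply/continuousP => _ [W oW <-].
by move/continuousP: cf => /(_ _ oW).
Qed.

(* The case of UW in W for [planar] true, of UR in VR or R_n for [planar] false. *)
Theorem parallel_loops_homotopic (planar : Prop) (S : set Q) (c : S) (f g : loop R c)
    (H : R * R -> Q) : (0 < n)%N ->
  (forall a, S (forget a) <->
     forall i, (nml a i = ex \/ nml a i = - ex) /\ (planar -> ctr a i 0 2 = 0)) ->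
  continuous H ->
  (forall s, H (s, 0) = set_val (f (clamp s))) ->
  (forall s, H (s, 1) = set_val (g (clamp s))) ->
  (forall t, H (0, t) = set_val c /\ H (1, t) = set_val c) ->
  (forall p a, planar -> forget a = H p -> forall i, ctr a i 0 2 = 0 /\ nml a i 0 2 = 0) ->
  loop_homotopic f g.
Proof.
move=> n0 S_E H_cts Hf Hg Hc H_flat.
(* The normals at the base point are [ex] up to sign; the signs are corrected. *)
have [alpha [alphaE alphaN]] : exists alpha : O, forget alpha = H (0, 0) /\
    forall i, nml alpha i = ex.
  have /S_E aS : S (forget (repr (set_val c))) by rewrite forget_repr; exact: set_valP.
  have [alpha [e1 e2]] := relabel (repr (set_val c) : O) 1%g
    (fun i => nml (repr (set_val c) : O) i != ex).
  exists alpha; split=> [|i]; first by rewrite e1 forget_repr (Hc 0).1.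
  have [_ _ ->] := e2 i; rewrite perm1; have [[->|NE] _] := aS i.
    by rewrite eqxx scale1r.
  case: eqVneq => [->|_]; first by rewrite scale1r.
  by rewrite NE scaleN1r opprK.
have [a [aH a0 a_cts a_clamp]] := lift_square H_cts alphaE.
have [c0 c1] : clamp (0 : R) = 0 /\ clamp (1 : R) = 1 by rewrite clamp_eq0// clamp_eq1.
have line_cts (x : R) : continuous (fun u : R => (x, u)).
  by apply: cts_pair; [exact: cts_cst|exact: cts_id].
have line_cts' (x : R) : continuous (fun u : R => (u, x)).
  by apply: cts_pair; [exact: cts_id|exact: cts_cst].
(* Over a constant path the lift is constant. The lifts on the two sides may differ by a permutation
   of the rings, since the loops may permute them. *)
have side0 t : a (0, t) = a (0, 0).
  apply: (constant_lift (c := set_val c) a_cts (line_cts 0)) => u.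
  by rewrite aH /clamp2 /= c0 (Hc _).1.
have side1 t : a (1, t) = a (1, 0).
  apply: (constant_lift (c := set_val c) a_cts (line_cts 1)) => u.
  by rewrite aH /clamp2 /= c1 (Hc _).2.
have coords i := lift_coordinates_cts i a_cts.
(* Along these sides the normals are [ex] up to sign, and a continuous choice of sign is
   constant. *)
have ends b : b = 0 \/ b = 1 -> forall i s, nml (a (s, b)) i = ex.
  move=> hb i s; have N_cts : continuous (fun s => nml (a (s, b)) i).
    have [_ _ h] := coords i.
    exact: (@cts_comp _ _ _ (fun p => nml (a p) i) _ h (line_cts' b)).
  have bS u : S (forget (a (u, b))).
    rewrite aH /clamp2 /=; case: hb => ->; rewrite ?c0 ?c1 ?Hf ?Hg; exact: set_valP.
  rewrite (@constant_sign R 3 _ ex ex_unit N_cts _ s 0).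
    by rewrite side0 a0 alphaN.
  by move=> u; have /S_E/(_ i)[] := bS u.
have [X [Y [XY_cts Y0 dj flatX [row0 row1 col0 col1]]]] := straighten
  (c := fun i p => ctr (a p) i) (N := fun i p => nml (a p) i) (r := fun i p => rad (a p) i)
  n0 (fun i => let: And3 h _ _ := coords i in h) (fun i => let: And3 _ h _ := coords i in h)
  (fun i => let: And3 _ _ h := coords i in h)
  (fun i p => congr1 (fun b => ctr b i) (a_clamp p))
  (fun i p => congr1 (fun b => rad b i) (a_clamp p))
  (fun i p => congr1 (fun b => nml b i) (a_clamp p))
  (fun i p => rad_gt0 (a p) i) (fun i p => nml_unit (a p) i)
  (fun p i j ij => rings_disjoint (a p) ij)
  (fun i t => conj (congr1 (fun b => ctr b i) (side0 t)) (congr1 (fun b => ctr b i) (side1 t)))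
  (fun i t => conj (congr1 (fun b => rad b i) (side0 t)) (congr1 (fun b => rad b i) (side1 t)))
  (fun i t => conj (etrans (congr1 (fun b => nml b i) (side0 t)) (ends 0 (or_introl erefl) i 0))
     (etrans (congr1 (fun b => nml b i) (side1 t)) (ends 0 (or_introl erefl) i 1)))
  (fun i s => conj (ends 0 (or_introl erefl) i s) (ends 1 (or_intror erefl) i s)).
pose m p : 'rV[@ring_data R]_n := \row_i (X i p, Y i p, ex).
have m_config p : is_config (m p).
  have mE i : m p 0 i = (X i p, Y i p, ex) by rewrite mxE.
  split=> [i|i|i j ij]; rewrite !mE; [exact: Y0|exact: ex_unit|].
  have d := dj p i j ij; split; first exact: d.
  exact: parallel_unlinked (Y0 i p) (Y0 j p) d.
pose b p : O := SigSub (mem_set (m_config p)).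
have bE p i : [/\ ctr (b p) i = X i p, rad (b p) i = Y i p & nml (b p) i = ex].
  by rewrite /ctr /rad /nml /= mxE.
have bS p : S (forget (b p)).
  apply/S_E => i; have [-> _ ->] := bE p i; split; first by left.
  move=> fl; apply: flatX => [j q|j q]; first by have [] := H_flat _ (a q) fl (aH q) j.
  by have [] := H_flat _ (a q) fl (aH q) j.
pose K p : S := SigSub (mem_set (bS p)).
have K_cts : continuous K.
  apply: cts_set_type; apply: (cts_comp (@forget_cts R n)); apply: cts_configuration => i.
  - have [h _] := XY_cts i; rewrite (_ : (fun p => ctr (b p) i) = X i)//.
    by apply/funext => p; have [] := bE p i.
  - have [_ h] := XY_cts i; rewrite (_ : (fun p => rad (b p) i) = Y i)//.
    by apply/funext => p; have [] := bE p i.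
  - rewrite (_ : (fun p => nml (b p) i) = fun=> ex); first exact: cts_cst.
    by apply/funext => p; have [] := bE p i.
have KE p (q : R * R) (d : S) : (forall i, X i p = ctr (a q) i /\ Y i p = rad (a q) i) ->
    (forall i, nml (a q) i = ex) -> forget (a q) = set_val d -> K p = d.
  move=> e1 e2 e3; apply: val_inj => /=; rewrite -[RHS]e3; congr forget.
  apply: ordered_ext => i; have [-> -> ->] := bE p i.
  by have [-> ->] := e1 i; rewrite e2.
(* The ends of the new homotopy are the given loops with pauses, due to the frame and to the
   excursion. *)
pose psi (s : R) := clamp (go (3 * s + -1)).
have psi_cts : continuous psi by rewrite /psi /go; cts; exact: cts_id.
have [psi0 psi1] : psi 0 = 0 /\ psi 1 = 1.
  by rewrite /psi /go clamp_eq0 ?clamp_eq1//; lra.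
have K0 s : K (s, 0) = f (psi s).
  apply: (KE _ (go (3 * s + -1), 0)) => [i|i|]; first exact: row0.
    exact: (ends 0 (or_introl erefl)).
  by rewrite aH /clamp2 /= c0 Hf clampK.
have K1 s : K (s, 1) = g (psi s).
  apply: (KE _ (go (3 * s + -1), 1)) => [i|i|]; first exact: row1.
    exact: (ends 1 (or_intror erefl)).
  by rewrite aH /clamp2 /= c1 Hg clampK.
have Kl t : K (0, t) = c.
  apply: (KE _ (0, 0)) => [i|i|]; first exact: col0.
    exact: (ends 0 (or_introl erefl)).
  by rewrite aH /clamp2 /= c0 (Hc _).1.
have Kr t : K (1, t) = c.
  apply: (KE _ (1, 0)) => [i|i|]; first exact: col1.
    exact: (ends 0 (or_introl erefl)).
  by rewrite aH /clamp2 /= c1 (Hc _).2.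
have K_line_cts x : {within `[0, 1]%classic, continuous (fun s : R => K (s, x))}.
  by apply: continuous_subspaceT; exact: (cts_comp K_cts (line_cts' x)).
pose f' := Loop (K_line_cts 0) (Kl 0) (Kr 0).
pose g' := Loop (K_line_cts 1) (Kl 1) (Kr 1).
have slow (u v : loop R c) : (forall s, v s = u (psi s)) -> loop_homotopic u v.
  move=> uv; apply: (@loop_reparam _ _ _ u v u id psi) => //.
  - exact: cts_id.
  - by move=> s s01; rewrite clampE.
  - by move=> s _; rewrite uv /psi clampK.
apply: loop_homotopic_trans (slow f f' K0) _.
apply: loop_homotopic_trans _ (loop_homotopic_sym (slow g g' K1)).
exists K; split=> //; exact: continuous_subspaceT.
Qed.

End spaces_of_parallel_rings.

(** * Injectivity on fundamental groups *)

Section injectivity.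
Context {R : realType} {X Y : topologicalType} (h : X -> Y) (h_cts : continuous h) (x : X).

(** Homotopies are extended to the whole plane by clamping, so that continuity on the square becomes
    plain continuity. *)
Lemma pi1_map_inj :
  (forall (f g : loop R x) (H : R * R -> Y), continuous H ->
    (forall s, H (s, 0) = h (f (clamp s))) -> (forall s, H (s, 1) = h (g (clamp s))) ->
    (forall t, H (0, t) = h x /\ H (1, t) = h x) -> loop_homotopic f g) ->
  injective (pi1_map R h_cts x).
Proof.
move=> hom a b /loop_classP/loop_homotopicP[H [H_cts H0 H1 Hc]].
rewrite -(loop_class_repr a) -(loop_class_repr b); apply/loop_classP.
exact: hom H_cts H0 H1 Hc.
Qed.

End injectivity.

Theorem proposition2p2 (R : realType) (n : nat) (hn : (1 <= n)%N) :
  [/\ forall c : UR R n,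
        injective (pi1_map R (set_val_continuous (UR R n)) c),
      forall c : UR R n,
        injective (pi1_map R (set_incl_continuous (UR_sub_VR n)) c) &
      forall c : UW R n,
        injective (pi1_map R (set_incl_continuous (UW_sub_W n)) c)].
Proof.
have UR_E a : UR R n (forget a) <->
    forall i, (nml a i = ex \/ nml a i = - ex) /\ (False -> ctr a i 0 2 = 0).
  by rewrite in_UR; split=> h i; [split=> //; exact: h|have [] := h i].
have UW_E a : UW R n (forget a) <->
    forall i, (nml a i = ex \/ nml a i = - ex) /\ (True -> ctr a i 0 2 = 0).
  by rewrite in_UW; split=> h i; have [h1 h2] := h i; split=> //; exact: h2.
have val_cts (A : set (ring_config R n)) (H : R * R -> A) :
    continuous H -> continuous (fun p => set_val (H p)).
  exact: (cts_comp (@set_val_continuous _ A)).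
split=> c; apply: pi1_map_inj => f g H H_cts H0 H1 Hc.
- exact: (parallel_loops_homotopic hn UR_E H_cts H0 H1 Hc).
- apply: (parallel_loops_homotopic hn UR_E (val_cts _ _ H_cts)) => // [s|s|t].
  + by rewrite H0.
  + by rewrite H1.
  + by have [-> ->] := Hc t.
- apply: (parallel_loops_homotopic hn UW_E (val_cts _ _ H_cts)) => [s|s|t|p a _ aH].
  + by rewrite H0.
  + by rewrite H1.
  + by have [-> ->] := Hc t.
  + by apply: in_W; rewrite aH; exact: set_valP.
Qed.
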